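(* Let $M$ be a closed subset of an $\mathbb{R}$-tree. Then the following are equivalent: (i) $\lambda(M)=0$; (ii) $\mathcal{F}(M)$ has the Schur property; (iii) $\mathcal{F}(M)$ has the Radon-Nikodým property; (iv) $\mathcal{F}(M)$ does not contain an isomorphic copy of $L_1$.
   Context: All Banach spaces are real; $L_1=L_1[0,1]$. For a metric space $(M,d)$ with a base point $0\in M$, $\mathrm{Lip}_0(M)$ is the Banach space of all Lipschitz functions $f\colon M\to\mathbb{R}$ with $f(0)=0$, normed by the Lipschitz constant $\|f\|_L$. Let $\delta\colon M\to \mathrm{Lip}_0(M)^*$, $\langle f,\delta(x)\rangle=f(x)$. The Lipschitz-free space is $\mathcal{F}(M)=\overline{\mathrm{span}}\,\delta(M)\subset \mathrm{Lip}_0(M)^*$. An $\mathbb{R}$-tree is an arc-connected metric space $(T,d)$ such that any two points $x\neq y$ are joined by a unique arc, and this arc is isometric to the real segment $[0,d(x,y)]$. The arc is denoted $[x,y]$ and called a segment; $\phi_{xy}\colon[x,y]\to[0,d(x,y)]$ denotes the isometry. Length measure $\lambda$ on $T$: a set $E\subset[x,y]$ is measurable if $\phi_{xy}(E)$ is Lebesgue measurable, and then $\lambda(E)$ is the Lebesgue measure of $\phi_{xy}(E)$. An arbitrary $E\subset T$ is measurable if $E\cap I$ is measurable for every segment $I$ of $T$, and then $\lambda(E)=\sup\{\sum_{k=1}^n\lambda(E\cap I_k): I_1,\dots,I_n \text{ disjoint segments in } T\}$. *)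

(* Defs.v *)
From HB Require Import structures.
From mathcomp Require Import all_boot all_order all_algebra.
From mathcomp Require Import all_classical all_reals all_analysis.

Set Implicit Arguments.
Unset Strict Implicit.
Unset Printing Implicit Defensive.

Import Order.TTheory GRing.Theory Num.Theory.
Import numFieldNormedType.Exports.

Local Open Scope classical_set_scope.
Local Open Scope ring_scope.

(* Subsets of metric spaces carry the restricted distance; the library already
   provides the underlying pseudometric structure on [set_type A]. *)
Section subset_metric.
Context {R : realType} {X : metricType R} (A : set X).

Let dist (x y : A) : R := mdist (set_val x) (set_val y).

Let dist_ge0 x y : 0 <= dist x y.
Proof. exact: mdist_ge0. Qed.

Let dist_positivity x y : dist x y = 0 -> x = y.
Proof. by move=> /mdist_positivity; rewrite set_valE => /val_inj. Qed.

Let ballE x (d : R) : ball x d = [set y | dist x y < d].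
Proof.
by rewrite [LHS](_ : _ = set_val @^-1` ball (set_val x) d)// ballEmdist.
Qed.

HB.instance Definition _ := @PseudoMetric_isMetric.Build R (set_type A)
  dist dist_ge0 dist_positivity ballE.

End subset_metric.

Section lip0.
Context {R : realType} {M : metricType R} (o : M).

Definition lipschitz_const (k : R) (f : M -> R) :=
  forall x y, `|f x - f y| <= k * mdist x y.

Definition lip0_pred : {pred M -> R} :=
  fun f => `[< f o = 0 /\ exists k, lipschitz_const k f >].

Lemma lip0_predP f :
  reflect (f o = 0 /\ exists k, lipschitz_const k f) (f \in lip0_pred).
Proof. exact: asboolP. Qed.

Record lip0 := Lip0 { lip0_fun :> M -> R; lip0_funP : lip0_fun \in lip0_pred }.

HB.instance Definition _ := [isSub for lip0_fun].
HB.instance Definition _ := [Choice of lip0 by <:].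

Lemma lip0_pred_submod : submod_closed lip0_pred.
Proof.
split.
  apply/lip0_predP; split => //; exists 0 => x y.
  by rewrite subrr normr0 mul0r.
move=> a f g /lip0_predP[f0 [k kf]] /lip0_predP[g0 [l lg]].
have E u : (a *: (f : M -> R^o) + g) u = a * f u + g u by [].
apply/lip0_predP; split; first by rewrite E f0 g0 mulr0 addr0.
exists (`|a| * k + l) => x y; rewrite !E opprD addrACA -mulrBr (le_trans (ler_normD _ _))// mulrDl lerD// normrM -mulrA.
by rewrite ler_wpM2l.
Qed.

HB.instance Definition _ :=
  GRing.isSubmodClosed.Build R (M -> R : lmodType R) lip0_pred lip0_pred_submod.
HB.instance Definition _ := [SubChoice_isSubLmodule of lip0 by <:].

(* For the empty set of quotients, [sup set0 = 0]. *)
Definition lip0_norm (f : lip0) : R :=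
  sup [set `|f xy.1 - f xy.2| / mdist xy.1 xy.2 | xy in
         [set xy : M * M | xy.1 <> xy.2]].

Lemma lip0_base (f : lip0) : f o = 0.
Proof. by have /lip0_predP[] := lip0_funP f. Qed.

Lemma lip0_normP (f : lip0) : lipschitz_const (lip0_norm f) f.
Proof.
move=> x y; have [->|/eqP xy] := eqVneq x y.
  by rewrite subrr normr0 mdistxx mulr0.
rewrite -ler_pdivrMr ?mdist_gt0; last exact/eqP.
apply: ub_le_sup; last by exists (x, y).
have /lip0_predP[_ [k kf]] := lip0_funP f.
exists k => _ [[u v] /= uv <-].
by rewrite ler_pdivrMr ?kf// mdist_gt0; exact/eqP.
Qed.

Lemma lip0_norm_le (f : lip0) (k : R) :
  0 <= k -> lipschitz_const k f -> lip0_norm f <= k.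
Proof.
move=> k0 kf; rewrite /lip0_norm; set A := [set _ | _ in _].
have [->|/set0P A0] := eqVneq A set0; first by rewrite sup0.
apply: ge_sup => // _ [[u v] /= uv <-].
by rewrite ler_pdivrMr ?kf// mdist_gt0; exact/eqP.
Qed.

Lemma lip0_norm_ge0 (f : lip0) : 0 <= lip0_norm f.
Proof.
rewrite /lip0_norm; set A := [set _ | _ in _].
have [->|/set0P[r]] := eqVneq A set0; first by rewrite sup0.
case=> -[u v] /= uv _; have := lip0_normP f u v => /(le_trans (normr_ge0 _)).
by rewrite pmulr_lge0// mdist_gt0; exact/eqP.
Qed.

Lemma lip0_ler_normD (f g : lip0) :
  lip0_norm (f + g) <= lip0_norm f + lip0_norm g.
Proof.
apply: lip0_norm_le => [|x y]; first by rewrite addr_ge0 ?lip0_norm_ge0.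
rewrite /= opprD addrACA mulrDl (le_trans (ler_normD _ _))//.
by rewrite lerD// lip0_normP.
Qed.

Lemma lip0_norm_eq0 (f : lip0) : lip0_norm f = 0 -> f = 0.
Proof.
move=> f0; apply: val_inj; apply/funext => x /=.
have := lip0_normP f x o; rewrite f0 mul0r lip0_base subr0 normr_le0.
by move/eqP.
Qed.

Let lip0_normZ_le (a : R) (f : lip0) :
  lip0_norm (a *: f) <= `|a| * lip0_norm f.
Proof.
apply: lip0_norm_le => [|x y]; first by rewrite mulr_ge0 ?lip0_norm_ge0.
rewrite /= -[X in `|X|]mulrBr normrM -mulrA ler_wpM2l//; exact: lip0_normP.
Qed.

Lemma lip0_normZ (a : R) (f : lip0) : lip0_norm (a *: f) = `|a| * lip0_norm f.
Proof.
apply/eqP; rewrite eq_le lip0_normZ_le/=.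
have [->|a0] := eqVneq a 0; first by rewrite normr0 mul0r lip0_norm_ge0.
rewrite -ler_pdivlMl ?normr_gt0// -normfV.
by rewrite -[X in lip0_norm X <= _](scalerK a0) lip0_normZ_le.
Qed.

HB.instance Definition _ :=
  Lmodule_isNormed.Build R lip0 lip0_ler_normD lip0_normZ lip0_norm_eq0.

Lemma lip0_normE (f : lip0) : `|f| = lip0_norm f.
Proof. by []. Qed.

End lip0.

Section dual_space.
Context {R : realType} (V : normedModType R).

Definition dual_pred : {pred V -> R} :=
  fun f => `[< linear (f : V -> R^o) /\
               exists k, forall x, `|f x| <= k * `|x| >].

Lemma dual_predP f :
  reflect (linear (f : V -> R^o) /\ exists k, forall x, `|f x| <= k * `|x|)
          (f \in dual_pred).
Proof. exact: asboolP. Qed.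

Record dual_space := Dual { dual_fun :> V -> R; dual_funP : dual_fun \in dual_pred }.

HB.instance Definition _ := [isSub for dual_fun].
HB.instance Definition _ := [Choice of dual_space by <:].

Lemma dual_pred_submod : submod_closed dual_pred.
Proof.
split.
  apply/dual_predP; split.
    move=> a x y; have E u : (0 : V -> R) u = 0 by [].
    by rewrite !E scaler0 addr0.
  by exists 0 => x; rewrite normr0 mul0r.
move=> a f g /dual_predP[lf [k kf]] /dual_predP[lg [l lg']].
have E u : (a *: (f : V -> R^o) + g) u = a * f u + g u by [].
apply/dual_predP; split.
  move=> b x y.
  rewrite !E lf lg [RHS]/(b * (a * f x + g x) + (a * f y + g y)).
  by rewrite /GRing.scale/= !mulrDr addrACA !mulrA [a * b]mulrC.
exists (`|a| * k + l) => x; rewrite E.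
by rewrite (le_trans (ler_normD _ _))// mulrDl lerD// normrM -mulrA ler_wpM2l.
Qed.

HB.instance Definition _ :=
  GRing.isSubmodClosed.Build R (V -> R : lmodType R) dual_pred dual_pred_submod.
HB.instance Definition _ := [SubChoice_isSubLmodule of dual_space by <:].

Definition dual_norm (f : dual_space) : R :=
  sup [set `|f x| | x in [set x : V | `|x| <= 1]].

Lemma dual_linear (f : dual_space) : linear (f : V -> R^o).
Proof. by have /dual_predP[] := dual_funP f. Qed.

HB.instance Definition _ (f : dual_space) :=
  GRing.isLinear.Build R V R^o *:%R (f : V -> R^o) (dual_linear f).

Let dual_norm_has_sup (f : dual_space) :
  has_sup [set `|f x| | x in [set x : V | `|x| <= 1]].
Proof.
split; first by exists `|f 0|; exists 0 => //=; rewrite normr0 ler01.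
have /dual_predP[_ [k kf]] := dual_funP f.
exists `|k| => _ [x /= x1 <-]; rewrite (le_trans (kf x))//.
rewrite (le_trans (ler_wpM2r (normr_ge0 _) (ler_norm k)))//.
by rewrite -[leRHS]mulr1 ler_wpM2l.
Qed.

Lemma dual_norm_ge0 (f : dual_space) : 0 <= dual_norm f.
Proof.
apply: (@le_trans _ _ `|f 0|) => //; apply: ub_le_sup.
  by case: (dual_norm_has_sup f).
by exists 0 => //=; rewrite normr0 ler01.
Qed.

Lemma dual_normP (f : dual_space) x : `|f x| <= dual_norm f * `|x|.
Proof.
have fZ a u : f (a *: u) = a * f u by exact: (linearZ_LR (f : {linear V -> R^o})).
have [->|x0] := eqVneq x 0.
  by rewrite -(scale0r 0) fZ mul0r normr0 mulr_ge0 ?dual_norm_ge0.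
rewrite -ler_pdivrMr ?normr_gt0// mulrC -{1}[`|x|]normr_id -normfV -normrM -fZ.
apply: ub_le_sup; first by case: (dual_norm_has_sup f).
by exists (`|x|^-1 *: x) => //=; rewrite normrZ normfV normr_id mulVf ?normr_eq0.
Qed.

Lemma dual_norm_le (f : dual_space) (k : R) :
  0 <= k -> (forall x, `|f x| <= k * `|x|) -> dual_norm f <= k.
Proof.
move=> k0 kf; apply: ge_sup; first by case: (dual_norm_has_sup f).
move=> _ [x /= x1 <-]; rewrite (le_trans (kf x))//.
by rewrite -[leRHS]mulr1 ler_wpM2l.
Qed.

Lemma dual_ler_normD (f g : dual_space) :
  dual_norm (f + g) <= dual_norm f + dual_norm g.
Proof.
apply: dual_norm_le => [|x]; first by rewrite addr_ge0 ?dual_norm_ge0.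
by rewrite (le_trans (ler_normD _ _))// mulrDl lerD// dual_normP.
Qed.

Lemma dual_norm_eq0 (f : dual_space) : dual_norm f = 0 -> f = 0.
Proof.
move=> f0; apply: val_inj; apply/funext => x /=.
by have := dual_normP f x; rewrite f0 mul0r normr_le0 => /eqP.
Qed.

Let dual_normZ_le (a : R) (f : dual_space) : dual_norm (a *: f) <= `|a| * dual_norm f.
Proof.
apply: dual_norm_le => [|x]; first by rewrite mulr_ge0 ?dual_norm_ge0.
by rewrite [X in `|X|]/(a * f x) normrM -mulrA ler_wpM2l// dual_normP.
Qed.

Lemma dual_normZ (a : R) (f : dual_space) : dual_norm (a *: f) = `|a| * dual_norm f.
Proof.
apply/eqP; rewrite eq_le dual_normZ_le/=.
have [->|a0] := eqVneq a 0; first by rewrite normr0 mul0r dual_norm_ge0.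
rewrite -ler_pdivlMl ?normr_gt0// -normfV.
by rewrite -[X in dual_norm X <= _](scalerK a0) dual_normZ_le.
Qed.

HB.instance Definition _ :=
  Lmodule_isNormed.Build R dual_space dual_ler_normD dual_normZ dual_norm_eq0.

Lemma dual_normE (f : dual_space) : `|f| = dual_norm f.
Proof. by []. Qed.

End dual_space.

Section free_space.
Context {R : realType} {M : metricType R} (o : M).

Definition eval_at (x : M) (f : lip0 o) : R := f x.

Lemma eval_at_dual x : eval_at x \in @dual_pred R (lip0 o).
Proof.
apply/dual_predP; split => [a f g|]; first by [].
exists (mdist x o) => f; have := lip0_normP f x o.
by rewrite lip0_base subr0 mulrC.
Qed.

Definition free_delta (x : M) : dual_space (lip0 o) := Dual (eval_at_dual x).

Definition delta_span : set (dual_space (lip0 o)) :=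
  [set m | exists n (a : 'I_n -> R) (x : 'I_n -> M),
             m = \sum_(i < n) a i *: free_delta (x i)].

Definition free_pred : {pred dual_space (lip0 o)} :=
  fun m => `[< closure delta_span m >].

Lemma free_predP m : reflect (closure delta_span m) (m \in free_pred).
Proof. exact: asboolP. Qed.

Record free_space := Free { free_val :> dual_space (lip0 o);
                           free_valP : free_val \in free_pred }.

HB.instance Definition _ := [isSub for free_val].
HB.instance Definition _ := [Choice of free_space by <:].

Lemma free_pred_submod : submod_closed free_pred.
Proof.
have clP m : m \in free_pred <-> forall e : R, 0 < e ->
    exists2 p, delta_span p & `|m - p| < e.
  split=> [/free_predP cm e e0|h]; last first.
    apply/free_predP => B /nbhs_ballP[e /= e0 eB].
    have [p sp mp] := h _ e0; exists p; split => //; apply: eB.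
    by rewrite -ball_normE.
  have [p [sp]] := cm _ (nbhsx_ballx m e e0).
  by rewrite -ball_normE /= => mp; exists p.
have span0 : delta_span 0.
  by exists 0, (fun=> 0), (fun=> o); rewrite big_ord0.
have spanD p q : delta_span p -> delta_span q -> delta_span (p + q).
  move=> [n [a [x ->]]] [m [b [y ->]]]; exists (n + m)%N.
  exists (fun i => match fintype.split i with inl j => a j | inr j => b j end).
  exists (fun i => match fintype.split i with inl j => x j | inr j => y j end).
  rewrite big_split_ord/=; congr (_ + _); apply: eq_bigr => i _.
    by rewrite (unsplitK (inl i)).
  by rewrite (unsplitK (inr i)).
have spanZ c p : delta_span p -> delta_span (c *: p).
  move=> [n [a [x ->]]]; exists n, (fun i => c * a i), x.
  by rewrite scaler_sumr; apply: eq_bigr => i _; rewrite scalerA.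
split; first by apply/clP => e e0; exists 0 => //; rewrite subrr normr0.
move=> c u v /clP uP /clP vP; apply/clP => e e0.
have c1 : 0 < `|c| + 1 by rewrite ltr_wpDl.
have [p sp up] := uP (e / 2 / (`|c| + 1)) (divr_gt0 (divr_gt0 e0 (ltr0Sn R 1)) c1).
have [q sq vq] := vP (e / 2) (divr_gt0 e0 (ltr0Sn R 1)).
exists (c *: p + q); first by apply: spanD => //; exact: spanZ.
rewrite opprD addrACA -scalerBr (le_lt_trans (ler_normD _ _))//.
rewrite [e]splitr ler_ltD// normrZ.
rewrite (@le_trans _ _ ((`|c| + 1) * `|u - p|))//.
  by rewrite ler_wpM2r// lerDl.
by rewrite mulrC -ler_pdivlMr// ltW.
Qed.

HB.instance Definition _ :=
  GRing.isSubmodClosed.Build R (dual_space (lip0 o)) free_pred free_pred_submod.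
HB.instance Definition _ := [SubChoice_isSubLmodule of free_space by <:].

Definition free_norm (m : free_space) : R := `|free_val m|.

Lemma free_ler_normD (m n : free_space) :
  free_norm (m + n) <= free_norm m + free_norm n.
Proof. exact: ler_normD. Qed.

Lemma free_normZ (a : R) (m : free_space) : free_norm (a *: m) = `|a| * free_norm m.
Proof. exact: normrZ. Qed.

Lemma free_norm_eq0 (m : free_space) : free_norm m = 0 -> m = 0.
Proof. by move=> /normr0_eq0 m0; exact: val_inj. Qed.

HB.instance Definition _ :=
  Lmodule_isNormed.Build R free_space free_ler_normD free_normZ free_norm_eq0.

End free_space.

Section rtree.
Context {R : realType} (T : metricType R).

(* A continuous injection of [0, 1] is a homeomorphism onto its image. *)
Definition is_arc (x y : T) (A : set T) : Prop :=
  exists g : R -> T,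
    [/\ {within `[0, 1]%classic, continuous g},
        {in `[0, 1]%classic &, injective g},
        g 0 = x, g 1 = y & A = g @` `[0, 1]%classic].

Definition isometric_to_segment (A : set T) (l : R) : Prop :=
  exists phi : T -> R,
    (forall u v, A u -> A v -> `|phi u - phi v| = mdist u v) /\
    phi @` A = `[0, l]%classic.

Definition is_rtree : Prop :=
  forall x y : T, x <> y ->
    exists A, [/\ is_arc x y A, forall B, is_arc x y B -> B = A &
                  isometric_to_segment A (mdist x y)].

Definition segment (x y : T) : set T :=
  [set z | exists2 A, is_arc x y A & A z].

(* In an R-tree, [mdist x] restricted to [segment x y] is the isometry onto
   [0, mdist x y] mapping x to 0. *)
Definition segment_measure (E : set T) (x y : T) : \bar R :=
  lebesgue_measure (mdist x @` (E `&` segment x y)).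

(* [lebesgue_measure] is defined on all sets (as an outer measure), so no
   measurability is required here; closed sets E always are measurable. *)
Definition length_measure (E : set T) : \bar R :=
  ereal_sup [set s | exists n (p : 'I_n -> T * T),
    [/\ forall i, (p i).1 <> (p i).2,
        trivIset setT (fun i => segment (p i).1 (p i).2) &
        s = (\sum_(i < n) segment_measure E (p i).1 (p i).2)%E]].

End rtree.

Section banach_properties.
Context {R : realType} (V : normedModType R).

Definition weakly_cvg (u : nat -> V) (x : V) : Prop :=
  forall f : dual_space V, f (u n) @[n --> \oo] --> f x.

Definition Schur_property : Prop :=
  forall (u : nat -> V) (x : V), weakly_cvg u x -> u n @[n --> \oo] --> x.

Section bochner.
Context d (S : measurableType d) (mu : {finite_measure set S -> \bar R}).

Definition simple_fun (s : S -> V) : Prop :=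
  finite_set (range s) /\ forall v, measurable (s @^-1` [set v]).

Definition simple_integral (A : set S) (s : S -> V) : V :=
  \sum_(v \in range s) fine (mu (s @^-1` [set v] `&` A)) *: v.

Definition strongly_measurable (g : S -> V) : Prop :=
  exists2 s : nat -> S -> V, forall n, simple_fun (s n) &
    {ae mu, forall x, s n x @[n --> \oo] --> g x}.

Definition L1_approx (g : S -> V) (s : nat -> S -> V) : Prop :=
  (forall n, simple_fun (s n)) /\
  (\int[mu]_x `|s n x - g x|%:E)%E @[n --> \oo] --> 0%E.

Definition bochner_integrable (g : S -> V) : Prop :=
  strongly_measurable g /\ exists s, L1_approx g s.

Definition is_bochner_integral (A : set S) (g : S -> V) (v : V) : Prop :=
  exists2 s, L1_approx g s & simple_integral A (s n) @[n --> \oo] --> v.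

Definition vector_measure (G : set S -> V) : Prop :=
  forall F : nat -> set S, (forall k, measurable (F k)) -> trivIset setT F ->
    series (fun k => G (F k)) @ \oo --> G (\bigcup_k F k).

Definition vector_bounded_variation (G : set S -> V) : Prop :=
  exists C : R, forall n (E : 'I_n -> set S),
    (forall i, measurable (E i)) -> trivIset setT E ->
    \sum_(i < n) `|G (E i)| <= C.

Definition vector_abs_continuous (G : set S -> V) : Prop :=
  forall A, measurable A -> mu A = 0%E -> G A = 0.

End bochner.

Definition Radon_Nikodym_property : Prop :=
  forall (d : measure_display) (S : measurableType d)
         (mu : {finite_measure set S -> \bar R}) (G : set S -> V),
    vector_measure G -> vector_bounded_variation G -> vector_abs_continuous mu G ->
    exists2 g : S -> V, bochner_integrable mu g &
      forall A, measurable A -> is_bochner_integral mu A g (G A).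

Definition lebesgue01 : {measure set (measurableTypeR R) -> \bar R} :=
  mrestr lebesgue_measure (measurable_itv `[0%R, 1%R]).

(* [LfunType] is the space of integrable functions before the quotient by
   almost everywhere equality. The lower and upper bounds make L constant on
   classes and turn it into an isomorphic embedding of the quotient L_1[0,1]. *)
Definition contains_L1 : Prop :=
  exists (L : {linear LfunType lebesgue01 (lexx 1%E) -> V}) (c C : R),
    0 < c /\ forall f : LfunType lebesgue01 (lexx 1%E),
      c * fine 'N[lebesgue01]_1[EFin \o f] <= `|L f| <=
      C * fine 'N[lebesgue01]_1[EFin \o f].

End banach_properties.

(* Main.v *)
Require Import Defs.
From HB Require Import structures.
From mathcomp Require Import all_boot all_order all_algebra.
From mathcomp Require Import all_classical all_reals all_analysis.
From mathcomp Require Import measurable_realfun lra ring.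

Set Implicit Arguments.
Unset Strict Implicit.
Unset Printing Implicit Defensive.

Import Order.TTheory GRing.Theory Num.Theory.
Import numFieldNormedType.Exports.

Local Open Scope classical_set_scope.
Local Open Scope ring_scope.

(** The case of length zero and the case of positive length both compare Lipschitz functions
    with integrals of bounded functions along segments; in the former, along the segments
    issued from the base point o, the rays.

    In an R-tree two rays share an initial part and then separate for good
    ([geodesic_branch]), so the length of what they do not share is the distance between
    their ends. Hence, for a measurable function g on the tree with |g| <= 1, the integral of
    g along the ray to x is a 1-Lipschitz function of x; and every 1-Lipschitz function
    that vanishes at o is a pointwise limit of such integrals, those of its difference
    quotients. Each m in the free space thus acts as a charge on the functions g, and its norm
    is the total variation of this charge ([norm_ray_rep]). In particular the norm is additive
    over disjoint regions of the tree.

    Assume that M has length zero. Since M is closed, the regions of the points at distance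
    more than 1/n from M and at most n from o carry, in the limit, the whole variation. In
    such a region, integrals along rays do not distinguish points of M that are close to each
    other, and so the variation is dominated by that of a second family of charges, acting on
    the functions on M that are locally constant at scale 1/n. That variation is in turn
    carried by finite unions of classes of points joined by short steps, and over one class it
    is the absolute value of a single functional. So the norm is obtained from absolute
    values of functionals by sums, domination and exhaustion by regions: it is [tame]
    ([tame_free_norm]). Weakly null sequences converge to 0 for every tame seminorm: the only
    case with content is exhaustion, which is a gliding hump argument ([gliding_hump]). This
    is the Schur property. Likewise the averages of a vector measure of bounded variation over
    finer and finer finite partitions converge to it in variation: for a functional this is
    the scalar Radon-Nikodym theorem, and exhaustion is handled by choosing a region that
    carries almost all of the variation of the measure ([averageable_glue]). The averages are
    integrals of step functions, which converge to a density ([bochner_density]).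

    Assume that M has positive length. Then some segment meets M in a set K of positive
    measure, isometric to a closed set of reals. Sending the indicator function of ]p, q], for
    p and q in K, to the difference of the points at q and p is isometric on step functions
    ([step_elt_norm]), and it extends to the integrable functions supported in K, that is, to
    a space isometric to L1[0, 1] up to a factor: the free space contains L1.

    Finally L1 lacks both properties, and so does every space that contains it. The functions
    of Rademacher type, with values 1 and -1, are weakly null by the inequality of Bessel and
    have norm 1 ([L1_no_Schur]). The measure sending A to its indicator function has no
    density: a step function close to a density cannot distinguish a set that halves all its
    steps from the complement of that set ([L1_no_RNP]). *)

(** * Evaluation functionals and completeness of the free space *)

Lemma cvg_finite_sum (R : realType) (I : Type) (r : seq I)
    (f : I -> nat -> R) (l : I -> R) :
  (forall i, f i k @[k --> \oo] --> l i) ->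
  (\sum_(i <- r) f i k) @[k --> \oo] --> \sum_(i <- r) l i.
Proof.
move=> fl; elim: r => [|i r ih].
  by under eq_fun do rewrite big_nil; rewrite big_nil; exact: cvg_cst.
by under eq_fun do rewrite big_cons; rewrite big_cons; exact: cvgD.
Qed.

Section free_space_basics.
Context {R : realType} {N : metricType R} (o : N).

(** The value 0 at functions that are not Lipschitz or do not vanish at o keeps this total. *)
Definition lip0_of (f : N -> R) : lip0 o := insubd 0 f.

Lemma lip0_ofE (f : N -> R) (k : R) :
  f o = 0 -> lipschitz_const k f -> lip0_of f = f :> (N -> R).
Proof.
move=> f0 kf; apply: (insubdK (0 : lip0 o)); apply/lip0_predP; split => //.
by exists k.
Qed.

Lemma lip0_norm_const (f : lip0 o) (k : R) :
  0 <= k -> lipschitz_const k f -> `|f| <= k.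
Proof. exact: (@lip0_norm_le R N o f k). Qed.

Lemma free_eval_dual (f : lip0 o) :
  (fun m : free_space o => free_val m f) \in @dual_pred R (free_space o).
Proof.
apply/dual_predP; split => [a m n //|].
by exists `|f| => m; rewrite mulrC; exact: dual_normP.
Qed.

Definition free_eval (f : lip0 o) : dual_space (free_space o) := Dual (free_eval_dual f).

Lemma free_pair_le (m : free_space o) (f : lip0 o) :
  `|free_val m f| <= `|m| * `|f|.
Proof. exact: dual_normP. Qed.

Lemma free_eval_norm (f : lip0 o) : `|free_eval f| <= `|f|.
Proof.
rewrite dual_normE; apply: dual_norm_le => // m.
by rewrite mulrC; exact: free_pair_le.
Qed.

Lemma dual_le (V : normedModType R) (f : dual_space V) v :
  `|f v| <= `|f| * `|v|.
Proof. exact: dual_normP. Qed.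

Lemma dualD (V : normedModType R) (f : dual_space V) u v :
  f (u + v) = f u + f v.
Proof. exact: (linearD (f : {linear V -> R^o})). Qed.

Lemma dualB (V : normedModType R) (f : dual_space V) u v :
  f (u - v) = f u - f v.
Proof. exact: (linearB (f : {linear V -> R^o})). Qed.

Lemma dualN (V : normedModType R) (f : dual_space V) u :
  f (- u) = - f u.
Proof. exact: (linearN (f : {linear V -> R^o})). Qed.

Lemma dual0 (V : normedModType R) (f : dual_space V) : f 0 = 0.
Proof. exact: (linear0 (f : {linear V -> R^o})). Qed.

Lemma dualZ (V : normedModType R) (f : dual_space V) a u :
  f (a *: u) = a * f u.
Proof. exact: (linearZ_LR (f : {linear V -> R^o})). Qed.

Lemma dual_sum (V : normedModType R) (f : dual_space V) I (r : seq I)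
    (P : pred I) (u : I -> V) :
  f (\sum_(i <- r | P i) u i) = \sum_(i <- r | P i) f (u i).
Proof. exact: (linear_sum (f : {linear V -> R^o})). Qed.

(** By homogeneity and symmetry, one-sided bounds on 1-Lipschitz functions suffice. *)
Lemma free_norm_le (m : free_space o) (C : R) : 0 <= C ->
  (forall f : lip0 o, lipschitz_const 1 f -> free_val m f <= C) -> `|m| <= C.
Proof.
move=> C0 mC; apply: dual_norm_le => // f.
have [/eqP|f0] := eqVneq `|f| 0.
  by rewrite normr_eq0 => /eqP ->; rewrite dual0 !normr0 mulr0.
have fgt : 0 < `|f| by rewrite lt_def f0/=.
have H (g : lip0 o) : `|g| = 1 -> free_val m g <= C.
  move=> g1; apply: mC => x y; rewrite -g1 lip0_normE; exact: lip0_normP.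
rewrite mulrC -ler_pdivrMl// -{1}[`|f|]normr_id -normfV -normrM -dualZ.
have n1 : `| `|f|^-1 *: f| = 1.
  by rewrite normrZ normfV normr_id mulVf.
rewrite ler_norml H// andbT lerNl -dualN; apply: H.
by rewrite normrN.
Qed.

Lemma free_point_pred (x : N) : free_delta o x \in @free_pred R N o.
Proof.
apply/free_predP; apply: subset_closure.
by exists 1%N, (fun=> 1), (fun=> x); rewrite big_ord1 scale1r.
Qed.

Definition free_point (x : N) : free_space o := Free (free_point_pred x).

Lemma free_val_sum (I : Type) (r : seq I) (P : pred I) (u : I -> free_space o) :
  free_val (\sum_(i <- r | P i) u i) = \sum_(i <- r | P i) free_val (u i).
Proof. by elim/big_rec2: _ => // i y1 y2 _ <-. Qed.

Lemma free_sumE (I : Type) (r : seq I) (P : pred I) (u : I -> free_space o) f :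
  free_val (\sum_(i <- r | P i) u i) f = \sum_(i <- r | P i) free_val (u i) f.
Proof. exact: (dual_sum (free_eval f)). Qed.

Lemma free_dense (m : free_space o) (e : R) : 0 < e ->
  exists n (a : 'I_n -> R) (x : 'I_n -> N),
    `|m - \sum_(i < n) a i *: free_point (x i)| <= e.
Proof.
move=> e0; have /free_predP cm := free_valP m.
have [p [[n [a [x ->]]]]] := cm _ (nbhsx_ballx (free_val m) e e0).
rewrite -ball_normE /= => mp; exists n, a, x.
have E : free_val (m - \sum_(i < n) a i *: free_point (x i)) =
    free_val m - \sum_(i < n) a i *: free_delta o (x i).
  by rewrite -(free_val_sum _ _ (fun i => a i *: free_point (x i))).
by change (`|free_val (m - \sum_(i < n) a i *: free_point (x i))| <= e); rewrite E ltW.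
Qed.

(** Finite combinations of evaluations are continuous for pointwise convergence, and they
    approximate m uniformly on bounded sets of Lipschitz functions. *)
Lemma free_pointwise_cvg (m : free_space o) (f : nat -> lip0 o) (g : lip0 o)
    (C : R) : (forall n, `|f n| <= C) ->
  (forall x, f n x @[n --> \oo] --> g x) ->
  free_val m (f n) @[n --> \oo] --> free_val m g.
Proof.
move=> fC fg; apply/cvgrPdist_le => e e0.
have C0 : 0 <= C by exact: le_trans (fC 0%N).
pose D := C + `|g| + 1.
have D0 : 0 < D by rewrite ltr_wpDl// addr_ge0.
have [n [a [x mx]]] := free_dense m (divr_gt0 (divr_gt0 e0 (ltr0Sn R 1)) D0).
set p := \sum_(i < n) _ in mx.
have pf (h : lip0 o) : free_val p h = \sum_(i < n) a i * h (x i).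
  by rewrite free_sumE.
have : free_val p (f k) @[k --> \oo] --> free_val p g.
  rewrite pf; under eq_fun do rewrite pf.
  apply: cvg_finite_sum => i.
  by apply: cvgM; [exact: cvg_cst|exact: fg].
move=> /cvgrPdist_le/(_ (e / 2))/(_ (divr_gt0 e0 (ltr0Sn R 1))).
apply: filterS => k H.
rewrite -dualB.
have -> : free_val m (g - f k) = free_val p (g - f k) + free_val (m - p) (g - f k).
  have -> : free_val (m - p) (g - f k) = free_val m (g - f k) - free_val p (g - f k) by [].
  by rewrite subrKC.
rewrite (le_trans (ler_normD _ _))// [leRHS]splitr lerD//; first by rewrite dualB.
rewrite (le_trans (free_pair_le _ _))//.
rewrite (@le_trans _ _ (e / 2 / D * D))//; last by rewrite divfK// gt_eqF.
rewrite ler_pM//.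
by rewrite (le_trans (ler_normB _ _))// /D addrC (le_trans (lerD (fC k) (lexx _)))// lerDl.
Qed.

Lemma real_cauchy_cvg (a : nat -> R) :
  (forall e : R, 0 < e ->
     \forall n \near \oo, forall k, (n <= k)%N -> `|a n - a k| <= e) ->
  exists l : R, a n @[n --> \oo] --> l.
Proof.
move=> ca; suff : cvg (a n @[n --> \oo]) by exists (lim (a n @[n --> \oo])).
apply/cauchy_cvgP/cauchy_exP => e e0.
have [n _ /(_ n (leqnn n)) H] := ca (e / 2) (divr_gt0 e0 (ltr0Sn R 1)).
exists (a n); exists n => // k /= nk.
rewrite -ball_normE/= (le_lt_trans (H k nk))//.
by rewrite ltr_pdivrMr// ltr_pMr// (ltrDl 1).
Qed.

(** A Cauchy sequence has a pointwise limit in the dual of the Lipschitz functions, and the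
    free space is closed there. *)
Lemma free_complete (u : nat -> free_space o) :
  (forall e : R, 0 < e ->
     \forall n \near \oo, forall k, (n <= k)%N -> `|u n - u k| <= e) ->
  exists m : free_space o, u n @[n --> \oo] --> m.
Proof.
move=> cu.
have uf (f : lip0 o) : exists l : R, free_val (u n) f @[n --> \oo] --> l.
  apply: real_cauchy_cvg => e e0.
  have f1 : 0 < `|f| + 1 by rewrite ltr_wpDl.
  apply: filterS (cu _ (divr_gt0 e0 f1)) => n H k nk.
  rewrite (_ : _ - _ = free_val (u n - u k) f)//.
  rewrite (le_trans (free_pair_le _ _))//.
  rewrite (le_trans (ler_wpM2r (normr_ge0 _) (H k nk)))//.
  by rewrite mulrAC ler_pdivrMr// ler_pM2l// lerDl.
have [l lu] := choice uf.
have lin : linear (l : lip0 o -> R^o).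
  move=> a f g; apply: (cvg_unique _ (lu (a *: f + g))).
    exact: Rhausdorff.
  have -> : (fun n => free_val (u n) (a *: f + g)) =
            (fun n => a * free_val (u n) f + free_val (u n) g).
    by apply/funext => n; rewrite dualD dualZ.
  by apply: cvgD; [apply: cvgM; [exact: cvg_cst|exact: lu]|exact: lu].
have bnd : forall e : R, 0 < e -> \forall n \near \oo, forall f, `|free_val (u n) f - l f| <= e * `|f|.
  move=> e e0; apply: filterS (cu e e0) => n H f.
  have C : `|free_val (u n) f - free_val (u k) f| @[k --> \oo] --> `|free_val (u n) f - l f|.
    by apply: cvg_norm; apply: cvgB; [exact: cvg_cst|exact: lu].
  apply: (closed_cvg (fun x : R => x <= e * `|f|)) C; first exact: closed_le.
  exists n => // k /= nk.
  rewrite (_ : _ - _ = free_val (u n - u k) f)// (le_trans (free_pair_le _ _))//.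
  by rewrite ler_wpM2r// H.
have ldual : l \in @dual_pred R (lip0 o).
  apply/dual_predP; split => //.
  have [n _ /(_ n (leqnn n)) H] := bnd 1 ltr01.
  exists (`|u n| + 1) => f.
  rewrite -[l f](subKr (free_val (u n) f)) (le_trans (ler_normB _ _))//.
  by rewrite mulrDl lerD// free_pair_le.
pose L := Dual ldual.
have Lu : forall e : R, 0 < e -> \forall n \near \oo, `|free_val (u n) - L| <= e.
  move=> e e0; apply: filterS (bnd e e0) => n H.
  by rewrite dual_normE; apply: dual_norm_le => //; exact: ltW.
have Lfree : L \in @free_pred R N o.
  apply/free_predP => B /nbhs_ballP[e /= e0 eB].
  have [n _ /(_ n (leqnn n)) H] := Lu (e / 3) (divr_gt0 e0 (ltr0Sn R 2)).
  have [k [a [x ax]]] := free_dense (u n) (divr_gt0 e0 (ltr0Sn R 2)).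
  exists (\sum_(i < k) a i *: free_delta o (x i)); split; first by exists k, a, x.
  apply: eB; rewrite -ball_normE/=.
  rewrite -[X in `|X|](subrKA (free_val (u n))) (le_lt_trans (ler_normD _ _))//.
  have ax' : `|free_val (u n) - \sum_(i < k) a i *: free_delta o (x i)| <= e / 3.
    rewrite -(free_val_sum _ _ (fun i => a i *: free_point (x i))).
    exact: ax.
  rewrite distrC (le_lt_trans (lerD H ax'))//; lra.
exists (Free Lfree); apply/cvgrPdist_le => e e0.
by apply: filterS (Lu e e0) => n; rewrite distrC.
Qed.

End free_space_basics.

(** * Tame seminorms and the Schur property *)

Section charge_rep.
Context {R : realType} (V : normedModType R) (W : Type).

(** Linear functionals on V indexed by the bounded functions of an algebra [adm] of functions
    on W, so that each v : V acts as a charge of bounded variation on W. Only the unit ball of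
    [adm] is meaningful as a domain of [chg], hence the bounds in the additivity axioms. *)
Record charge_rep := ChargeRep {
  adm : set (W -> R);
  chg : (W -> R) -> dual_space V;
  chg_bound : R;
  adm1 : adm (cst 1);
  admN : forall g, adm g -> adm (\- g);
  admD : forall g h, adm g -> adm h -> adm (g \+ h);
  admM : forall g h, adm g -> adm h -> adm (g \* h);
  adm_lim : forall (g : nat -> W -> R) h, (forall n, adm (g n)) ->
    (forall w, g n w @[n --> \oo] --> h w) -> adm h;
  chgN : forall g, adm g -> (forall w, `|g w| <= 1) -> chg (\- g) = - chg g;
  chgD : forall g h, adm g -> adm h -> (forall w, `|g w| <= 1) ->
    (forall w, `|h w| <= 1) -> (forall w, `|g w + h w| <= 1) ->
    chg (g \+ h) = chg g + chg h;
  chg_le : forall g, adm g -> (forall w, `|g w| <= 1) -> `|chg g| <= chg_bound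
}.

Variable S : charge_rep.

Definition aball : set (W -> R) := [set g | adm S g /\ forall w, `|g w| <= 1].

Definition region (E : set W) : Prop := adm S (\1_E : W -> R).

(** The variation over E of the charge on W defined by v. *)
Definition total_var (E : set W) (v : V) : R :=
  sup [set chg S (g \* (\1_E : W -> R)) v | g in aball].

Lemma adm0 : adm S (cst 0).
Proof.
have -> : cst 0 = (cst 1 : W -> R) \+ \- cst 1.
  by apply/funext => w /=; rewrite subrr.
by apply: admD; [exact: adm1|apply: admN; exact: adm1].
Qed.

Lemma indic_le1 (E : set W) w : `|(\1_E w : R)| <= 1.
Proof. by rewrite indicE; case: (_ \in _); rewrite ?normr1 ?normr0. Qed.

Lemma regionT : region setT.
Proof. by rewrite /region indicT; exact: adm1. Qed.

Lemma regionC E : region E -> region (~` E).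
Proof.
move=> rE; rewrite /region.
have -> : \1_(~` E) = (cst 1 : W -> R) \+ \- \1_E.
  apply/funext => w /=; rewrite !indicE in_setC.
  by case: (_ \in _); rewrite /= ?subrr ?subr0.
by apply: admD; [exact: adm1|exact: admN].
Qed.

Lemma regionI E E' : region E -> region E' -> region (E `&` E').
Proof.
move=> rE rE'; rewrite /region.
have -> : \1_(E `&` E') = (\1_E : W -> R) \* \1_E'.
  by apply/funext => w /=; rewrite indicI.
exact: admM.
Qed.

Lemma regionD E E' : region E -> region E' -> region (E `\` E').
Proof. by move=> rE rE'; rewrite setDE; apply: regionI => //; exact: regionC. Qed.

Lemma regionU E E' : region E -> region E' -> region (E `|` E').
Proof.
move=> rE rE'; rewrite -[_ `|` _]setCK setCU.
by apply: regionC; apply: regionI; exact: regionC.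
Qed.

Lemma aballI g E : aball g -> region E -> aball (g \* (\1_E : W -> R)).
Proof.
move=> [ag g1] rE; split; first exact: admM.
by move=> w /=; rewrite normrM mulr_ile1// ?indic_le1.
Qed.

Lemma aballN g : aball g -> aball (\- g).
Proof. by move=> [ag g1]; split; [exact: admN|move=> w /=; rewrite normrN]. Qed.

Lemma aball0 : aball (cst 0).
Proof. by split; [exact: adm0|move=> w; rewrite normr0]. Qed.

Lemma chg_aball g v : aball g -> chg S g v <= chg_bound S * `|v|.
Proof.
move=> [ag g1]; rewrite (le_trans (ler_norm _))// (le_trans (dual_le _ _))//.
by rewrite ler_wpM2r//; exact: chg_le.
Qed.

Lemma chgNE g v : aball g -> chg S (\- g) v = - chg S g v.
Proof. by move=> [ag g1]; rewrite chgN. Qed.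

Lemma chgDE g h v : aball g -> aball h -> aball (g \+ h) ->
  chg S (g \+ h) v = chg S g v + chg S h v.
Proof. by move=> [ag g1] [ah h1] [_ gh1]; rewrite chgD. Qed.

Let has_sup_tv E v : region E ->
  has_sup [set chg S (g \* (\1_E : W -> R)) v | g in aball].
Proof.
move=> rE; split.
  by exists (chg S (cst 0 \* \1_E) v), (cst 0) => //; exact: aball0.
exists (chg_bound S * `|v|) => _ [g ag <-].
by apply: chg_aball; exact: aballI.
Qed.

Lemma total_var_ub E g v : region E -> aball g ->
  chg S (g \* (\1_E : W -> R)) v <= total_var E v.
Proof.
move=> rE ag; apply: ub_le_sup; first by case: (has_sup_tv v rE).
by exists g.
Qed.

Lemma total_var_abs E g v : region E -> aball g ->
  `|chg S (g \* (\1_E : W -> R)) v| <= total_var E v.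
Proof.
move=> rE ag; rewrite ler_norml total_var_ub// andbT lerNl -chgNE; last exact: aballI.
have -> : (\- (g \* (\1_E : W -> R))) = (\- g) \* \1_E.
  by apply/funext => w /=; rewrite mulNr.
by apply: total_var_ub => //; exact: aballN.
Qed.

Lemma total_var_le E v c : region E ->
  (forall g, aball g -> chg S (g \* (\1_E : W -> R)) v <= c) -> total_var E v <= c.
Proof.
move=> rE H; apply: ge_sup; first by case: (has_sup_tv v rE).
by move=> _ [g ag <-]; exact: H.
Qed.

Lemma total_var_gt E v c : region E -> c < total_var E v ->
  exists2 g, aball g & c < chg S (g \* (\1_E : W -> R)) v.
Proof.
move=> rE cE; have e0 : 0 < total_var E v - c by rewrite subr_gt0.
have [_ [g ag <-]] := sup_adherent e0 (has_sup_tv v rE).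
by rewrite subKr => H; exists g.
Qed.

Lemma total_var_bound E v : region E -> total_var E v <= chg_bound S * `|v|.
Proof.
by move=> rE; apply: total_var_le => // g ag; apply: chg_aball; exact: aballI.
Qed.

Lemma total_varU E E' v : region E -> region E' -> [disjoint E & E'] ->
  total_var (E `|` E') v <= total_var E v + total_var E' v.
Proof.
move=> rE rE' dE; apply: total_var_le => [|g ag]; first exact: regionU.
have e : g \* (\1_(E `|` E') : W -> R) = (g \* (\1_E : W -> R)) \+ (g \* (\1_E' : W -> R)).
  apply/funext => w /=; rewrite -mulrDr !indicE in_setU; congr (_ * _).
  have [wE|] := boolP (w \in E); have [wE'|] := boolP (w \in E'); rewrite /= ?addr0 ?add0r//.
  exfalso; move/disj_setPS : dE => /(_ w); apply.
  by split; exact/set_mem.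
rewrite e chgDE; [|exact: aballI|exact: aballI|rewrite -e; apply: aballI => //; exact: regionU].
by apply: lerD; exact: total_var_ub.
Qed.

(** Almost optimal test functions on E and E' glue to one test function on the union. *)
Lemma total_varU_ge E E' v : region E -> region E' -> [disjoint E & E'] ->
  total_var E v + total_var E' v <= total_var (E `|` E') v.
Proof.
move=> rE rE' dE; have rU := regionU rE rE'.
rewrite -lerBrDr; apply: total_var_le => // g ag.
rewrite lerBrDr -lerBrDl; apply: total_var_le => // g' ag'.
rewrite lerBrDl.
pose h := (g \* (\1_E : W -> R)) \+ (g' \* (\1_E' : W -> R)).
have hE w : w \in E -> h w = g w.
  move=> wE; rewrite /h/= !indicE wE mulr1 [w \in E'](_ : _ = false) ?mulr0 ?addr0//.
  apply/negbTE/negP => wE'; move/disj_setPS : dE => /(_ w); apply.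
  by split; exact/set_mem.
have hE' w : w \notin E -> h w = g' w * \1_E' w.
  by move=> wE; rewrite /h/= !indicE (negbTE wE) mulr0 add0r.
have bh : aball h.
  split; first by apply: admD; apply: admM => //; [case: ag|case: ag'].
  move=> w; have [wE|wE] := boolP (w \in E).
    by rewrite hE//; case: ag.
  by rewrite hE'// normrM mulr_ile1// ?indic_le1//; case: ag'.
have hU : h \* (\1_(E `|` E') : W -> R) = h.
  apply/funext => w /=; rewrite indicE in_setU.
  have [wE|wE] := boolP (w \in E); first by rewrite mulr1.
  by rewrite hE'// indicE/=; case: (w \in E'); rewrite ?mulr1// !mulr0.
rewrite -chgDE; [|exact: aballI|exact: aballI|exact: bh].
by rewrite -/h -hU; exact: total_var_ub.
Qed.

Lemma total_varS E E' v : region E -> region E' -> E `<=` E' ->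
  total_var E v <= total_var E' v.
Proof.
move=> rE rE' EE'; apply: total_var_le => // g ag.
have -> : g \* (\1_E : W -> R) = (g \* (\1_E : W -> R)) \* \1_E'.
  apply/funext => w /=; rewrite !indicE -mulrA; congr (_ * _).
  have [wE|] := boolP (w \in E); last by rewrite mul0r.
  by rewrite [w \in E']mem_set ?mulr1//; apply: EE'; exact/set_mem.
by apply: total_var_ub => //; exact: aballI.
Qed.

Lemma total_varD E u v : region E ->
  total_var E (u + v) <= total_var E u + total_var E v.
Proof.
move=> rE; apply: total_var_le => // g ag.
by rewrite dualD lerD//; exact: total_var_ub.
Qed.

Lemma total_varZ E a v : region E -> total_var E (a *: v) = `|a| * total_var E v.
Proof.
move=> rE.
have H b w : total_var E (b *: w) <= `|b| * total_var E w.
  apply: total_var_le => // g ag.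
  rewrite dualZ (le_trans (ler_norm _))// normrM ler_wpM2l//; exact: total_var_abs.
apply/eqP; rewrite eq_le H/=.
have [->|a0] := eqVneq a 0.
  rewrite normr0 mul0r (le_trans _ (total_var_ub _ rE aball0))//.
  have -> : (cst 0 : W -> R) \* \1_E = \- (cst 0 \* \1_E).
    by apply/funext => w /=; rewrite mul0r oppr0.
  have -> : (cst 0 : W -> R) \* \1_E = cst 0.
    by apply/funext => w /=; rewrite mul0r.
  rewrite scale0r dual0//.
by rewrite -ler_pdivlMl ?normr_gt0// -normfV -[X in total_var E X <= _](scalerK a0).
Qed.

End charge_rep.

Section seminorms.
Context {R : realType} {V : normedModType R}.

Definition bounded_seminorm (q : V -> R) : Prop :=
  [/\ forall u v, q (u + v) <= q u + q v,
      forall a v, q (a *: v) = `|a| * q v &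
      exists C, forall v, q v <= C * `|v|].

Lemma seminorm0 q : bounded_seminorm q -> q 0 = 0.
Proof. by move=> [_ qZ _]; rewrite -(scale0r 0) qZ normr0 mul0r. Qed.

Lemma seminormN q v : bounded_seminorm q -> q (- v) = q v.
Proof. by move=> [_ qZ _]; rewrite -scaleN1r qZ normrN1 mul1r. Qed.

Lemma seminorm_ge0 q v : bounded_seminorm q -> 0 <= q v.
Proof.
move=> sq; have := seminorm0 sq; case: (sq) => qD _ _.
have := qD v (- v); rewrite subrr seminormN// => H E; rewrite E in H.
by move: H; rewrite -mulr2n pmulrn_lge0.
Qed.

Lemma seminorm_sum q (I : Type) (r : seq I) (v : I -> V) : bounded_seminorm q ->
  q (\sum_(i <- r) v i) <= \sum_(i <- r) q (v i).
Proof.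
move=> sq; elim: r => [|i r ih]; first by rewrite !big_nil seminorm0.
rewrite !big_cons; case: (sq) => qD _ _.
by rewrite (le_trans (qD _ _))// lerD2l.
Qed.

Lemma bounded_seminorm_total_var W (S : charge_rep V W) E :
  region S E -> bounded_seminorm (total_var S E).
Proof.
move=> rE; split; [by move=> u v; exact: total_varD|
  by move=> a v; exact: total_varZ|].
by exists (chg_bound S) => v; exact: total_var_bound.
Qed.

(** The charges are carried by the regions in D, up to errors that depend on the vector. *)
Definition exhausting W (S : charge_rep V W) (D : set (set W)) : Prop :=
  [/\ D `<=` region S, forall E E', D E -> D E' -> D (E `|` E') &
      forall v (e : R), 0 < e -> exists2 E, D E & total_var S (~` E) v <= e].

(** Seminorms built from the |f v|, for f in the dual, by operations that preserve both
    convergence to 0 along weakly null sequences ([tame_null]) and the approximation of vector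
    measures by their averages ([tame_averageable]). *)
Inductive tame : (V -> R) -> Prop :=
| tame_dual (f : dual_space V) : tame (fun v => `|f v|)
| tame_add (q1 q2 : V -> R) : tame q1 -> tame q2 -> tame (fun v => q1 v + q2 v)
| tame_le (q q' : V -> R) (C : R) : bounded_seminorm q -> 0 <= C ->
    (forall v, q v <= C * q' v) -> tame q' -> tame q
| tame_glue W (S : charge_rep V W) (D : set (set W)) : exhausting S D ->
    (forall E, D E -> tame (total_var S E)) -> tame (total_var S setT).

Lemma tame_seminorm q : tame q -> bounded_seminorm q.
Proof.
elim=> {q} [f|q1 q2 _ [D1 Z1 [C1 B1]] _ [D2 Z2 [C2 B2]]|//|W S D _ _ _].
- split.
  + by move=> u v; rewrite dualD ler_normD.
  + by move=> a v; rewrite dualZ normrM.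
  + by exists `|f| => v; exact: dual_le.
- split.
  + by move=> u v; rewrite addrACA lerD.
  + by move=> a v; rewrite Z1 Z2 mulrDr.
  + by exists (C1 + C2) => v; rewrite mulrDl lerD.
- by apply: bounded_seminorm_total_var; exact: regionT.
Qed.

End seminorms.

Section schur.
Context {R : realType} {V : normedModType R} (u : nat -> V).
Hypothesis u_null : forall f : dual_space V, f (u n) @[n --> \oo] --> (0 : R).

(** Suppose that the variations of the terms of u do not tend to 0. As those over each region
    in D do, some terms of u, of variation larger than c, live up to small errors on the
    disjoint differences of an increasing sequence of regions. Almost optimal test functions on
    these differences glue to a single one, whose functional stays away from 0 along u. *)
Lemma gliding_hump W (S : charge_rep V W) (D : set (set W)) : exhausting S D ->
  (forall E, D E -> total_var S E (u n) @[n --> \oo] --> (0 : R)) ->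
  total_var S setT (u n) @[n --> \oo] --> (0 : R).
Proof.
move=> [Dreg DU Dex] HD; apply: contrapT => nc.
have rT := @regionT R V W S.
have [c c0 Hc] : exists2 c : R, 0 < c & forall K, exists2 k, (K <= k)%N & c < total_var S setT (u k).
  apply: contrapT => H; apply: nc; apply/cvgrPdist_le => e e0.
  apply: contrapT => ne; apply: H; exists e => // K.
  apply: contrapT => H; apply: ne; exists K => // k /= Kk.
  rewrite sub0r normrN ger0_norm; last exact/seminorm_ge0/bounded_seminorm_total_var.
  by rewrite leNgt; apply/negP => ek; apply: H; exists k.
pose e := c / 8; have e0 : 0 < e by rewrite divr_gt0.
have step (x : set W * nat) : exists y : nat * set W * (W -> R), D x.1 ->
    [/\ (x.2 <= y.1.1)%N, D y.1.2 /\ x.1 `<=` y.1.2, aball S y.2,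
        total_var S x.1 (u y.1.1) <= e /\ total_var S (~` y.1.2) (u y.1.1) <= e &
        c - 3 * e < chg S (y.2 \* (\1_(y.1.2 `\` x.1) : W -> R)) (u y.1.1)].
  case: x => E K /=; have [DE|nDE] := pselect (D E); last first.
    by exists (0%N, set0, cst 0) => /nDE.
  have /cvgrPdist_le/(_ e e0)[K1 _ HK1] := HD E DE.
  have [k Kk ck] := Hc (maxn K K1).
  have [E1 DE1 HE1] := Dex (u k) e e0.
  have DU1 := DU _ _ DE DE1.
  have rE := Dreg _ DE; have rE1 := Dreg _ DE1; have rU := Dreg _ DU1.
  have kE : total_var S E (u k) <= e.
    have := HK1 k (leq_trans (leq_maxr _ _) Kk).
    by rewrite sub0r normrN => /(le_trans (ler_norm _)).
  have kC : total_var S (~` (E `|` E1)) (u k) <= e.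
    apply: le_trans HE1; apply: total_varS; [exact: regionC|exact: regionC|].
    by apply: subsetC; exact: subsetUr.
  have rA : region S ((E `|` E1) `\` E) by exact: regionD.
  have tot : total_var S setT (u k) <= total_var S E (u k) +
      total_var S ((E `|` E1) `\` E) (u k) + total_var S (~` (E `|` E1)) (u k).
    rewrite -[X in total_var S X _ <= _](setUv (E `|` E1)).
    rewrite (le_trans (total_varU _ rU (regionC rU) _))//.
      by apply/disj_setPS => w [].
    rewrite lerD2r.
    rewrite -[X in total_var S X _ <= _](_ : E `|` ((E `|` E1) `\` E) = _).
      by apply: total_varU => //; apply/disj_setPS => w [? []].
    by rewrite setDE setUIr setUv setIT setUA setUid.
  have ga : c - 3 * e < total_var S ((E `|` E1) `\` E) (u k) by rewrite /e in kE kC *; lra.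
  have [g ag gk] := total_var_gt rA ga.
  exists (k, E `|` E1, g) => _; split => //=.
  exact: leq_trans (leq_maxl _ _) Kk.
have [nx Hnx] := choice step.
have [E0 DE0 _] := Dex 0 e e0.
(* Ds is the increasing sequence of regions, ks and gs the terms and test functions chosen
   along it. *)
pose Ds := fix Ds n := if n is m.+1 then (nx (Ds m, m)).1.2 else E0.
pose ks n := (nx (Ds n, n)).1.1.
pose gs n := (nx (Ds n, n)).2.
have DsD n : D (Ds n).
  by elim: n => //= n ih; have [_ []] := Hnx (Ds n, n) ih.
have Hs n := Hnx (Ds n, n) (DsD n).
have Dsub n m : (n <= m)%N -> Ds n `<=` Ds m.
  elim: m => [|m ih]; first by rewrite leqn0 => /eqP ->.
  rewrite leq_eqVlt => /predU1P[->//|]; rewrite ltnS => /ih nm.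
  by apply: (subset_trans nm); have [_ [_ ]] := Hs m.
pose A n := Ds n.+1 `\` Ds n.
have rDs n : region S (Ds n) := Dreg _ (DsD n).
have rA n : region S (A n) by exact: regionD.
have Auniq n m w : A n w -> A m w -> n = m.
  move=> [Dn nDn] [Dm nDm]; apply/eqP; rewrite eqn_leq.
  apply/andP; split; rewrite leqNgt; apply/negP => h.
    by apply: nDn; exact: (Dsub _ _ h).
  by apply: nDm; exact: (Dsub _ _ h).
pose g w := if pselect (exists n, A n w) is left h then gs (projT1 (cid h)) w else 0.
have gA n w : A n w -> g w = gs n w.
  move=> Anw; rewrite /g; case: pselect => [h|]; last by case; exists n.
  by case: cid => m Amw /=; rewrite (Auniq _ _ _ Amw Anw).
have gN w : (forall n, ~ A n w) -> g w = 0.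
  by move=> h; rewrite /g; case: pselect => [h'|//]; exfalso; case: (h') => n /h.
have aG n : adm S (g \* (\1_(Ds n `\` Ds 0) : W -> R)).
  elim: n => [|n ih].
    have -> : g \* (\1_(Ds 0 `\` Ds 0) : W -> R) = cst 0; last exact: adm0.
    by apply/funext => w /=; rewrite setDv indic0 mulr0.
  have -> : g \* (\1_(Ds n.+1 `\` Ds 0) : W -> R) =
      (g \* (\1_(Ds n `\` Ds 0) : W -> R)) \+ (gs n \* (\1_(A n) : W -> R)).
    apply/funext => w /=; rewrite !indicE.
    have [Anw|nA] := pselect (A n w).
      rewrite (gA _ _ Anw) (mem_set Anw) mulr1 [w \in _ `\` _]mem_set; last first.
        by split; [case: Anw|case: Anw => _ h1 /(Dsub _ _ (leq0n n))].
      rewrite mulr1 [w \in _]memNset ?mulr0 ?add0r//.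
      by move=> []; case: Anw => _ h1 /h1.
    rewrite (memNset nA) mulr0 addr0; congr (_ * (nat_of_bool _)%:R).
    apply/idP/idP => /set_mem [h1 h2]; apply/mem_set; split => //.
      by apply: contrapT => h; apply: nA.
    exact: (Dsub n n.+1).
  apply: admD => //; apply: admM => //; first by case: (Hs n) => _ _ [].
  exact: rA.
have ag : aball S g.
  split.
    apply: (adm_lim aG) => w; apply/cvgrPdist_le => d d0.
    have [[n Anw]|nA] := pselect (exists n, A n w); last first.
      by exists 0%N => // m _; rewrite /= gN ?mul0r ?subrr ?normr0 ?ltW// => n An; apply: nA; exists n.
    exists n.+1 => // m /= nm; rewrite indicE mem_set ?mulr1 ?subrr ?normr0 ?ltW//.
    case: Anw => h1 h2; split; first exact: (Dsub _ _ nm).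
    by move=> /(Dsub _ _ (leq0n n)).
  move=> w; have [[n Anw]|nA] := pselect (exists n, A n w).
    rewrite (gA _ _ Anw). case: (Hs n) => _ _ [_ gg1] _ _. exact: gg1.
  by rewrite gN ?normr0// => n An; apply: nA; exists n.
(* The part of g on A n contributes more than 5 e, and the parts on Ds n and outside
   Ds n.+1 at most e each. *)
have lower n : 3 * e < chg S g (u (ks n)).
  have [_ _ agn [q1 q2] q3] := Hs n.
  have E1 : g = (g \* (\1_(Ds n.+1) : W -> R)) \+ (g \* (\1_(~` Ds n.+1) : W -> R)).
    apply/funext => w /=; rewrite !indicE in_setC.
    by case: (_ \in _); rewrite /= ?mulr1 ?mulr0 ?addr0 ?add0r.
  have E2 : g \* (\1_(Ds n.+1) : W -> R) = (g \* (\1_(Ds n) : W -> R)) \+ (gs n \* (\1_(A n) : W -> R)).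
    apply/funext => w /=; rewrite !indicE.
    have [Anw|nA] := pselect (A n w).
      rewrite (gA _ _ Anw) (mem_set Anw) mulr1 [w \in Ds n.+1]mem_set; last by case: Anw.
      by rewrite mulr1 [w \in _]memNset ?mulr0 ?add0r//; case: Anw.
    rewrite (memNset nA) mulr0 addr0; congr (_ * (nat_of_bool _)%:R).
    apply/idP/idP => /set_mem h1; apply/mem_set.
      by apply: contrapT => h; apply: nA.
    exact: (Dsub n n.+1).
  have b1 : aball S (g \* (\1_(Ds n.+1) : W -> R)) by exact: aballI.
  have rC := regionC (rDs n.+1).
  rewrite E1 chgDE; [|by []|exact: aballI|by rewrite -E1].
  rewrite {1}E2 chgDE; [|exact: aballI|exact: aballI|by rewrite -E2].
  have B1 := total_var_abs (u (ks n)) (rDs n) ag.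
  have B2 := total_var_abs (u (ks n)) rC ag.
  move: B1 B2; rewrite !ler_norml => /andP[B1 _] /andP[B2 _].
  have q1' : total_var S (Ds n) (u (ks n)) <= e := q1.
  have q2' : total_var S (~` Ds n.+1) (u (ks n)) <= e := q2.
  have q3' : c - 3 * e < chg S (gs n \* (\1_(A n) : W -> R)) (u (ks n)) := q3.
  have ce : c = 8 * e by rewrite /e mulrC divfK// pnatr_eq0.
  rewrite ce in q3'; lra.
have /cvgrPdist_le/(_ e e0)[K _ HK] := u_null (chg S g).
have Kk : (K <= ks K)%N by case: (Hs K).
have := HK _ Kk; rewrite sub0r normrN => /(le_trans (ler_norm _)).
by rewrite leNgt => /negP; apply; have := lower K; lra.
Qed.

Lemma tame_null q : tame q -> q (u n) @[n --> \oo] --> (0 : R).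
Proof.
elim=> {q} [f|q1 q2 _ h1 _ h2|q q' C sq C0 qq' _ h|W S D ex _ h].
- by rewrite -(normr0 R); apply: cvg_norm; exact: u_null.
- by rewrite -(addr0 0); exact: cvgD.
- have h' : C * q' (u n) @[n --> \oo] --> (0 : R).
    by rewrite -(mulr0 C); apply: cvgM => //; exact: cvg_cst.
  apply: (squeeze_cvgr _ (cvg_cst 0) h').
  by apply: nearW => n; rewrite qq' andbT; exact: seminorm_ge0.
- exact: gliding_hump ex h.
Qed.

End schur.

Theorem tame_Schur (R : realType) (V : normedModType R) :
  tame (fun v : V => `|v|) -> Schur_property V.
Proof.
move=> tV u x ux.
have null (f : dual_space V) : f (u n - x) @[n --> \oo] --> (0 : R).
  have -> : (fun n => f (u n - x)) = (fun n => f (u n) - f x).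
    by apply/funext => n; rewrite dualB.
  by rewrite -(subrr (f x)); apply: cvgB; [exact: ux|exact: cvg_cst].
have := tame_null null tV => /cvgrPdist_le H.
apply/cvgrPdist_le => e e0; apply: filterS (H e e0) => n.
by rewrite sub0r normrN normr_id distrC.
Qed.

(** * Averages of vector measures over finite partitions *)

Section partitions.
Context {R : realType} d (S : measurableType d).
Variable mu : {finite_measure set S -> \bar R}.

(** A finite measurable partition is encoded by the map sending a point to the index of its
    block: partitions finer than p are those through which p factors, and pairing two maps
    gives their common refinement. *)
Definition mpart (K : finType) (p : S -> K) : Prop :=
  forall k, measurable (p @^-1` [set k]).

Definition block (K : finType) (p : S -> K) (k : K) : set S := p @^-1` [set k].

Definition mass (A : set S) : R := fine (mu A).

Lemma mass_ge0 A : 0 <= mass A. Proof. exact: fine_ge0. Qed.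

Lemma massE A : measurable A -> (mass A)%:E = mu A.
Proof. by move=> mA; rewrite /mass fineK// fin_num_measure. Qed.

Lemma mass0 : mass set0 = 0. Proof. by rewrite /mass measure0. Qed.

Lemma mpart_pair (K K' : finType) (p : S -> K) (p' : S -> K') :
  mpart p -> mpart p' -> mpart (fun x => (p x, p' x)).
Proof.
move=> mp mp' [k k'].
have -> : (fun x => (p x, p' x)) @^-1` [set (k, k')] = block p k `&` block p' k'.
  by apply/seteqP; split=> [x [<- <-]//|x [/= -> ->]//].
by apply: measurableI; [exact: mp|exact: mp'].
Qed.

Lemma block_pair (K K' : finType) (p : S -> K) (p' : S -> K') k k' :
  block (fun x => (p x, p' x)) (k, k') = block p k `&` block p' k'.
Proof. by rewrite /block; apply/seteqP; split=> [x [<- <-]//|x [/= -> ->]//]. Qed.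

Lemma block_in (A : set S) : block (fun x => x \in A) true = A.
Proof. by apply/seteqP; split => x /=; [move/set_mem|move/mem_set]. Qed.

Lemma block_notin (A : set S) : block (fun x => x \in A) false = ~` A.
Proof.
apply/seteqP; split => x /=; first by move=> h /mem_set; rewrite h.
by move=> h; apply/negbTE/negP => /set_mem.
Qed.

Lemma mpart_set A : measurable A -> mpart (fun x => x \in A).
Proof.
move=> mA [].
  by rewrite -[X in measurable X]/(block _ true) block_in.
by rewrite -[X in measurable X]/(block _ false) block_notin; exact: measurableC.
Qed.

Lemma mpart_preimage (K : finType) (p : S -> K) (P : set K) : mpart p ->
  measurable (p @^-1` P).
Proof.
move=> mp; have -> : p @^-1` P = \bigcup_(k in P) block p k.
  apply/seteqP; split => x /= => [Px|[k Pk pk]]; first by exists (p x).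
  by rewrite (pk : p x = k).
by apply: fin_bigcup_measurable => // k _; exact: mp.
Qed.

(* The blocks of a partition are listed as a sequence, completed by empty sets, because
   additivity is only assumed for sequences. *)
Let trace (K : finType) (p : S -> K) (A : set S) (n : nat) : set S :=
  if @insub nat (fun n => (n < #|K|)%N) 'I_#|K| n is Some i
  then A `&` block p (enum_val i) else set0.

Let bigcup_trace (K : finType) (p : S -> K) (A : set S) : \bigcup_n trace p A n = A.
Proof.
apply/seteqP; split => [x [n _]|x Ax]; rewrite /trace.
  by case: insub => [i []|].
exists (enum_rank (p x)) => //.
by rewrite /trace (valK (enum_rank (p x))) enum_rankK.
Qed.

Let trace_disj (K : finType) (p : S -> K) (A : set S) : trivIset setT (trace p A).
Proof.
move=> n m _ _ [x []]; rewrite /trace.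
case: insubP => [i _ vi|//] [_ pi]; case: insubP => [j _ vj|//] [_ pj].
by rewrite -vi -vj; congr nat_of_ord; apply: enum_val_inj; rewrite -pi -pj.
Qed.

Let trace_meas (K : finType) (p : S -> K) (A : set S) n : mpart p -> measurable A ->
  measurable (trace p A n).
Proof.
move=> mp mA; rewrite /trace; case: insub => [i|]; last exact: measurable0.
by apply: measurableI => //; exact: mp.
Qed.

Let sum_trace (K : finType) (p : S -> K) (A : set S) (V : zmodType)
    (G : set S -> V) n : G set0 = 0 -> (#|K| <= n)%N ->
  \sum_(0 <= i < n) G (trace p A i) = \sum_(k : K) G (A `&` block p k).
Proof.
move=> G0 Kn; rewrite (big_cat_nat (leq0n _) Kn)//= [X in _ + X]big_nat_cond [X in _ + X]big1.
  rewrite addr0 big_mkord [RHS](reindex (@enum_val K predT)); last first.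
    by exists enum_rank => k _; [exact: enum_valK|exact: enum_rankK].
  apply: eq_bigr => i _.
  by rewrite /trace (valK i).
move=> i /andP[/andP[Ki _] _]; rewrite /trace insubF//.
by rewrite ltnNge Ki.
Qed.

Lemma mass_part (K : finType) (p : S -> K) A : mpart p -> measurable A ->
  mass A = \sum_(k : K) mass (A `&` block p k).
Proof.
move=> mp mA; rewrite -(@sum_trace K p A _ mass #|K|)//; last exact: mass0.
apply: EFin_inj; rewrite massE// -sumEFin.
rewrite -[in LHS](bigcup_trace p A).
rewrite (eq_bigr (fun i => mu (trace p A i))); last first.
  by move=> i _; rewrite massE//; exact: trace_meas.
rewrite big_mkord -measure_semi_additive//.
- congr (mu _); rewrite -bigcup_mkord.
  apply/seteqP; split => x; last by move=> [n _ h]; exists n.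
  move=> [n _]; rewrite /trace; case: insubP => [i ni vi|//] h.
  by exists n => //; rewrite /trace -vi (valK i).
- by move=> i; exact: trace_meas.
- by apply: bigsetU_measurable => i _; exact: trace_meas.
Qed.

Section vm.
Context {V : normedModType R} (G : set S -> V).
Hypotheses (vG : vector_measure G) (acG : vector_abs_continuous mu G).

Lemma vector_measure0 : G set0 = 0.
Proof. by apply: acG; rewrite ?measure0//. Qed.

Lemma vector_measure_part (K : finType) (p : S -> K) A : mpart p -> measurable A ->
  G A = \sum_(k : K) G (A `&` block p k).
Proof.
move=> mp mA.
have : series (fun n => G (trace p A n)) @ \oo --> G (\bigcup_n trace p A n).
  by apply: vG => [n|]; [exact: trace_meas|exact: trace_disj].
rewrite bigcup_trace => H; apply: (cvg_unique _ H); first exact: norm_hausdorff.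
apply/cvgrPdist_le => e e0; exists #|K| => // n /= Kn.
by rewrite /series/= sum_trace ?vector_measure0// subrr normr0 ltW.
Qed.

(** The conditional expectation of the set function G on the partition p. On null blocks the
    quotient is 0. *)
Definition average (K : finType) (p : S -> K) (A : set S) : V :=
  \sum_(k : K) (mass (A `&` block p k) / mass (block p k)) *: G (block p k).

End vm.

(** A bound on the variation of H; the supremum over partitions may not exist. *)
Definition var_le {V : normedModType R} (q : V -> R) (H : set S -> V) (C : R) : Prop :=
  forall (K : finType) (p : S -> K), mpart p -> \sum_(k : K) q (H (block p k)) <= C.

Section var.
Context {V : normedModType R}.

Lemma var_le_average (q : V -> R) (H : set S -> V) C (K : finType) (p : S -> K) :
  bounded_seminorm q -> mpart p -> var_le q H C -> var_le q (average H p) C.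
Proof.
move=> sq mp HC K' p' mp'.
apply: le_trans (HC _ _ mp).
rewrite (@le_trans _ _ (\sum_(j : K') \sum_(k : K)
    mass (block p' j `&` block p k) / mass (block p k) * q (H (block p k))))//.
  apply: ler_sum => j _; rewrite (le_trans (seminorm_sum _ _ sq))//.
  apply: ler_sum => k _; case: sq => _ qZ _.
  by rewrite qZ ger0_norm// divr_ge0// mass_ge0.
rewrite exchange_big/=; apply: ler_sum => k _.
rewrite -mulr_suml -mulr_suml.
have -> : \sum_(j : K') mass (block p' j `&` block p k) = mass (block p k).
  by rewrite (mass_part mp' (mp k)); apply: eq_bigr => j _; rewrite setIC.
have [->|m0] := eqVneq (mass (block p k)) 0.
  by rewrite mul0r mul0r seminorm_ge0.
by rewrite divff// mul1r.
Qed.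

Lemma var_leD (q : V -> R) (H H' : set S -> V) C C' : bounded_seminorm q ->
  var_le q H C -> var_le q H' C' -> var_le q (fun A => H A - H' A) (C + C').
Proof.
move=> sq hC hC' K p mp; apply: le_trans (lerD (hC _ _ mp) (hC' _ _ mp)).
rewrite -big_split/=; apply: ler_sum => k _; rewrite -(seminormN (H' _) sq).
by case: sq => qD _ _; exact: qD.
Qed.

End var.

End partitions.

Section averaging.
Context {R : realType} {V : normedModType R} d (S : measurableType d).
Variables (mu : {finite_measure set S -> \bar R}) (G : set S -> V).
Hypotheses (vG : vector_measure G) (bG : vector_bounded_variation G)
  (acG : vector_abs_continuous mu G).

(** The averages of G converge to G in q-variation along refinements of partitions. They are
    the integrals of step functions, from which a density can be built. *)
Definition averageable (q : V -> R) : Prop := forall e : R, 0 < e ->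
  exists (K : finType) (p : S -> K), mpart p /\
    forall (K' : finType) (p' : S -> K') (phi : K' -> K), mpart p' ->
      (forall x, p x = phi (p' x)) -> var_le q (fun A => G A - average mu G p' A) e.

Lemma averageable_le (q q' : V -> R) (C : R) : bounded_seminorm q' ->
  (forall v, q v <= C * q' v) -> 0 <= C ->
  averageable q' -> averageable q.
Proof.
move=> sq' qq' C0 aq' e e0; have C1 : 0 < C + 1 by rewrite ltr_wpDl.
have [K [p [mp H]]] := aq' (e / (C + 1)) (divr_gt0 e0 C1).
exists K, p; split => // K' p' phi mp' pp' K2 p2 mp2.
have := H K' p' phi mp' pp' K2 p2 mp2.
rewrite ler_pdivlMr// => He; apply: le_trans He.
rewrite mulr_suml; apply: ler_sum => k _; apply: le_trans (qq' _) _.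
by rewrite mulrC ler_wpM2l ?seminorm_ge0// lerDl.
Qed.

Lemma averageable_add (q1 q2 : V -> R) : averageable q1 -> averageable q2 ->
  averageable (fun v => q1 v + q2 v).
Proof.
move=> a1 a2 e e0; have e2 : 0 < e / 2 by rewrite divr_gt0.
have [K1 [p1 [mp1 H1]]] := a1 _ e2; have [K2 [p2 [mp2 H2]]] := a2 _ e2.
exists (K1 * K2)%type, (fun x => (p1 x, p2 x)); split; first exact: mpart_pair.
move=> K' p' phi mp' pp' K p mp; rewrite big_split/= [e]splitr; apply: lerD.
  by apply: (H1 K' p' (fst \o phi)) => // x /=; rewrite -pp'.
by apply: (H2 K' p' (snd \o phi)) => // x /=; rewrite -pp'.
Qed.

Lemma bounded_part : exists C, var_le (fun v => `|v|) G C.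
Proof.
have [C HC] := bG; exists C => K p mp.
rewrite (reindex (@enum_val K predT)); last first.
  by exists enum_rank => k _; [exact: enum_valK|exact: enum_rankK].
rewrite (eq_bigl xpredT)//.
apply: (HC _ (fun i => block p (enum_val i))) => [i|i j _ _ [x [pi pj]]]; first exact: mp.
by apply: enum_val_inj; rewrite -(pi : p x = _) -(pj : p x = _).
Qed.

Lemma var_refine (q : V -> R) (K K' : finType) (p : S -> K) (p' : S -> K') :
  bounded_seminorm q -> mpart p -> mpart p' ->
  \sum_(k : K) q (G (block p k)) <=
  \sum_(kk : K * K') q (G (block (fun x => (p x, p' x)) kk)).
Proof.
move=> sq mp mp'.
have -> : \sum_(kk : K * K') q (G (block (fun x => (p x, p' x)) kk)) =
    \sum_(k : K) \sum_(k' : K') q (G (block (fun x => (p x, p' x)) (k, k'))).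
  by rewrite pair_bigA; apply: eq_bigr => -[].
apply: ler_sum => k _; rewrite (vector_measure_part vG acG mp' (mp k)).
rewrite (le_trans (seminorm_sum _ _ sq))//; apply: ler_sum => k' _.
by rewrite block_pair.
Qed.

(** Take a partition whose variation is almost maximal, and a region E in D carrying, up to
    small errors, the values of G on its blocks. Variations over E and over its complement add
    up, and they increase under refinement; so the variation of G over the complement of E is
    small along all partitions. Over E the averages converge by assumption. *)
Lemma averageable_glue W (T : charge_rep V W) (D : set (set W)) : exhausting T D ->
  (forall E, D E -> averageable (total_var T E)) -> averageable (total_var T setT).
Proof.
move=> [Dreg DU Dex] aD e0 e00; pose e := e0 / 5.
have ep : 0 < e by rewrite divr_gt0.
have rT := @regionT R V W T.
have sT := bounded_seminorm_total_var rT.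
pose vars := [set x | exists (K : finType) (p : S -> K), mpart p /\
   x = \sum_(k : K) total_var T setT (G (block p k))].
have hv : has_sup vars.
  have mp1 : mpart (fun _ : S => tt).
    move=> []; rewrite (_ : _ @^-1` _ = setT); first exact: measurableT.
    by apply/seteqP.
  split; first by exists (\sum_(k : unit) total_var T setT (G (block (fun=> tt) k))), unit, (fun=> tt).
  have [C HC] := bounded_part; exists (`|chg_bound T| * C) => _ [K [p [mp ->]]].
  apply: le_trans (ler_wpM2l (normr_ge0 _) (HC _ _ mp)).
  rewrite mulr_sumr; apply: ler_sum => k _.
  rewrite (le_trans (total_var_bound _ rT))// ler_wpM2r// ler_norm//.
have [_ [K [p [mp ->]]] Hp] := sup_adherent ep hv.
set w := sup vars in Hp.
have [E DE HE] : exists2 E, D E & \sum_(k : K) total_var T (~` E) (G (block p k)) <= e.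
  have K1 : 0 < (#|K|%:R + 1 : R) by rewrite ltr_wpDl.
  have Hs (s : seq K) : exists2 E, D E & forall k, k \in s ->
      total_var T (~` E) (G (block p k)) <= e / (#|K|%:R + 1).
    elim: s => [|k s [E DE HE]].
      by have [E DE _] := Dex 0 1 ltr01; exists E.
    have [E' DE' HE'] := Dex (G (block p k)) _ (divr_gt0 ep K1).
    exists (E `|` E'); first exact: DU.
    have rC := regionC (Dreg _ (DU _ _ DE DE')).
    move=> j; rewrite inE => /predU1P[->|js].
      apply: le_trans HE'; apply: total_varS => //; first exact/regionC/Dreg.
      by apply: subsetC; exact: subsetUr.
    apply: le_trans (HE j js); apply: total_varS => //; first exact/regionC/Dreg.
    by apply: subsetC; exact: subsetUl.
  have [E DE HE] := Hs (enum K); exists E => //.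
  rewrite (@le_trans _ _ (\sum_(k : K) e / (#|K|%:R + 1)))//.
    by apply: ler_sum => k _; apply: HE; rewrite mem_enum.
  rewrite sumr_const -[X in X <= _]mulr_natr -mulrA ger_pMr// mulrC ler_pdivrMr// mul1r.
  by rewrite lerDl.
have rE := Dreg _ DE; have rC := regionC rE.
have sE := bounded_seminorm_total_var rE; have sC := bounded_seminorm_total_var rC.
have disj : [disjoint E & ~` E] by apply/disj_setPS => x [].
have splitv v : total_var T setT v <= total_var T E v + total_var T (~` E) v.
  by rewrite -[X in total_var T X _ <= _](setUv E); exact: total_varU.
have splitv' v : total_var T E v + total_var T (~` E) v <= total_var T setT v.
  by rewrite -[X in _ <= total_var T X _](setUv E); exact: total_varU_ge.
(* The refinement of p by p' has variation at most w and at least w - e, and its part over E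
   is at least that of p. *)
have varC : var_le (total_var T (~` E)) G (2 * e).
  move=> K' p' mp'.
  have h1 := var_refine sE mp mp'.
  have h2 : \sum_(k' : K') total_var T (~` E) (G (block p' k')) <=
      \sum_(kk : K * K') total_var T (~` E) (G (block (fun x => (p x, p' x)) kk)).
    rewrite (le_trans (var_refine sC mp' mp))//.
    rewrite (reindex (fun kk : K * K' => (kk.2, kk.1)))/=; last first.
      by exists (fun kk => (kk.2, kk.1)) => -[].
    rewrite le_eqVlt; apply/orP; left; apply/eqP; apply: eq_bigr => -[k k'] _ /=.
    by rewrite !block_pair setIC.
  have h3 : \sum_(kk : K * K') total_var T setT (G (block (fun x => (p x, p' x)) kk)) <= w.
    apply: ub_le_sup; first by case: hv.
    exists (K * K')%type, (fun x => (p x, p' x)); split => //; exact: mpart_pair.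
  have h4 : \sum_(kk : K * K') total_var T E (G (block (fun x => (p x, p' x)) kk)) +
     \sum_(kk : K * K') total_var T (~` E) (G (block (fun x => (p x, p' x)) kk)) <=
     \sum_(kk : K * K') total_var T setT (G (block (fun x => (p x, p' x)) kk)).
    by rewrite -big_split/=; apply: ler_sum => kk _; exact: splitv'.
  have h5 : \sum_(k : K) total_var T setT (G (block p k)) <=
     \sum_(k : K) total_var T E (G (block p k)) + \sum_(k : K) total_var T (~` E) (G (block p k)).
    by rewrite -big_split/=; apply: ler_sum => kk _; exact: splitv.
  lra.
have [K' [p' [mp' H']]] := aD E DE e ep.
exists K', p'; split => // K2 p2 phi mp2 pp2.
have v1 := H' K2 p2 phi mp2 pp2.
have v2 := var_leD sC varC (var_le_average mu sC mp2 varC).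
move=> K3 p3 mp3; apply: (@le_trans _ _ (e + (2 * e + 2 * e))); last by rewrite /e; lra.
apply: le_trans (lerD (v1 _ _ mp3) (v2 _ _ mp3)).
by rewrite -big_split/=; apply: ler_sum => k _; exact: splitv.
Qed.

End averaging.

Lemma finite_factor d (S : measurableType d) (X : choiceType) (x0 : X) (s : S -> X) :
  finite_set (range s) -> (forall v, measurable (s @^-1` [set v])) ->
  exists (K : finType) (p : S -> K) (psi : K -> X),
    mpart p /\ forall x, s x = psi (p x).
Proof.
move=> /finite_seqP[r rE] ms.
have sr x : s x \in r.
  have : range s (s x) by exists x.
  by rewrite rE.
have idx x : (index (s x) r < (size r).+1)%N by rewrite ltnS ltnW// index_mem.
exists 'I_(size r).+1, (fun x => Ordinal (idx x)), (fun k : 'I__ => nth x0 r k); split; last first.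
  by move=> x /=; rewrite nth_index.
move=> k; have [[x /= kx]|nk] := pselect (exists x, Ordinal (idx x) = k); last first.
  rewrite (_ : _ @^-1` _ = set0)//; apply/seteqP; split => // x /= kx.
  by apply: nk; exists x.
rewrite (_ : _ @^-1` _ = s @^-1` [set s x])//; apply/seteqP; split => y /=.
  rewrite -kx => /(congr1 val)/= e.
  by rewrite -(nth_index x0 (sr y)) e nth_index.
by move=> e; rewrite -kx; apply: val_inj; rewrite /= e.
Qed.

Lemma cvge0_near (R : realType) (u : nat -> \bar R) (e : R) :
  u n @[n --> \oo] --> 0%E -> 0 < e -> \forall n \near \oo, (u n <= e%:E)%E.
Proof.
move=> /fine_cvgP[fu cu] e0; move/cvgrPdist_le : cu => /(_ e e0) cu.
near=> n; rewrite -[leLHS]fineK; last by near: n.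
rewrite lee_fin (le_trans (ler_norm _))// -normrN -[X in `|X|]sub0r; near: n; exact: cu.
Unshelve. all: by end_near. Qed.

Section integral_part.
Context {R : realType} d (S : measurableType d).
Variable mu : {finite_measure set S -> \bar R}.

Lemma integral_mpart (K : finType) (p : S -> K) (A : set S) (f : S -> R) :
  mpart p -> measurable A -> measurable_fun A f ->
  (\int[mu]_(x in A) (f x)%:E = \sum_(k : K) \int[mu]_(x in A `&` block p k) (f x)%:E)%E.
Proof.
move=> mp mA /measurable_EFinP mf.
have AE : A = \big[setU/set0]_(k <- enum K) (A `&` block p k).
  rewrite -bigcup_seq; apply/seteqP; split => [x Ax|x [k _ []//]].
  by exists (p x) => //=; rewrite mem_enum.
rewrite {1}AE integral_bigsetU_EFin -?AE ?enum_uniq//.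
- by rewrite big_enum.
- by move=> k; apply: measurableI => //; exact: mp.
- by move=> i j _ _ [x [[_ pi] [_ pj]]]; rewrite -(pi : p x = i) -(pj : p x = j).
Qed.

Lemma integral_finite_valued (K : finType) (p : S -> K) (A : set S) (h : K -> R) :
  mpart p -> measurable A ->
  (\int[mu]_(x in A) (h (p x))%:E = (\sum_(k : K) h k * mass mu (A `&` block p k))%:E)%E.
Proof.
move=> mp mA; rewrite (integral_mpart mp)//; last first.
  apply: (measurable_funS measurableT) => // _ B _.
  by rewrite setTI; exact: (mpart_preimage (h @^-1` B) mp).
rewrite -sumEFin; apply: eq_bigr => k _.
have mB : measurable (A `&` block p k) by apply: measurableI => //; exact: mp.
rewrite EFinM massE// -integral_cst//.
by apply: eq_integral => x /set_mem [_ <-].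
Qed.

Lemma measurable_finite_valued (K : finType) (p : S -> K) (h : K -> R) :
  mpart p -> measurable_fun setT (fun x => h (p x)).
Proof.
by move=> mp _ B _; rewrite setTI; exact: (mpart_preimage (h @^-1` B) mp).
Qed.

Lemma integrable_finite_valued (K : finType) (p : S -> K) (h : K -> R) :
  mpart p -> mu.-integrable setT (fun x => (h (p x))%:E).
Proof.
move=> mp; apply/integrableP; split.
  apply/measurable_EFinP; exact: measurable_finite_valued.
have := @integral_finite_valued K p setT (fun k => `|h k|) mp measurableT.
by move=> /= ->; exact: ltry.
Qed.

End integral_part.

Section dual_averageable.
Import HBSimple.
Context {R : realType} {V : normedModType R} d (S : measurableType d).
Variables (mu : {finite_measure set S -> \bar R}) (G : set S -> V).
Hypotheses (vG : vector_measure G) (acG : vector_abs_continuous mu G).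
Variable (f : dual_space V).

Definition dual_charge (A : set S) : \bar R := (f (G A))%:E.

Let dual_charge0 : dual_charge set0 = 0%E.
Proof. by rewrite /dual_charge (vector_measure0 acG) dual0. Qed.

Let dual_charge_fin A : measurable A -> dual_charge A \is a fin_num.
Proof. by []. Qed.

Let dual_charge_sigma : semi_sigma_additive dual_charge.
Proof.
move=> F mF tF mUF.
rewrite /dual_charge (_ : (fun n => _) = EFin \o (fun n => f (series (fun k => G (F k)) n))); last first.
  by apply/funext => n /=; rewrite sumEFin /series/= dual_sum.
apply: cvg_EFin; first exact: nearW.
apply/cvgrPdist_le => e e0.
have C1 : 0 < `|f| + 1 by rewrite ltr_wpDl.
have /cvgrPdist_le/(_ _ (divr_gt0 e0 C1)) := vG mF tF.
apply: filterS => n h /=; rewrite -dualB (le_trans (dual_le _ _))//.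
rewrite (le_trans (ler_wpM2l (normr_ge0 _) h))// mulrCA ger_pMr// ler_pdivrMr// mul1r.
by rewrite lerDl.
Qed.

HB.instance Definition _ := isCharge.Build _ _ _ dual_charge
  dual_charge0 dual_charge_fin dual_charge_sigma.

(** In the scalar case there is a Radon-Nikodym density, and step functions approximate it in
    mean. *)
Lemma averageable_dual : averageable mu G (fun v => `|f v|).
Proof.
move=> e e0.
have dom : dual_charge `<< mu.
  move=> A nA B mB BA; rewrite /dual_charge acG ?dual0//.
  exact: nA.
pose D := Radon_Nikodym [the charge _ _ of dual_charge] mu.
pose g := fine \o D.
have gE x : D x = (g x)%:E by rewrite /g/= fineK// Radon_Nikodym_fin_num.
have ig : mu.-integrable setT (EFin \o g).
  rewrite (_ : EFin \o g = D); first exact: Radon_Nikodym_integrable.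
  by apply/funext => x /=; rewrite gE.
have fG A : measurable A -> (f (G A))%:E = (\int[mu]_(x in A) (g x)%:E)%E.
  move=> mA; rewrite [LHS](Radon_Nikodym_integral dom mA).
  by apply: eq_integral => x _; exact: gE.
have [g_ [ig_ _ gl]] := approximation_sfun_integrable measurableT ig.
have e2 : 0 < e / 2 by rewrite divr_gt0.
have [n _ /(_ n (leqnn n)) gn] := cvge0_near gl e2.
set s := g_ n in gn.
have [K [p [psi [mp sE]]]] : exists (K : finType) (p : S -> K) (psi : K -> R),
    mpart p /\ forall x, s x = psi (p x).
  apply: (finite_factor 0); first exact: fimfunP.
  by move=> v; rewrite -[_ @^-1` _]setTI; exact: measurable_funP.
exists K, p; split => // K' p' phi mp' pp'.
pose sg k' := psi (phi k').
have sE' x : s x = sg (p' x) by rewrite sE pp'.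
pose h A : R^o := f (G A) - \sum_(k' : K') sg k' * mass mu (A `&` block p' k').
have is_ : mu.-integrable setT (EFin \o s).
  rewrite (_ : EFin \o s = fun x => (sg (p' x))%:E); first exact: integrable_finite_valued.
  by apply/funext => x /=; rewrite sE'.
have hE A : measurable A -> (h A)%:E = (\int[mu]_(x in A) ((g x)%:E - (s x)%:E))%E.
  move=> mA; rewrite integralB//; [|exact: integrableS ig|exact: integrableS is_].
  rewrite -fG// /h EFinB; congr (_ - _)%E.
  rewrite -integral_finite_valued//; apply: eq_integral => x _.
  by rewrite sE'.
have mgs : measurable_fun setT (fun x => `|g x - s x|).
  apply: measurableT_comp => //; apply: measurable_funB.
    by apply/measurable_EFinP; case/integrableP : ig.
  by apply/measurable_EFinP; case/integrableP : is_.
have hvar : var_le (fun v : R^o => `|v|) h (e / 2).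
  move=> K2 p2 mp2; rewrite -lee_fin; apply: le_trans gn.
  rewrite -sumEFin [leRHS](_ : _ = \int[mu]_x (`|g x - s x|)%:E)%E//.
  rewrite (integral_mpart _ mp2 measurableT mgs); apply: lee_sum => k _.
  have mk : measurable (block p2 k) by exact: mp2.
  rewrite setTI -abse_EFin hE// (le_trans (le_abse_integral _ _ _))//.
  apply: (measurable_funS measurableT) => //.
  rewrite (_ : (fun x => _) = EFin \o (fun x => g x - s x)); last by apply/funext.
  apply/measurable_EFinP; apply: measurable_funB.
    by apply/measurable_EFinP; case/integrableP : ig.
  by apply/measurable_EFinP; case/integrableP : is_.
have sn : bounded_seminorm (fun v : R^o => `|v|).
  split; [exact: ler_normD|by move=> a v; rewrite normrZ|].
  by exists 1 => v; rewrite mul1r.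
have key A : measurable A -> f (G A - average mu G p' A) = h A - average mu h p' A.
  move=> mA; rewrite dualB /h -[LHS]/(_ - _) -addrA; congr (_ + _).
  rewrite -opprD; congr (- _).
  rewrite /average dual_sum -big_split/=; apply: eq_bigr => k' _.
  rewrite dualZ /GRing.scale/= (bigD1 k')//= big1 ?addr0; last first.
    move=> j jk; rewrite [_ `&` _](_ : _ = set0) ?mass0 ?mulr0//.
    apply/seteqP; split => // x [kx jx]; move: jk.
    by rewrite -(kx : p' x = k') -(jx : p' x = j) eqxx.
  rewrite setIid mulrBr addrCA [X in _ + X](_ : _ = 0) ?addr0//.
  have [m0|m0] := eqVneq (mass mu (block p' k')) 0; last first.
    by rewrite [sg _ * mass mu (block _ _)]mulrC mulrA divfK// mulrC subrr.
  rewrite m0 invr0 mulr0 mul0r subr0.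
  suff -> : mass mu (A `&` block p' k') = 0 by rewrite mulr0.
  have mk : measurable (block p' k') by exact: mp'.
  apply/eqP; rewrite eq_le mass_ge0 andbT -m0 -lee_fin !massE//; last exact: measurableI.
  by apply: le_measure; rewrite ?inE//; exact: measurableI.
move=> K2 p2 mp2; rewrite [e]splitr.
apply: le_trans (var_leD sn hvar (var_le_average mu sn mp' hvar) mp2).
by apply: ler_sum => k _; rewrite key//; exact: mp2.
Qed.

End dual_averageable.

(** * Bochner densities from averages *)

(** The integral of a non-negative function is a supremum over the simple functions below it,
    hence monotone without measurability assumptions. *)
Lemma ge0_le_integral_any d (S : measurableType d) (R : realType)
    (mu : {measure set S -> \bar R}) (f g : S -> \bar R) :
  (forall x, (0 <= f x)%E) -> (forall x, (f x <= g x)%E) ->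
  (\int[mu]_x f x <= \int[mu]_x g x)%E.
Proof.
move=> f0 fg; rewrite !ge0_integralTE//; last by move=> x; exact: le_trans (fg x).
apply: le_ereal_sup => _ [h hf <-]; exists h => //= x.
exact: le_trans (hf x) (fg x).
Qed.

Section simple_functions.
Context {R : realType} {V : normedModType R} d (S : measurableType d).
Variable mu : {finite_measure set S -> \bar R}.

Lemma simple_fun_finite_valued (K : finType) (p : S -> K) (w : K -> V) :
  mpart p -> simple_fun (w \o p).
Proof.
move=> mp; split.
  have -> : range (w \o p) = w @` range p by rewrite image_comp.
  by apply: finite_image; exact: finite_finset.
by move=> v; exact: (mpart_preimage (fun k => w k = v) mp).
Qed.

Lemma simple_integral_finite_valued (K : finType) (p : S -> K) (w : K -> V) A :
  mpart p -> measurable A ->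
  simple_integral mu A (w \o p) = \sum_(k : K) mass mu (A `&` block p k) *: w k.
Proof.
move=> mp mA; have [fr _] := simple_fun_finite_valued w mp.
rewrite /simple_integral fsbig_finite//=.
set r := finmap.enum_fset _.
have memr k x : p x = k -> w k \in r.
  move=> pk; rewrite /r in_fset_set//; apply/mem_set; exists x => //=.
  by rewrite pk.
have ur : uniq r by exact: finmap.fset_uniq.
transitivity (\sum_(v <- r) \sum_(k : K | w k == v) mass mu (A `&` block p k) *: w k).
  apply: eq_bigr => v _.
  have mv : measurable ((w \o p) @^-1` [set v] `&` A).
    by apply: measurableI => //; exact: (mpart_preimage (fun k => w k = v) mp).
  rewrite -/(mass mu _) (mass_part mu mp mv) scaler_suml (bigID (fun k => w k == v))/=.
  rewrite [X in _ + X]big1 ?addr0.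
    apply: eq_bigr => k /eqP wk; rewrite -{2}wk; congr (mass mu _ *: _).
    apply/seteqP; split => x [].
      by move=> [_ Ax] px.
    by move=> Ax px; split => //; split => //=; rewrite (px : p x = k).
  move=> k wk; rewrite [_ `&` _](_ : _ = set0) ?mass0 ?scale0r//.
  apply/seteqP; split => // x [[/= wv _] px]; move: wk.
  by rewrite -(px : p x = k) wv eqxx.
rewrite (exchange_big_dep xpredT)//=; apply: eq_bigr => k _.
have [wr|wr] := boolP (w k \in r).
  rewrite -big_filter (_ : [seq i <- r | w k == i] = [:: w k]) ?big_seq1//.
  rewrite (eq_filter (_ : _ =1 pred1 (w k))); first exact: filter_pred1_uniq.
  by move=> v /=; rewrite eq_sym.
rewrite big1_seq//.
  rewrite [_ `&` _](_ : _ = set0) ?mass0 ?scale0r//.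
  by apply/seteqP; split => // x [_ /memr]; rewrite (negbTE wr).
by move=> v /andP[/eqP <-]; rewrite (negbTE wr).
Qed.

End simple_functions.

Section bochner_density.
Context {R : realType} {V : normedModType R} d (S : measurableType d).
Variables (mu : {finite_measure set S -> \bar R}) (G : set S -> V).
Hypotheses (vG : vector_measure G) (acG : vector_abs_continuous mu G).
Hypothesis Vcomplete : forall u : nat -> V,
  (forall e : R, 0 < e -> \forall n \near \oo, forall k, (n <= k)%N -> `|u n - u k| <= e) ->
  exists v : V, u n @[n --> \oo] --> v.
Hypothesis aG : averageable mu G (fun v => `|v|).

Let e (n : nat) : R := (1 / 2) ^+ n.

Let e_gt0 n : 0 < e n. Proof. by rewrite exprn_gt0. Qed.

Let eS n : e n = 2 * e n.+1. Proof. by rewrite /e exprS mulrA mulrC -mulrA; lra. Qed.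

Let e_cvg : (e n)%:E @[n --> \oo] --> 0%E.
Proof.
apply: cvg_EFin; first exact: nearW.
by apply: cvg_expr; rewrite ger0_norm//; lra.
Qed.

Lemma averages_exist : exists P : nat -> {K : finType & S -> K}, forall n,
  mpart (projT2 (P n)) /\ var_le (fun v => `|v|) (fun A => G A - average mu G (projT2 (P n)) A) (e n).
Proof.
have H n : exists P : {K : finType & S -> K}, mpart (projT2 P) /\
    var_le (fun v => `|v|) (fun A => G A - average mu G (projT2 P) A) (e n).
  have [K [p [mp H]]] := aG (e_gt0 n).
  by exists (existT _ K p); split => //=; exact: (H K p id).
have [P HP] := choice H.
by exists P.
Qed.

Let P := projT1 (cid averages_exist).
Let KK n : finType := projT1 (P n).
Let p n : S -> KK n := projT2 (P n).
Let mp n : mpart (p n) := (projT2 (cid averages_exist) n).1.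
Let vp n : var_le (fun v => `|v|) (fun A => G A - average mu G (p n) A) (e n) :=
  (projT2 (cid averages_exist) n).2.

Let w n (k : KK n) : V := (mass mu (block (p n) k))^-1 *: G (block (p n) k).

Let s n : S -> V := (@w n) \o p n.

Let averageE n A : average mu G (p n) A = \sum_(k : KK n) mass mu (A `&` block (p n) k) *: w k.
Proof. by apply: eq_bigr => k _; rewrite scalerA. Qed.

Let average_block n A k : A `<=` block (p n) k -> average mu G (p n) A = mass mu A *: w k.
Proof.
move=> Ak; rewrite averageE (bigD1 k)//= big1 ?addr0.
  by rewrite (setIidl Ak).
move=> j jk; rewrite [_ `&` _](_ : _ = set0) ?mass0 ?scale0r//.
apply/seteqP; split => // x [/Ak kx jx]; move: jk.
by rewrite -(kx : p n x = k) -(jx : p n x = j) eqxx.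
Qed.

Let h n x : R := `|s n.+1 x - s n x|.

Let h_ge0 n x : 0 <= h n x. Proof. exact: normr_ge0. Qed.

Let mh n : measurable_fun setT (h n).
Proof.
pose q x := (p n.+1 x, p n x).
have mq : mpart q by apply: mpart_pair; exact: mp.
exact: (measurable_finite_valued (fun kk : KK n.+1 * KK n => `|w kk.1 - w kk.2|) mq).
Qed.

Let int_h n : (\int[mu]_x (h n x)%:E <= (2 * e n)%:E)%E.
Proof.
pose q x := (p n.+1 x, p n x).
have mq : mpart q by apply: mpart_pair; exact: mp.
rewrite [leLHS](_ : _ = \int[mu]_x ((fun kk : KK n.+1 * KK n => `|w kk.1 - w kk.2|) (q x))%:E)%E//.
rewrite (@integral_finite_valued _ _ _ mu _ q setT (fun kk : KK n.+1 * KK n => `|w kk.1 - w kk.2|))//.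
rewrite lee_fin.
have -> : \sum_(k : KK n.+1 * KK n) `|w k.1 - w k.2| * mass mu (setT `&` block q k) =
    \sum_(k : KK n.+1 * KK n) `|(G (block q k) - average mu G (p n) (block q k)) -
       (G (block q k) - average mu G (p n.+1) (block q k))|.
  apply: eq_bigr => k _; rewrite setTI.
  rewrite (@average_block n _ k.2); last by move=> x <-.
  rewrite (@average_block n.+1 _ k.1); last by move=> x <-.
  rewrite [X in _ = `|X|](_ : _ = mass mu (block q k) *: (w k.1 - w k.2)).
    by rewrite normrZ ger0_norm ?mass_ge0// mulrC.
  by rewrite opprB addrC subrKA scalerBr.
apply: (@le_trans _ _ (e n + e n.+1)); last by have := eS n; have := e_gt0 n; lra.
apply: le_trans (lerD (vp n mq) (vp n.+1 mq)).
by rewrite -big_split/=; apply: ler_sum => k _; exact: ler_normB.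
Qed.

(* T n bounds the distance from the n-th step function to the limit. *)
Let T n x : \bar R := (\sum_(n <= i <oo) (h i x)%:E)%E.

Let int_T n : (\int[mu]_x T n x <= (4 * e n)%:E)%E.
Proof.
rewrite (_ : T n = fun x => \sum_(0 <= i <oo) (h (i + n)%N x)%:E)%E; last first.
  by apply/funext => x; rewrite /T -(nneseries_addn (f := fun i => (h i x)%:E))// => i; rewrite lee_fin ?h_ge0.
rewrite integral_nneseries//; last first.
- by move=> i x _; rewrite lee_fin ?h_ge0.
- by move=> i; apply/measurable_EFinP; exact: mh.
apply: lime_le.
  by apply: is_cvg_nneseries => i _ _; apply: integral_ge0 => x _; rewrite lee_fin ?h_ge0.
apply: nearW => k.
apply: (@le_trans _ _ (\sum_(0 <= i < k) (2 * e (i + n)%N)%:E)%E).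
  by apply: lee_sum => i _; exact: int_h.
rewrite sumEFin lee_fin.
suff -> : \sum_(0 <= i < k) 2 * e (i + n)%N = 4 * e n - 4 * e (k + n)%N.
  by rewrite gerDl oppr_le0 mulr_ge0// ltW.
elim: k => [|k ih]; first by rewrite big_nil add0n subrr.
by rewrite big_nat_recr//= ih addSn (eS (k + n)%N); lra.
Qed.

Let dist_T n x k : (n <= k)%N -> (`|s n x - s k x|%:E <= T n x)%E.
Proof.
move=> nk; apply: (@le_trans _ _ (\sum_(n <= i < k) (h i x)%:E)%E); last first.
  by apply: nneseries_lim_ge => i _ _; rewrite lee_fin ?h_ge0.
rewrite sumEFin lee_fin distrC; elim: k nk => [|k ih].
  by rewrite leqn0 => /eqP ->; rewrite subrr normr0 big_nil.
rewrite leq_eqVlt => /predU1P[->|]; first by rewrite subrr normr0 sumr_ge0// => i _; exact: normr_ge0.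
rewrite ltnS => nk; rewrite big_nat_recr//= addrC.
rewrite -[X in `|X|](subrKA (s k x)) (le_trans (ler_normD _ _))//.
by rewrite lerD// ih.
Qed.

Let T_split n x : T 0 x = ((\sum_(0 <= i < n) h i x)%:E + T n x)%E.
Proof.
rewrite /T (nneseries_split 0 n)//; last by move=> k _; rewrite lee_fin ?h_ge0.
by rewrite add0n sumEFin.
Qed.

Let T_cvg x : (T 0 x < +oo)%E -> exists v : V, s n x @[n --> \oo] --> v.
Proof.
move=> Tx; apply: Vcomplete => r r0.
have hk k : true -> (0 <= (h k x)%:E)%E by rewrite lee_fin h_ge0.
have /cvge0_near/(_ r0) := nneseries_tail_cvg Tx hk.
by apply: filterS => n Tn k nk; rewrite -lee_fin; apply: le_trans Tn; exact: dist_T.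
Qed.

Let g x : V := if pselect (exists v : V, s n x @[n --> \oo] --> v) is left ex
  then projT1 (cid ex) else 0.

Let g_cvg x : (T 0 x < +oo)%E -> s n x @[n --> \oo] --> g x.
Proof.
move=> /T_cvg ex; rewrite /g; case: pselect => // ex'.
by case: cid.
Qed.

Let dist_g n x : (`|s n x - g x|%:E <= T n x)%E.
Proof.
have [Tx|] := ltP (T n x) +oo%E; last by rewrite leye_eq => /eqP ->; rewrite leey.
have T0x : (T 0 x < +oo)%E by rewrite (T_split n) lte_add_pinfty// ltry.
have T0 : (0 <= T n x)%E by apply: nneseries_ge0 => i _ _; rewrite lee_fin ?h_ge0.
have Tf : T n x = (fine (T n x))%:E by rewrite fineK// ge0_fin_numE.
rewrite Tf lee_fin.
have C : `|s n x - s k x| @[k --> \oo] --> `|s n x - g x|.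
  by apply: cvg_norm; apply: cvgB; [exact: cvg_cst|exact: g_cvg].
apply: (closed_cvg (fun y : R => y <= fine (T n x))) C; first exact: closed_le.
exists n => // k /= nk; rewrite -lee_fin -Tf; exact: dist_T.
Qed.

Let s_approx : L1_approx mu g s.
Proof.
split; first by move=> n; exact: simple_fun_finite_valued.
apply: (@squeeze_cvge _ _ _ _ (fun=> 0%E) _ (fun n => (4 * e n)%:E)).
- apply: nearW => n; apply/andP; split.
    by apply: integral_ge0 => x _; rewrite lee_fin.
  apply: le_trans (int_T n); apply: ge0_le_integral_any => x; first by rewrite lee_fin.
  exact: dist_g.
- exact: cvg_cst.
- rewrite -(mule0 4%:E); under eq_fun do rewrite EFinM.
  by apply: cvgeZl.
Qed.

(** Partitions with errors 2^-n give step functions whose successive distances in mean are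
    summable; they converge almost everywhere to a density. *)
Lemma bochner_density : exists2 g : S -> V, bochner_integrable mu g &
  forall A, measurable A -> is_bochner_integral mu A g (G A).
Proof.
exists g.
  split; last by exists s.
  exists s; first by move=> n; exact: simple_fun_finite_valued.
  have iT : mu.-integrable setT (T 0).
    apply/integrableP; split.
      by apply: ge0_emeasurable_sum => [i x _ _|i _]; [rewrite lee_fin h_ge0|apply/measurable_EFinP; exact: mh].
    under eq_integral => x _.
      rewrite gee0_abs; last by apply: nneseries_ge0 => i _ _; rewrite lee_fin h_ge0.
      over.
    by rewrite (le_lt_trans (int_T 0))// ltry.
  apply: filterS (integrable_ae measurableT iT) => x /(_ I) fx.
  by apply: g_cvg; rewrite ltey_eq fx.
move=> A mA; exists s => //.
have -> : (fun n => simple_integral mu A (s n)) = (fun n => average mu G (p n) A).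
  by apply/funext => n; rewrite simple_integral_finite_valued// averageE.
apply/cvgrPdist_le => r r0.
have := cvge0_near e_cvg r0; apply: filterS => n; rewrite lee_fin => er.
apply: le_trans er; have := vp n (mpart_set mA); apply: le_trans.
by rewrite (bigD1 true)//= block_in lerDl sumr_ge0.
Qed.

End bochner_density.

Section tame_RNP.
Context {R : realType} {V : normedModType R} d (S : measurableType d).
Variables (mu : {finite_measure set S -> \bar R}) (G : set S -> V).
Hypotheses (vG : vector_measure G) (bG : vector_bounded_variation G)
  (acG : vector_abs_continuous mu G).

Lemma tame_averageable q : tame q -> averageable mu G q.
Proof.
elim=> {q} [f|q1 q2 _ h1 _ h2|q q' C sq C0 qq' tq' h|W T D ex _ h].
- exact: averageable_dual.
- exact: averageable_add.
- exact: (averageable_le (tame_seminorm tq') qq' C0 h).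
- exact: (averageable_glue vG bG acG ex h).
Qed.

End tame_RNP.

Theorem tame_RNP (R : realType) (V : normedModType R) :
  (forall u : nat -> V,
    (forall e : R, 0 < e ->
      \forall n \near \oo, forall k, (n <= k)%N -> `|u n - u k| <= e) ->
    exists v : V, u n @[n --> \oo] --> v) ->
  tame (fun v : V => `|v|) -> Radon_Nikodym_property V.
Proof.
move=> cV tV d S mu G vG bG acG.
by apply: bochner_density => //; exact: tame_averageable.
Qed.

(** * Geodesics in R-trees *)

Section clamp.
Context {R : realType}.

Definition clamp (a t : R) : R := Num.max 0 (Num.min t a).

Lemma clamp_itv a t : 0 <= a -> 0 <= clamp a t <= a.
Proof. by move=> a0; rewrite /clamp; case: (lerP t a) => ta; case: (lerP 0 t) => t0;
  rewrite ?(max_r a0); lra. Qed.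

Lemma clamp_id a t : 0 <= t <= a -> clamp a t = t.
Proof. by move=> /andP[t0 ta]; rewrite /clamp min_l// max_r. Qed.

Lemma clamp_lip a s t : 0 <= a -> `|clamp a s - clamp a t| <= `|s - t|.
Proof.
move=> a0; rewrite /clamp.
have [st|st] := lerP 0 (s - t); [rewrite (ger0_norm st)|rewrite (ltr0_norm st)];
  rewrite ler_norml; case: (lerP s a) => sa; case: (lerP t a) => ta;
  case: (lerP 0 s) => s0; case: (lerP 0 t) => t0;
  rewrite ?(max_r a0); apply/andP; split; lra.
Qed.

End clamp.

Section lipschitz_paths.
Context {R : realType} {T : metricType R}.

Lemma lipschitz_continuous (h : R -> T) : (forall s t, mdist (h s) (h t) <= `|s - t|) ->
  continuous h.
Proof.
move=> hl t; apply/metricType_numDomainType.cvgrPdist_lt => e e0.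
apply/nbhs_ballP; exists e => //= s ts.
exact: le_lt_trans (hl _ _) ts.
Qed.

Lemma lipschitz_arc (h : R -> T) (L : R) : 0 < L ->
  (forall s t, 0 <= s <= L -> 0 <= t <= L -> mdist (h s) (h t) <= `|s - t|) ->
  (forall s t, 0 <= s <= L -> 0 <= t <= L -> h s = h t -> s = t) ->
  is_arc (h 0) (h L) (h @` `[0, L]).
Proof.
move=> L0 hl hi; have L0' := ltW L0.
pose g t := h (clamp L (L * t)).
have gE t : 0 <= t <= 1 -> g t = h (L * t).
  by move=> /andP[t0 t1]; rewrite /g clamp_id// mulr_ge0//= ger_pMr.
exists g; split.
- apply: continuous_subspaceT => t.
  apply: (@continuous_comp _ _ _ (fun t => L * t) (fun s => h (clamp L s))).
    by apply: mulrl_continuous.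
  apply: lipschitz_continuous => s s'.
  by rewrite (le_trans (hl _ _ _ _)) ?clamp_itv// clamp_lip.
- move=> s t; rewrite !inE/= !in_itv/= => s01 t01.
  rewrite !gE// => /hi; move: s01 t01 => /andP[s0 s1] /andP[t0 t1].
  by rewrite !mulr_ge0//= !ger_pMr// s1 t1 => /(_ isT isT)/mulfI; apply; rewrite gt_eqF.
- by rewrite gE ?mulr0// lexx ler01.
- by rewrite gE ?mulr1// lexx ler01.
- apply/seteqP; split => [_ [s /=] + <-|_ [t /=] + <-]; rewrite in_itv/= => /andP[s0 s1].
    exists (s / L); first by rewrite /= in_itv/= divr_ge0//= ler_pdivrMr// mul1r.
    rewrite gE; first by rewrite mulrCA divff ?mulr1// gt_eqF.
    by rewrite divr_ge0//= ler_pdivrMr// mul1r.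
  exists (L * t); last by rewrite gE// s0 s1.
  by rewrite /= in_itv/= mulr_ge0//= ger_pMr.
Qed.

End lipschitz_paths.

Section rtree_rays.
Context {R : realType} {T : metricType R}.
Hypothesis hT : is_rtree T.

Lemma arc_neq (x y : T) A : is_arc x y A -> x <> y.
Proof.
move=> [g [_ gi g0 g1 _]] xy.
have i0 : (0 : R) \in `[0, 1]%classic by rewrite inE/= in_itv/= lexx ler01.
have i1 : (1 : R) \in `[0, 1]%classic by rewrite inE/= in_itv/= lexx ler01.
have := gi 0 1 i0 i1; rewrite g0 g1 => /(_ xy) /eqP.
by rewrite eq_sym oner_eq0.
Qed.

Lemma arc_unique (x y : T) A B : is_arc x y A -> is_arc x y B -> A = B.
Proof.
move=> aA aB; have [C [_ h _]] := hT (arc_neq aA).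
by rewrite (h _ aA) (h _ aB).
Qed.

Definition geodesic (x y : T) (g : R -> T) : Prop :=
  [/\ g 0 = x, g (mdist x y) = y &
      forall s t, 0 <= s <= mdist x y -> 0 <= t <= mdist x y ->
        mdist (g s) (g t) = `|s - t|].

(** The isometry of the arc onto [0, d(x, y)] sends x to one of the two ends; after a reversal
    if necessary, its inverse is a geodesic from x to y. *)
Lemma geodesic_exists (x y : T) : exists g, geodesic x y g /\
  (x <> y -> is_arc x y (g @` `[0, mdist x y])).
Proof.
have [->|xy] := pselect (x = y).
  exists (fun=> y); split => //; split => // s t; rewrite mdistxx => s0 t0.
  have -> : s = 0 by lra.
  have -> : t = 0 by lra.
  by rewrite subrr normr0.
set d := mdist x y.
have d0 : 0 < d by rewrite mdist_gt0; exact/eqP.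
have [A [aA uA [phi [iso im]]]] := hT xy.
have [g0 [_ _ g00 g01 AE]] := aA.
have Ax : A x.
  by rewrite AE -g00; exists 0 => //=; rewrite in_itv/= lexx ler01.
have Ay : A y.
  by rewrite AE -g01; exists 1 => //=; rewrite in_itv/= lexx ler01.
have bnd z : A z -> 0 <= phi z <= d.
  move=> Az; have : (phi @` A) (phi z) by exists z.
  by rewrite im /= in_itv/=.
have [psi [[iso' bnd'] im' px py]] : exists psi : T -> R,
    [/\ (forall u v, A u -> A v -> `|psi u - psi v| = mdist u v) /\
        (forall z, A z -> 0 <= psi z <= d),
        forall t, 0 <= t <= d -> exists2 z, A z & psi z = t,
        psi x = 0 & psi y = d].
  have sur t : 0 <= t <= d -> exists2 z, A z & phi z = t.
    move=> td; have [z Az <-] : (phi @` A) t by rewrite im /= in_itv/=.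
    by exists z.
  have := iso _ _ Ax Ay; rewrite -/d; have := bnd _ Ax; have := bnd _ Ay.
  move=> /andP[y0 y1] /andP[x0 x1].
  have [le|lt] := lerP (phi x) (phi y).
    move=> e; by exists phi; split => //; lra.
  move=> e; exists (fun z => d - phi z); split; [split|move=> t /andP[t0 td]|lra|lra].
    by move=> u v Au Av; rewrite -iso// distrC; congr (`|_|); ring.
    by move=> z /bnd /andP[z0 z1]; apply/andP; split; lra.
  have [|z Az pz] := sur (d - t); first by apply/andP; split; lra.
  by exists z => //; rewrite pz subKr.
have inv t : exists z, 0 <= t <= d -> A z /\ psi z = t.
  have [/im'[z Az pz]|nt] := pselect (0 <= t <= d); first by exists z.
  by exists x.
have [g Hg] := choice inv.
have gpsi z : A z -> g (psi z) = z.
  move=> Az; have bz := bnd' _ Az.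
  by apply: mdist_positivity; have [Ag pg] := Hg _ bz; rewrite -iso'// pg subrr normr0.
have geo : geodesic x y g.
  split; [by rewrite -px gpsi|by rewrite -/d -py gpsi|] => s t /Hg[As ps] /Hg[At pt].
  by rewrite -iso'// ps pt.
exists g; split => // _; have [ge0 ge1 ge] := geo.
rewrite -{1}ge0 -[X in is_arc _ X _]ge1; apply: lipschitz_arc => //.
  by move=> s t s0 t0; rewrite ge.
by move=> s t s0 t0 gst; apply/eqP; rewrite -subr_eq0 -normr_eq0 -ge// gst mdistxx.
Qed.

Lemma geodesic_lip_arc (x y : T) g : geodesic x y g -> forall c, 0 < c <= mdist x y ->
  is_arc x (g c) (g @` `[0, c]).
Proof.
move=> [g0 _ gi] c /andP[c0 cd]; rewrite -{1}g0.
have sub s : 0 <= s <= c -> 0 <= s <= mdist x y.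
  by move=> /andP[-> sc]; rewrite (le_trans sc).
apply: lipschitz_arc => // s t /sub s0 /sub t0; first by rewrite gi.
by move=> gst; apply/eqP; rewrite -subr_eq0 -normr_eq0 -gi// gst mdistxx.
Qed.

Lemma segment_geodesic (x y : T) g : x <> y -> geodesic x y g ->
  segment x y = g @` `[0, mdist x y].
Proof.
move=> xy gg; have d0 : 0 < mdist x y by rewrite mdist_gt0; exact/eqP.
have [_ g1 _] := gg.
have aA := geodesic_lip_arc gg (c := mdist x y); rewrite g1 in aA.
have {}aA := aA (introT andP (conj d0 (lexx _))).
apply/seteqP; split => [z [B aB Bz]|z Az]; last by exists (g @` `[0, mdist x y]).
by rewrite (arc_unique aA aB).
Qed.

Lemma geodesic_dist0 (x y : T) g t : geodesic x y g -> 0 <= t <= mdist x y ->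
  mdist x (g t) = t.
Proof.
move=> [g0 _ gi] /andP[t0 t1]; rewrite -{1}g0 gi ?lexx ?mdist_ge0 ?t0//.
by rewrite sub0r normrN ger0_norm.
Qed.

Lemma geodesic_dist1 (x y : T) g t : geodesic x y g -> 0 <= t <= mdist x y ->
  mdist (g t) y = mdist x y - t.
Proof.
move=> [_ g1 gi] /andP[t0 t1]; rewrite -{1}g1 gi ?lexx ?mdist_ge0 ?t0//.
by rewrite distrC ger0_norm ?subr_ge0.
Qed.

(** Let c be the last time at which the geodesics agree. They agree before c by uniqueness of
    arcs, and do not meet after c; so the path from x to g c and then to y is an arc, hence
    the geodesic from x to y. *)
Lemma geodesic_branch (o x y : T) (g h : R -> T) :
  geodesic o x g -> geodesic o y h ->
  exists c, [/\ 0 <= c <= mdist o x, c <= mdist o y,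
    forall t, 0 <= t <= c -> g t = h t &
    mdist x y = mdist o x + mdist o y - 2 * c].
Proof.
move=> gg hh.
set a := mdist o x; set b := mdist o y.
have a0 : 0 <= a by exact: mdist_ge0. have b0 : 0 <= b by exact: mdist_ge0.
pose S := [set t | [/\ 0 <= t <= a, t <= b & g t = h t]].
have [g0 g1 gi] := gg; have [h0 h1 hi] := hh.
have S0 : S 0 by split; rewrite ?lexx ?a0// g0 h0.
have hS : has_sup S by split; [exists 0|exists a => t [/andP[]]].
set c := sup S.
have c0 : 0 <= c by apply: ub_le_sup => //; case: hS.
have ca : c <= a by apply: ge_sup; [exists 0|move=> t [/andP[]]].
have cb : c <= b by apply: ge_sup; [exists 0|move=> t []].
have gc : g c = h c.
  apply: mdist_positivity; apply/eqP; rewrite eq_le mdist_ge0 andbT.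
  apply/ler_addgt0Pr => e e0; rewrite add0r.
  have [t [/andP[t0 ta] tb gt] tc] := sup_adherent (divr_gt0 e0 (ltr0Sn R 1)) hS.
  have tc' : t <= c by apply: ub_le_sup; [case: hS|split; rewrite ?t0 ?ta].
  rewrite (le_trans (metric_triangle _ (g t) _))// gi ?c0 ?t0// gt hi ?c0 ?t0//.
  by rewrite ger0_norm ?subr_ge0// distrC ger0_norm ?subr_ge0//; move: tc; rewrite -/c; lra.
have gd t : 0 <= t <= a -> mdist o (g t) = t by exact: geodesic_dist0.
have hd t : 0 <= t <= b -> mdist o (h t) = t by exact: geodesic_dist0.
have agree t : 0 <= t <= c -> g t = h t.
  move=> /andP[t0 tc]; have [c_eq0|c_neq0] := eqVneq c 0.
    by have -> : t = 0 by [rewrite c_eq0 in tc; lra]; rewrite g0 h0.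
  have cp : 0 < c by rewrite lt_def c_neq0.
  have A1 : is_arc o (g c) (g @` `[0, c]) by apply: geodesic_lip_arc gg _ _; rewrite cp.
  have A2 : is_arc o (g c) (h @` `[0, c]).
    by rewrite gc; apply: geodesic_lip_arc hh _ _; rewrite cp.
  have : (g @` `[0, c]) (g t) by exists t => //=; rewrite in_itv/= t0.
  rewrite (arc_unique A1 A2) => -[s /=]; rewrite in_itv/= => /andP[s0 sc] e.
  have st : s = t.
    rewrite -(hd s) ?s0 ?(le_trans sc)// e gd// t0 (le_trans tc)//.
  by rewrite -e st.
have sep s t : c <= s <= a -> c < t <= b -> g s <> h t.
  move=> /andP[cs sa] /andP[ct tb] e.
  have st : s = t.
    rewrite -(gd s) ?sa ?(le_trans c0)// e hd// tb (le_trans c0)//.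
    exact: ltW.
  have : t <= c; last by rewrite leNgt ct.
  apply: ub_le_sup; first by case: hS.
  by split => //; [rewrite -st sa (le_trans c0)|rewrite -e st].
exists c; split; rewrite ?c0 ?ca//.
pose L := a + b - 2 * c.
have [L_eq0|L_neq0] := eqVneq L 0.
  have e1 : a = c by rewrite /L in L_eq0; lra.
  have e2 : b = c by rewrite /L in L_eq0; lra.
  by rewrite -g1 -h1 -/a -/b -/L L_eq0 {1}e1 e2 gc mdistxx.
have L0 : 0 < L by rewrite lt_def L_neq0/= /L; lra.
(* the path from x back to g c and on to y, parametrized by length *)
pose k s := if s <= a - c then g (a - s) else h (s - a + 2 * c).
have kl s : 0 <= s -> s <= a - c -> k s = g (a - s) by move=> _ h'; rewrite /k h'.
have kr s : a - c <= s -> k s = h (s - a + 2 * c).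
  move=> s1; rewrite /k; case: ifPn => // s2.
  have -> : s = a - c by lra.
  have -> : a - (a - c) = c by lra.
  by have -> : a - c - a + 2 * c = c by lra.
have gdist s t : 0 <= s <= a -> 0 <= t <= a -> mdist (g s) (g t) = `|s - t| by exact: gi.
have hdist s t : 0 <= s <= b -> 0 <= t <= b -> mdist (h s) (h t) = `|s - t| by exact: hi.
have klip s t : 0 <= s <= L -> 0 <= t <= L -> s <= t -> mdist (k s) (k t) <= `|s - t|.
  rewrite /L => /andP[s0 sL] /andP[t0 tL] st.
  have [t1|t1] := lerP t (a - c).
    rewrite !kl//; last lra.
    by rewrite gdist; [rewrite -normrN; apply/eqP; apply/eqP; rewrite le_eqVlt; apply/orP; left; apply/eqP; congr (`|_|); lra|apply/andP; split; lra|apply/andP; split; lra].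
  have [s1|s1] := lerP (a - c) s.
    rewrite (kr _ s1) (kr _ (ltW t1)) hdist; [|apply/andP; split; lra|apply/andP; split; lra].
    by rewrite le_eqVlt; apply/orP; left; apply/eqP; congr (`|_|); lra.
  rewrite (le_trans (metric_triangle _ (g c) _))//.
  rewrite (kl _ s0 (ltW s1)) {2}gc (kr _ (ltW t1)) gdist ?hdist; try (apply/andP; split; lra).
  rewrite [X in X + _]ger0_norm; last lra.
  rewrite [X in _ + X]ler0_norm; last lra.
  by rewrite [leRHS]ler0_norm; lra.
have kinj s t : 0 <= s <= L -> 0 <= t <= L -> s <= t -> k s = k t -> s = t.
  rewrite /L => /andP[s0 sL] /andP[t0 tL] st.
  have [t1|t1] := lerP t (a - c).
    rewrite !kl//; last lra.
    move=> e; have := gdist (a - s) (a - t); rewrite e mdistxx.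
    move=> h'; have /esym/eqP := h' ltac:(apply/andP; split; lra) ltac:(apply/andP; split; lra).
    by rewrite normr_eq0 => /eqP; lra.
  have [s1|s1] := lerP (a - c) s.
    rewrite (kr _ s1) (kr _ (ltW t1)) => e; have := hdist (s - a + 2 * c) (t - a + 2 * c); rewrite e mdistxx.
    move=> h'; have /esym/eqP := h' ltac:(apply/andP; split; lra) ltac:(apply/andP; split; lra).
    by rewrite normr_eq0 => /eqP; lra.
  rewrite (kl _ s0 (ltW s1)) (kr _ (ltW t1)) => /sep h'; exfalso; apply: h'; apply/andP; split; lra.
have k0 : k 0 = x by rewrite kl ?subr0// subr_ge0.
have k1 : k L = y.
  rewrite kr /L; last lra.
  by have -> : a + b - 2 * c - a + 2 * c = b by lra.
have aK : is_arc x y (k @` `[0, L]).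
  rewrite -k0 -k1; apply: lipschitz_arc => // s t s0 t0.
    have [st|/ltW ts] := leP s t; first exact: klip.
    by rewrite metric_sym distrC klip.
  by have [/kinj h'|/ltW/kinj h' /esym] := leP s t; [exact: h'|move/h' => ->].
have xy := arc_neq aK.
have [f [ff /(_ xy) aF]] := geodesic_exists x y.
have : (k @` `[0, L]) (g c).
  exists (a - c); first by rewrite /= in_itv/= /L; apply/andP; split; lra.
  by rewrite kl ?subr_ge0//; congr g; lra.
rewrite (arc_unique aK aF) => -[u /=]; rewrite in_itv/= => u0 e.
have d0 := geodesic_dist0 ff u0; have d1 := geodesic_dist1 ff u0.
rewrite e metric_sym in d0; rewrite e gc in d1.
have e0 := geodesic_dist1 (t := c) gg; rewrite -/a c0 ca in e0.
have e1 := geodesic_dist1 (t := c) hh; rewrite -/b c0 cb in e1.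
move: (e0 isT) (e1 isT); rewrite d0 d1; lra.
Qed.

End rtree_rays.

(** * Means of difference quotients *)

Section difference_quotient.
Context {R : realType}.
Notation mu := (@lebesgue_measure R).

Lemma continuous_primitive (f : R -> R) (a b : R) : continuous f ->
  exists F : R -> R, forall x, a < x < b -> is_derive x 1 F (f x).
Proof.
move=> cf; have [ab|ba] := ltP a b; last first.
  by exists f => x /andP[ax xb]; have := lt_le_trans (lt_trans ax xb) ba; rewrite ltxx.
pose F x := (\int[mu]_(t in `[a, x]) f t)%R.
exists F => x /andP[ax xb].
have int_f : mu.-integrable `[a, b] (EFin \o f).
  by apply: continuous_compact_integrable; [exact: segment_compact|exact: continuous_subspaceT].
have [dF F'] : derivable F x 1 /\ F^`()%classic x = f x.
  by apply: (continuous_FTC1 xb) => //; exact: cf.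
by rewrite -F' derive1E; exact: derivableP.
Qed.

Lemma Lip1_continuous (f : R -> R) : (forall s t, `|f s - f t| <= `|s - t|) -> continuous f.
Proof.
move=> fl t; apply/cvgrPdist_lt => e e0; apply/nbhs_ballP; exists e => //= s ts.
exact: le_lt_trans (fl _ _) ts.
Qed.

(** In terms of a primitive of f, the integral is the difference of the means of f over the
    intervals of length h that end at b and at a. *)
Lemma integral_increment (f : R -> R) (a b h : R) : 0 < h -> a <= b ->
  (forall s t, `|f s - f t| <= `|s - t|) ->
  `|(\int[mu]_(t in `[a, b]) ((f t - f (t - h)) / h))%R - (f b - f a)| <= 2 * h.
Proof.
move=> h0; rewrite le_eqVlt => /predU1P[<-|ab] fl.
  rewrite set_itv1 /Rintegral integral_set1 subrr subr0 normr0.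
  by rewrite mulr_ge0// ltW.
have cf := Lip1_continuous fl.
have [F dF] := continuous_primitive (a - h - 1) (b + 1) cf.
have dF' x : a - h - 1 < x < b + 1 -> derivable F x 1.
  by move=> xab; have dFx := dF x xab; apply: ex_derive.
have mvt x : a <= x <= b -> exists2 y, x - h < y < x & F x - F (x - h) = f y * h.
  move=> /andP[ax xb].
  have [|||y] := @MVT R F f (x - h) x; first lra.
  - by move=> y; rewrite in_itv/= => /andP[y1 y2]; apply: dF; apply/andP; split; lra.
  - apply: derivable_within_continuous => y; rewrite in_itv/= => /andP[y1 y2].
    by apply: dF'; apply/andP; split; lra.
  rewrite in_itv/= => yx ->; exists y => //; congr (_ * _); lra.
pose H t := F t - F (t - h).
have dH x : a - 1 < x < b + 1 -> is_derive x 1 H (f x - f (x - h)).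
  move=> /andP[x1 x2].
  have d1 : is_derive x 1 F (f x) by apply: dF; apply/andP; split; lra.
  have d2 : is_derive (shift (- h) x) 1 F (f (x - h)).
    by apply: dF; rewrite /shift; apply/andP; split; lra.
  have d3 : is_derive x 1 (shift (- h)) (1 : R) by exact: is_derive_shift.
  have d4 := is_derive1_comp d2 d3; rewrite mulr1 in d4.
  exact: is_deriveB.
have cff : continuous (fun t => f t - f (t - h)).
  move=> t; apply: cvgB; first exact: cf.
  apply: (@continuous_comp _ _ _ (fun t => t - h) f); last exact: cf.
  by apply: cvgB; [exact: cvg_id|exact: cvg_cst].
have iff : mu.-integrable `[a, b] (EFin \o (fun t => f t - f (t - h))).
  by apply: continuous_compact_integrable; [exact: segment_compact|exact: continuous_subspaceT].
have ftc : (\int[mu]_(t in `[a, b]) (f t - f (t - h)))%R = H b - H a.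
  rewrite /Rintegral (@continuous_FTC2 R _ H)//.
  - exact: continuous_subspaceT.
  - have cH x : a - 1 < x < b + 1 -> H t @[t --> x] --> H x.
      move=> xab; have dHx := dH x xab.
      by apply: differentiable_continuous; apply/derivable1_diffP; apply: ex_derive.
    split.
    + move=> x; rewrite in_itv/= => /andP[x1 x2].
      have dHx : is_derive x 1 H (f x - f (x - h)) by apply: dH; apply/andP; split; lra.
      by apply: ex_derive.
    + by apply: cvg_at_right_filter; apply: cH; apply/andP; split; lra.
    + by apply: cvg_at_left_filter; apply: cH; apply/andP; split; lra.
  - move=> x; rewrite in_itv/= => /andP[x1 x2].
    have dHx : is_derive x 1 H (f x - f (x - h)) by apply: dH; apply/andP; split; lra.
    by rewrite derive1E; exact: derive_val.
under eq_Rintegral do rewrite mulrC.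
rewrite RintegralZl// ftc.
have [|y1 /andP[y11 y12] e1] := mvt a; first by rewrite lexx ltW.
have [|y2 /andP[y21 y22] e2] := mvt b; first by rewrite lexx ltW.
rewrite /H e1 e2 -mulrBl mulrC mulfK ?gt_eqF//.
rewrite [X in `|X|](_ : _ = (f y2 - f b) - (f y1 - f a)); last by ring.
rewrite (le_trans (ler_normB _ _))// mulr2n mulrDl !mul1r lerD//; apply: le_trans (fl _ _) _.
  by rewrite ler0_norm; lra.
by rewrite ler0_norm; lra.
Qed.

End difference_quotient.

(** * Functionals constant at a small scale *)

Section mcshane.
Context {R : realType} {T : metricType R} (M : set T).

(** Extension of 1-Lipschitz functions by infimal convolution; the metric subspace is given as
    a family of points, and the distance as a function. *)
Lemma mcshane (I X : Type) (D : X -> X -> R) (p : I -> X) (f : I -> R) (i0 : I) :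
  (forall x, D x x = 0) -> (forall x y, D x y = D y x) ->
  (forall x y z, D x z <= D x y + D y z) ->
  (forall i j, `|f i - f j| <= D (p i) (p j)) ->
  exists F : X -> R, (forall z z', `|F z - F z'| <= D z z') /\
    forall i, F (p i) = f i.
Proof.
move=> D0 Dsym Dtri fl.
pose A z := [set f i + D (p i) z | i in [set: I]].
have hA z : has_inf (A z).
  split; first by exists (f i0 + D (p i0) z), i0.
  exists (f i0 - D (p i0) z) => _ [i _ <-].
  have := le_trans (ler_norm _) (fl i0 i).
  have := Dtri (p i0) z (p i); rewrite (Dsym z); lra.
have lip z z' : inf (A z) <= inf (A z') + D z z'.
  rewrite -lerBlDr; apply: lb_le_inf; first by have [] := hA z'.
  move=> _ [i _ <-]; rewrite lerBlDr -addrA.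
  apply: (@le_trans _ _ (f i + D (p i) z)).
    by apply: ge_inf; [case: (hA z)|exists i].
  by rewrite lerD2l (Dsym z z') Dtri.
exists (fun z => inf (A z)); split.
  move=> z z'; rewrite ler_norml; have := lip z z'; have := lip z' z.
  by rewrite (Dsym z' z) => h1 h2; apply/andP; split; lra.
move=> i; apply/eqP; rewrite eq_le; apply/andP; split.
  by apply: ge_inf; [case: (hA (p i))|exists i => //; rewrite D0 addr0].
apply: lb_le_inf; first by have [] := hA (p i).
by move=> _ [j _ <-]; have := le_trans (ler_norm _) (fl i j); rewrite Dsym; lra.
Qed.

Definition dist_to (z : T) : R := inf [set mdist (set_val x) z | x in [set: M]].

Lemma dist_to_le (x : M) z : dist_to z <= mdist (set_val x) z.
Proof. by apply: ge_inf; [exists 0 => _ [y _ <-]; exact: mdist_ge0|exists x]. Qed.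

Lemma dist_to_lip (o : M) z z' : `|dist_to z - dist_to z'| <= mdist z z'.
Proof.
have lip u u' : dist_to u <= dist_to u' + mdist u u'.
  rewrite -lerBlDr; apply: lb_le_inf; first by exists (mdist (set_val o) u'), o.
  move=> _ [x _ <-]; rewrite lerBlDr (le_trans (dist_to_le x u))//.
  by rewrite (metric_sym u) metric_triangle.
rewrite ler_norml; have := lip z z'; have := lip z' z.
by rewrite (metric_sym z' z) => h1 h2; apply/andP; split; lra.
Qed.

Lemma dist_to_closed (o : M) z : closed M -> dist_to z <= 0 -> M z.
Proof.
move=> cM dz; apply: cM => B /nbhs_ballP[e /= e0 eB].
have h : has_inf [set mdist (set_val x) z | x in [set: M]].
  by split; [exists (mdist (set_val o) z), o|exists 0 => _ [y _ <-]; exact: mdist_ge0].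
have [_ [x _ <-] xe] := inf_adherent e0 h.
exists (set_val x); split; first exact: set_valP.
apply: eB; rewrite ballEmdist/= metric_sym; apply: lt_le_trans xe _.
by rewrite gerDr.
Qed.

End mcshane.

Section flat_system.
Context {R : realType} {N : metricType R} (o : N) (r : R) (r0 : 0 < r).

Lemma free_evalD (f g : lip0 o) : free_eval (f + g) = free_eval f + free_eval g.
Proof. by apply: val_inj; apply/funext => m /=; rewrite dualD. Qed.

Lemma free_evalN (f : lip0 o) : free_eval (- f) = - free_eval f.
Proof. by apply: val_inj; apply/funext => m /=; rewrite dualN. Qed.

Lemma free_evalZ a (f : lip0 o) : free_eval (a *: f) = a *: free_eval f.
Proof. by apply: val_inj; apply/funext => m /=; rewrite dualZ. Qed.

(** Locally constant at scale r. *)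
Definition flat : set (N -> R) := [set g | forall x y, mdist x y <= r -> g x = g y].

Definition flat_fun (g : N -> R) : lip0 o := lip0_of o (fun x => g x - g o).

Let flat_lip g : flat g -> (forall x, `|g x| <= 1) ->
  lipschitz_const (2 / r) (fun x => g x - g o).
Proof.
move=> fg g1 x y; have [/fg->|rx] := lerP (mdist x y) r.
  by rewrite subrr normr0 mulr_ge0// ?mdist_ge0// divr_ge0// ltW.
rewrite opprB addrA subrK (@le_trans _ _ 2)//.
  by rewrite (le_trans (ler_normB _ _))// [leRHS](_ : 2 = 1 + 1)// lerD.
by rewrite mulrAC ler_pdivlMr// ler_pM2l// ltW.
Qed.

Lemma flat_funE g : flat g -> (forall x, `|g x| <= 1) ->
  flat_fun g = (fun x => g x - g o) :> (N -> R).
Proof. by move=> fg g1; apply: (lip0_ofE (k := 2 / r)); [rewrite subrr|exact: flat_lip]. Qed.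

(** The functional of g is the Lipschitz function g - g o, of constant at most 2 / r since g
    does not vary below distance r. *)
Definition flat_rep : charge_rep (free_space o) N.
Proof.
apply: (@ChargeRep _ _ _ flat (fun g => free_eval (flat_fun g)) (2 / r)).
- by move=> x y.
- by move=> g fg x y xy /=; rewrite (fg _ _ xy).
- by move=> g h fg fh x y xy /=; rewrite (fg _ _ xy) (fh _ _ xy).
- by move=> g h fg fh x y xy /=; rewrite (fg _ _ xy) (fh _ _ xy).
- move=> g h fg gh x y xy; have e : (fun n => g n x) = (fun n => g n y).
    by apply/funext => n; exact: (fg n).
  have gx := gh x; rewrite e in gx.
  exact: (cvg_unique (@Rhausdorff R) gx (gh y)).
- move=> g fg g1; rewrite -free_evalN; congr free_eval; apply: val_inj.
  rewrite [LHS]flat_funE; last by move=> x /=; rewrite normrN.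
    by apply/funext => x /=; rewrite flat_funE// opprB opprK addrC.
  by move=> x y xy /=; rewrite (fg _ _ xy).
- move=> g h fg fh g1 h1 gh1; rewrite -free_evalD; congr free_eval; apply: val_inj.
  rewrite [LHS]flat_funE//; last by move=> x y xy /=; rewrite (fg _ _ xy) (fh _ _ xy).
  apply/funext => x /=; rewrite !flat_funE//.
  by rewrite opprD addrACA.
- move=> g fg g1; rewrite (le_trans (free_eval_norm _))//.
  apply: lip0_norm_const; first by rewrite divr_ge0// ltW.
  by rewrite flat_funE//; exact: flat_lip.
Defined.

(** The points that can be joined to y by steps of length at most r, described as those that
    no locally constant function separates from y. *)
Definition flat_class (y : N) : set N := [set x | forall g, flat g -> g x = g y].

Definition flat_hull (s : seq N) : set N := [set x | exists2 y, y \in s & flat_class y x].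

Lemma region_flat (E : set N) : (forall x y, mdist x y <= r -> E x -> E y) ->
  region flat_rep E.
Proof.
move=> hE x y xy; rewrite !indicE; congr (nat_of_bool _)%:R.
apply/idP/idP => /set_mem h; apply/mem_set; first exact: hE h.
by apply: hE h; rewrite metric_sym.
Qed.

Lemma region_flat_class y : region flat_rep (flat_class y).
Proof.
by apply: region_flat => x z xz hx g fg; rewrite -(fg _ _ xz) hx.
Qed.

Lemma region_flat_hull s : region flat_rep (flat_hull s).
Proof.
apply: region_flat => x z xz [y ys hx]; exists y => // g fg.
by rewrite -(fg _ _ xz) hx.
Qed.

(** Test functions are constant on a class, so a single functional bounds the variation. *)
Lemma tame_flat_class y : tame (total_var flat_rep (flat_class y)).
Proof.
have rc := region_flat_class y.
pose f := free_eval (flat_fun (\1_(flat_class y) : N -> R)).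
apply: (@tame_le _ _ _ (fun v => `|f v|) 1) => //; last exact: tame_dual.
  exact: bounded_seminorm_total_var.
move=> v; rewrite mul1r; apply: total_var_le => // g [ag g1].
have -> : chg flat_rep (g \* (\1_(flat_class y) : N -> R)) = g y *: f.
  rewrite /f -free_evalZ; congr free_eval; apply: val_inj.
  rewrite [LHS]flat_funE; last by move=> x /=; rewrite normrM mulr_ile1// indic_le1.
    apply/funext => x /=; rewrite flat_funE//; last exact: indic_le1.
    have E w : g w * (\1_(flat_class y) w : R) = g y * \1_(flat_class y) w.
      rewrite indicE; have [/set_mem h|] := boolP (w \in _); last by rewrite !mulr0.
      by rewrite (h g ag).
    by rewrite !E -mulrBr.
  exact: (admM (c := flat_rep)).
rewrite [X in X <= _](_ : _ = g y * f v)// (le_trans (ler_norm _))// normrM ler_piMl//.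
Qed.

(** Finite unions of classes exhaust the variation, since combinations of finitely many point
    evaluations only charge the classes of their points and of o. *)
Lemma tame_flat : tame (total_var flat_rep setT).
Proof.
apply: (@tame_glue _ _ _ _ [set E | exists s, E = flat_hull s]).
  split.
  - by move=> _ [s ->]; exact: region_flat_hull.
  - move=> _ _ [s ->] [s' ->]; exists (s ++ s'); apply/seteqP; split => x.
      by move=> [[y ys h]|[y ys h]]; exists y; rewrite // mem_cat ys ?orbT.
    move=> [y]; rewrite mem_cat => /orP[ys|ys] h; [left|right]; by exists y.
  - move=> v e e0; have b0 : 0 < 2 / r by rewrite divr_gt0.
    have [n [a [x ax]]] := free_dense v (divr_gt0 e0 b0).
    set p := \sum_(i < n) _ in ax.
    pose s := o :: codom x.
    exists (flat_hull s); first by exists s.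
    have rC := regionC (region_flat_hull s).
    have p0 : total_var flat_rep (~` flat_hull s) p <= 0.
      apply: total_var_le => // g ag.
      have [fg g1] := aballI ag rC.
      have out z : z \in s -> (g \* (\1_(~` flat_hull s) : N -> R)) z = 0.
        move=> zs /=; rewrite indicE memNset ?mulr0// => nz; apply: nz.
        by exists z.
      rewrite [X in X <= 0](_ : _ = \sum_(i < n) a i * flat_fun (g \* (\1_(~` flat_hull s) : N -> R)) (x i)); last first.
        by rewrite [LHS]free_sumE.
      rewrite big1// => i _; rewrite flat_funE// !out ?subr0 ?mulr0//.
        exact: mem_head.
      by rewrite inE codom_f orbT.
    rewrite -[v](subrK p) (le_trans (total_varD _ _ rC))//.
    rewrite -[leRHS]addr0 lerD// (le_trans (total_var_bound _ rC))//.
    rewrite [chg_bound _]/(2 / r) mulrC -ler_pdivlMr//.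
move=> _ [s ->]; elim: s => [|y s ih].
  apply: (@tame_le _ _ _ (fun v => `|(0 : dual_space (free_space o)) v|) 0) => //.
  - exact/bounded_seminorm_total_var/region_flat_hull.
  - move=> v; rewrite mul0r; apply: total_var_le; first exact: region_flat_hull.
    move=> g ag; rewrite (_ : flat_hull [::] = set0); last by apply/seteqP; split => // x [].
    have -> : g \* (\1_set0 : N -> R) = \- (g \* (\1_set0 : N -> R)).
      by apply/funext => x /=; rewrite indicE in_set0 mulr0 oppr0.
    have b0 : aball flat_rep (g \* (\1_set0 : N -> R)).
      by apply: aballI => //; rewrite -setCT; apply: regionC; exact: regionT.
    have e : g \* (\1_set0 : N -> R) = \- (g \* (\1_set0 : N -> R)).
      by apply/funext => x /=; rewrite indicE in_set0 mulr0 oppr0.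
    rewrite chgNE//; have := chgNE v b0; rewrite -e; lra.
  - exact: tame_dual.
have [[y' ys' h']|nh] := pselect (flat_hull s y).
  rewrite (_ : flat_hull (y :: s) = flat_hull s)//; apply/seteqP; split => x.
    move=> [z]; rewrite inE => /predU1P[->|zs] h; last by exists z.
    by exists y' => // g fg; rewrite h// h'.
  by move=> [z zs h]; exists z => //; rewrite inE zs orbT.
have -> : flat_hull (y :: s) = flat_hull s `|` flat_class y.
  apply/seteqP; split => x.
    move=> [z]; rewrite inE => /predU1P[->|zs] h; first by right.
    by left; exists z.
  by move=> [[z zs h]|h]; [exists z => //; rewrite inE zs orbT|exists y => //; exact: mem_head].
have rs := region_flat_hull s; have ry := region_flat_class y.
apply: (@tame_le _ _ _ (fun v => total_var flat_rep (flat_hull s) v + total_var flat_rep (flat_class y) v) 1) => //.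
- by apply: bounded_seminorm_total_var; exact: regionU.
- move=> v; rewrite mul1r; apply: total_varU => //.
  apply/disj_setPS => x [[z zs hz] hy]; apply: nh; exists z => // g fg.
  by rewrite -(hy g fg) hz.
- by apply: tame_add => //; exact: tame_flat_class.
Qed.

End flat_system.

(** * The free norm as a total variation along rays *)

Section interval_integrals.
Context {R : realType}.
Notation mu := (@lebesgue_measure R).

Lemma integrable_bounded (k : R -> R) (a b C : R) : measurable_fun [set: R] k ->
  (forall t, `|k t| <= C) -> mu.-integrable `[a, b] (EFin \o k).
Proof.
move=> mk kC; apply: measurable_bounded_integrable => //.
- by apply: compact_finite_measure; exact: segment_compact.
- exact: measurable_funS mk.
- exists C; split; first exact: num_real.
  by move=> M CM x _ /=; rewrite (le_trans (kC x))// ltW.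
Qed.

Lemma integral_split (k : R -> R) (a c C : R) : 0 <= c <= a ->
  measurable_fun [set: R] k -> (forall t, `|k t| <= C) ->
  (\int[mu]_(t in `[0, a]) k t = \int[mu]_(t in `[0, c]) k t + \int[mu]_(t in `]c, a]) k t)%R.
Proof.
move=> /andP[c0 ca] mk kC.
by rewrite -(Rintegral_itvB (integrable_bounded 0 a mk kC))// subrKC.
Qed.

Lemma integral_ocitv_le (k : R -> R) (c a : R) : c <= a -> measurable_fun [set: R] k ->
  (forall t, `|k t| <= 1) -> `|\int[mu]_(t in `]c, a]) k t|%R <= a - c.
Proof.
move=> ca mk k1.
have sub : `]c, a] `<=` `[c, a].
  by move=> t; rewrite /= !in_itv/= => /andP[/ltW -> ->].
have i1 : mu.-integrable `]c, a] (EFin \o k).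
  by apply: (@integrableS _ _ _ mu `[c, a] _ _ _ _ sub) => //; exact: (integrable_bounded _ _ mk k1).
have m1 : measurable_fun [set: R] (fun t => `|k t|) by exact: measurableT_comp.
have i2 : mu.-integrable `]c, a] (EFin \o (fun t => `|k t|)).
  apply: (@integrableS _ _ _ mu `[c, a] _ _ _ _ sub) => //; apply: (@integrable_bounded _ _ _ 1) => // t.
  by rewrite normr_id.
have i3 : mu.-integrable `]c, a] (EFin \o (fun=> 1)).
  apply: (@integrableS _ _ _ mu `[c, a] _ _ _ _ sub) => //; apply: (@integrable_bounded _ _ _ 1) => // t.
  by rewrite normr1.
rewrite (le_trans (le_normr_Rintegral _ i1))//.
rewrite (le_trans (le_Rintegral _ i2 i3 _))//.
rewrite Rintegral_cst// mul1r [X in fine X](_ : _ = (a - c)%:E)//.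
rewrite [LHS](lebesgue_measure_itv `]c, a])/= lte_fin.
by case: ltP => // ac; congr EFin; lra.
Qed.

Lemma integral_ocitv0 (k : R -> R) (c a : R) : (forall t, c < t <= a -> k t = 0) ->
  (\int[mu]_(t in `]c, a]) k t)%R = 0.
Proof.
move=> k0; rewrite /Rintegral (eq_integral (fun=> 0%E)) ?integral0//.
by move=> t; rewrite inE/= in_itv/= => /k0 ->.
Qed.

End interval_integrals.

Section tree_system.
Context {R : realType} {T : metricType R} (hT : is_rtree T) (M : set T) (o : M).
Notation mu := (@lebesgue_measure R).
Let oT : T := set_val o.

Lemma rays_exist : exists G : T -> R -> T, forall x, geodesic oT x (G x).
Proof.
have H x : exists g, geodesic oT x g by have [g []] := geodesic_exists hT oT x; exists g.
by have [G HG] := choice H; exists G.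
Qed.

(** The clamp makes rays continuous and 1-Lipschitz on the whole line. *)
Definition ray (x : T) (t : R) : T := projT1 (cid rays_exist) x (clamp (mdist oT x) t).

Let rayP x : geodesic oT x (projT1 (cid rays_exist) x).
Proof. by case: cid. Qed.

Lemma ray_id x t : 0 <= t <= mdist oT x -> ray x t = projT1 (cid rays_exist) x t.
Proof. by move=> tx; rewrite /ray clamp_id. Qed.

Lemma ray_geodesic x : geodesic oT x (ray x).
Proof.
have [h0 h1 hi] := rayP x.
split => [||s t s0 t0]; [|by rewrite ray_id ?lexx ?mdist_ge0|by rewrite !ray_id//; exact: hi].
by rewrite ray_id ?lexx ?mdist_ge0.
Qed.

Lemma ray_clamp x t : ray x t = ray x (clamp (mdist oT x) t).
Proof. by rewrite /ray [clamp _ (clamp _ t)]clamp_id// clamp_itv// mdist_ge0. Qed.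

Lemma ray_lip x s t : mdist (ray x s) (ray x t) <= `|s - t|.
Proof.
have [_ _ h] := rayP x.
by rewrite /ray h ?clamp_itv ?clamp_lip ?mdist_ge0.
Qed.

Lemma ray_end x : ray x (mdist oT x) = x.
Proof. by rewrite ray_id ?lexx ?mdist_ge0//; have [] := rayP x. Qed.

Lemma ray_le0 x t : t <= 0 -> ray x t = oT.
Proof.
move=> t0; rewrite ray_clamp /clamp.
have -> : Num.min t (mdist oT x) = t by rewrite min_l// (le_trans t0)// mdist_ge0.
by rewrite (max_l t0) ray_id ?lexx ?mdist_ge0//; have [] := rayP x.
Qed.

Lemma ray_dist x t : 0 <= t <= mdist oT x -> mdist oT (ray x t) = t.
Proof. by move=> tx; rewrite ray_id//; exact: geodesic_dist0 (rayP x) tx. Qed.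

Lemma ray_dist_end x t : 0 <= t <= mdist oT x -> mdist (ray x t) x = mdist oT x - t.
Proof. by move=> tx; rewrite ray_id//; exact: geodesic_dist1 (rayP x) tx. Qed.

Lemma ray_branch x y : exists c, [/\ 0 <= c <= mdist oT x, c <= mdist oT y,
  forall t, 0 <= t <= c -> ray x t = ray y t &
  mdist x y = mdist oT x + mdist oT y - 2 * c].
Proof.
have [c [/andP[c0 cx] cy H D]] := geodesic_branch hT (rayP x) (rayP y).
exists c; split; rewrite ?c0// => t /andP[t0 tc].
by rewrite !ray_id ?t0 ?(le_trans tc)// H// t0.
Qed.

(** The distances to the point at time s leave no other branching point than this one. *)
Lemma ray_ray x s t : 0 <= s <= mdist oT x -> t <= s -> ray (ray x s) t = ray x t.
Proof.
move=> sx ts; have [c [/andP[c0 cx] cy H D]] := ray_branch (ray x s) x.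
have [t0|t0] := leP t 0; first by rewrite !ray_le0.
apply: H; rewrite (ltW t0)/= (le_trans ts)//.
by move: D; rewrite ray_dist// ray_dist_end//; lra.
Qed.

Definition ray_adm : set (T -> R) :=
  [set g | forall x, measurable_fun [set: R] (fun t => g (ray x t))].

Definition ray_int (g : T -> R) (x : T) : R :=
  (\int[mu]_(t in `[0, mdist oT x]) g (ray x t))%R.

(** The integrals along the two rays cancel up to the point where these separate. *)
Lemma ray_intB g C x y : ray_adm g -> (forall z, `|g z| <= C) ->
  exists c, [/\ 0 <= c <= mdist oT x, c <= mdist oT y,
    mdist x y = mdist oT x + mdist oT y - 2 * c &
    ray_int g x - ray_int g y = (\int[mu]_(t in `]c, mdist oT x]) g (ray x t))%R -
                               (\int[mu]_(t in `]c, mdist oT y]) g (ray y t))%R].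
Proof.
move=> ag g1; have [c [/andP[c0 cx] cy H D]] := ray_branch x y.
exists c; split; rewrite ?c0//.
rewrite /ray_int (integral_split (c := c) _ (ag x) (fun t => g1 _)) ?c0//.
rewrite (integral_split (c := c) _ (ag y) (fun t => g1 _)) ?c0//.
have -> : (\int[mu]_(t in `[0, c]) g (ray x t) = \int[mu]_(t in `[0, c]) g (ray y t))%R.
  by apply: eq_Rintegral => t; rewrite inE/= in_itv/= => /H ->.
by rewrite opprD addrACA subrr add0r.
Qed.

Lemma ray_int_lip g x y : ray_adm g -> (forall z, `|g z| <= 1) ->
  `|ray_int g x - ray_int g y| <= mdist x y.
Proof.
move=> ag g1; have [c [/andP[c0 cx] cy D ->]] := ray_intB x y ag g1.
rewrite (le_trans (ler_normB _ _))//.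
rewrite (le_trans (lerD (integral_ocitv_le cx (ag x) _) (integral_ocitv_le cy (ag y) _)))//.
rewrite D; lra.
Qed.

Definition ray_fun (g : T -> R) : lip0 o := lip0_of o (fun x : M => ray_int g (set_val x)).

Lemma ray_funE g : ray_adm g -> (forall z, `|g z| <= 1) ->
  ray_fun g = (fun x : M => ray_int g (set_val x)) :> (M -> R).
Proof.
move=> ag g1; apply: (lip0_ofE (k := 1)).
  by rewrite /ray_int mdistxx set_itv1 /Rintegral integral_set1.
by move=> x y; rewrite mul1r; exact: ray_int_lip.
Qed.

Lemma ray_fun_norm g : ray_adm g -> (forall z, `|g z| <= 1) -> `|ray_fun g| <= 1.
Proof.
move=> ag g1; apply: lip0_norm_const => //; rewrite ray_funE// => x y.
by rewrite mul1r; exact: ray_int_lip.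
Qed.

(** The functional of g is the Lipschitz function sending x to the integral of g along the ray
    to x. It is 1-Lipschitz when |g| <= 1, since the parts of two rays beyond their branching
    point have total length d(x, y). *)
Definition ray_rep : charge_rep (free_space o) T.
Proof.
apply: (@ChargeRep _ _ _ ray_adm (fun g => free_eval (ray_fun g)) 1).
- by move=> x; exact: measurable_cst.
- by move=> g ag x; exact: measurableT_comp (ag x).
- by move=> g h ag ah x; exact: measurable_funD.
- by move=> g h ag ah x; exact: measurable_funM.
- move=> g h ag gh x; apply: (@measurable_fun_cvg _ _ _ _ (fun n t => g n (ray x t))) => [n|t _]; [exact: ag|exact: gh].
- move=> g ag g1; rewrite -free_evalN; congr free_eval; apply: val_inj.
  rewrite [LHS]ray_funE; last by move=> x /=; rewrite normrN.
    apply/funext => x /=; rewrite ray_funE// /ray_int -[RHS]mulN1r -RintegralZl//.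
      by apply: eq_Rintegral => t _; rewrite mulN1r.
    exact: (integrable_bounded _ _ (ag _) (fun t => g1 _)).
  by move=> x; exact: measurableT_comp (ag x).
- move=> g h ag ah g1 h1 gh1; rewrite -free_evalD; congr free_eval; apply: val_inj.
  rewrite [LHS]ray_funE//; last by move=> x; exact: measurable_funD.
  apply/funext => x /=; rewrite !ray_funE// /ray_int RintegralD//.
    exact: (integrable_bounded _ _ (ag _) (fun t => g1 _)).
  exact: (integrable_bounded _ _ (ah _) (fun t => h1 _)).
- move=> g ag g1; rewrite (le_trans (free_eval_norm _))//; exact: ray_fun_norm.
Defined.

(** Difference quotient towards the base point. *)
Definition slope (F : T -> R) (h : R) (z : T) : R :=
  (F z - F (ray z (mdist oT z - h))) / h.

Lemma slope_le1 F h z : 0 < h -> (forall z z', `|F z - F z'| <= mdist z z') ->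
  `|slope F h z| <= 1.
Proof.
move=> h0 Fl; rewrite /slope normrM normfV (gtr0_norm h0) ler_pdivrMr// mul1r.
rewrite (le_trans (Fl _ _))// -{1}(ray_end z) (le_trans (ray_lip _ _ _))//.
by rewrite opprB addrC subrK gtr0_norm.
Qed.

Lemma slope_ray F h x t : 0 < h -> 0 <= t <= mdist oT x ->
  slope F h (ray x t) = (F (ray x t) - F (ray x (t - h))) / h.
Proof.
move=> h0 tx; rewrite /slope ray_dist// ray_ray//.
by rewrite gerDl oppr_le0 ltW.
Qed.

Let Fray_lip (F : T -> R) x : (forall z z', `|F z - F z'| <= mdist z z') ->
  forall s t, `|F (ray x s) - F (ray x t)| <= `|s - t|.
Proof. by move=> Fl s t; rewrite (le_trans (Fl _ _))// ray_lip. Qed.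

Lemma slope_adm F h : 0 < h -> (forall z z', `|F z - F z'| <= mdist z z') ->
  ray_adm (slope F h).
Proof.
move=> h0 Fl x; apply: continuous_measurable_fun.
pose k t := (F (ray x t) - F (ray x (t - h))) / h.
have -> : (fun t => slope F h (ray x t)) = k \o clamp (mdist oT x).
  apply/funext => t /=; rewrite [ray x t]ray_clamp slope_ray//.
  by rewrite clamp_itv// mdist_ge0.
have cF := Lip1_continuous (Fray_lip x Fl).
have ck : continuous k.
  move=> t; apply: cvgM; last exact: cvg_cst.
  apply: cvgB; first exact: cF.
  apply: (@continuous_comp _ _ _ (fun t => t - h) (fun s => F (ray x s))); last exact: cF.
  by apply: cvgB; [exact: cvg_id|exact: cvg_cst].
move=> t; apply: continuous_comp; last exact: ck.
by apply: Lip1_continuous => s s'; apply: clamp_lip; exact: mdist_ge0.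
Qed.

Lemma ray_int_slope F h x : 0 < h -> (forall z z', `|F z - F z'| <= mdist z z') ->
  `|ray_int (slope F h) x - (F x - F oT)| <= 2 * h.
Proof.
move=> h0 Fl.
have := integral_increment h0 (mdist_ge0 oT x) (Fray_lip x Fl).
rewrite ray_end ray_le0//; apply: le_trans.
rewrite le_eqVlt; apply/orP; left; apply/eqP; congr (`|_ - _|).
by apply: eq_Rintegral => t; rewrite inE/= in_itv/= => tx; exact: slope_ray.
Qed.

(** Extend a 1-Lipschitz function on M to the tree. The integrals along rays of the difference
    quotients of the extension are 1-Lipschitz and converge pointwise to it, so the
    test functions of [ray_rep] approach the norm of m. *)
Lemma norm_ray_rep (m : free_space o) : `|m| = total_var ray_rep setT m.
Proof.
have rT := @regionT _ _ _ ray_rep.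
apply/eqP; rewrite eq_le; apply/andP; split; last first.
  by rewrite (le_trans (total_var_bound _ rT))//= mul1r.
apply: free_norm_le => [|f fl]; first exact/seminorm_ge0/bounded_seminorm_total_var.
have [F [Fl Ff]] : exists F : T -> R, (forall z z', `|F z - F z'| <= mdist z z') /\
    forall x : M, F (set_val x) = f x.
  apply: mcshane => //; [exact: mdistxx|exact: metric_sym|exact: metric_triangle|].
  by move=> x y; have := fl x y; rewrite mul1r.
pose h (n : nat) : R := n.+1%:R^-1.
have h0 n : 0 < h n by rewrite invr_gt0.
have hc : h n @[n --> \oo] --> (0 : R) by exact: cvg_harmonic.
have an n := slope_adm (h0 n) Fl.
have s1 n z := slope_le1 z (h0 n) Fl.
have cvgf : free_val m (ray_fun (slope F (h n))) @[n --> \oo] --> free_val m f.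
  apply: (free_pointwise_cvg (C := 1)) => [n|x]; first exact: ray_fun_norm.
  apply/cvgrPdist_le => e e0.
  have /cvgrPdist_le/(_ (e / 2)) := hc; rewrite divr_gt0// => /(_ isT).
  apply: filterS => n; rewrite sub0r normrN gtr0_norm// => hn.
  rewrite ray_funE// distrC.
  have := ray_int_slope (set_val x) (h0 n) Fl.
  rewrite Ff [F oT](_ : _ = 0) ?subr0; last by rewrite Ff lip0_base.
  by move/le_trans; apply; rewrite mulrC -ler_pdivlMr.
apply: (closed_cvg (fun y : R => y <= total_var ray_rep setT m)) cvgf; first exact: closed_le.
apply: nearW => n.
have := total_var_ub m rT (conj (an n) (s1 n) : aball ray_rep _).
rewrite indicT (_ : slope F (h n) \* cst 1 = slope F (h n))//.
by apply/funext => z /=; rewrite mulr1.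
Qed.

End tree_system.

(** * The free norm over a set of length zero *)

Section tame_free_space.
Context {R : realType} {T : metricType R} (hT : is_rtree T) (M : set T) (o : M).
Hypothesis cM : closed M.
Notation mu := (@lebesgue_measure R).
Let oT : T := set_val o.
Notation ray := (ray hT o).
Notation S := (ray_rep hT o).
Hypothesis null_rays : forall x : M,
  mu (`[0, mdist oT (set_val x)] `&` [set t | M (ray (set_val x) t)]) = 0%E.

Definition far (n : nat) : set T :=
  [set z | n.+1%:R^-1 < dist_to M z /\ mdist oT z <= n.+1%:R].

Lemma far_sub n m : (n <= m)%N -> far n `<=` far m.
Proof.
move=> nm z [h1 h2]; split.
  by apply: le_lt_trans h1; rewrite lef_pV2 ?posrE// ler_nat ltnS.
by apply: (le_trans h2); rewrite ler_nat ltnS.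
Qed.

Lemma measurable_far n x : measurable (ray x @^-1` far n).
Proof.
have cd : continuous (fun t => dist_to M (ray x t)).
  apply: Lip1_continuous => s t; apply: le_trans (dist_to_lip o _ _) _.
  exact: ray_lip.
have co : continuous (fun t => mdist oT (ray x t)).
  apply: Lip1_continuous => s t; rewrite ler_norml.
  have h1 := metric_triangle oT (ray x s) (ray x t).
  have h2 := metric_triangle oT (ray x t) (ray x s).
  have h3 := ray_lip hT o x s t; rewrite (metric_sym (ray x t)) in h2.
  by apply/andP; split; lra.
have -> : ray x @^-1` far n =
  (fun t => dist_to M (ray x t)) @^-1` `]n.+1%:R^-1, +oo[ `&`
  (fun t => mdist oT (ray x t)) @^-1` `]-oo, n.+1%:R].
  by apply/seteqP; split => t /=; rewrite !in_itv/= andbT.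
apply: measurableI.
  rewrite -[X in measurable X]setTI; apply: continuous_measurable_fun => //.
rewrite -[X in measurable X]setTI; apply: continuous_measurable_fun => //.
Qed.

Lemma region_far n : region S (far n).
Proof.
move=> x; have -> : (fun t => \1_(far n) (ray x t) : R) = \1_(ray x @^-1` far n).
  by apply/funext => t; rewrite !indicE; congr (nat_of_bool _)%:R; apply/idP/idP => /set_mem h; apply/mem_set.
by apply: measurable_indic; exact: measurable_far.
Qed.

(** The part of the ray outside [far n] decreases to its part in M, because M is closed. *)
Lemma not_far_cvg (x : M) :
  fine (mu (`[0, mdist oT (set_val x)] `&` ray (set_val x) @^-1` (~` far n)))
    @[n --> \oo] --> (0 : R).
Proof.
set L := mdist oT (set_val x).
pose F n := `[0, L] `&` ray (set_val x) @^-1` (~` far n).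
have mF n : measurable (F n).
  apply: measurableI => //; rewrite -preimage_setC; apply: measurableC.
  exact: measurable_far.
have FI : \bigcap_n F n = `[0, L] `&` [set t | M (ray (set_val x) t)].
  apply/seteqP; split => [t Ft|t [tL Mt] n _].
    have [tL _] := Ft 0%N I; split => //=; apply: (dist_to_closed o cM).
    rewrite leNgt; apply/negP => d0.
    have Lt : mdist oT (ray (set_val x) t) <= L.
      by rewrite ray_dist//; move: tL; rewrite /= in_itv/= => // /andP[].
    have [n1 _ h1] := near_infty_natSinv_lt (PosNum d0).
    have [n2 _ h2] := nbhs_infty_ger L.
    have [_] := Ft (maxn n1 n2) I; apply; split.
      exact: (h1 _ (leq_maxl _ _)).
    rewrite (le_trans Lt)//; apply: le_trans (h2 _ (leq_maxr n1 n2)) _.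
    by rewrite ler_nat.
  split => //= -[h _]; move: h; rewrite ltNge => /negP; apply.
  rewrite (@le_trans _ _ 0)//.
  have Mt' : ray (set_val x) t \in M by apply/mem_set.
  have := dist_to_le (exist (fun z => z \in M) _ Mt' : M) (ray (set_val x) t).
  by rewrite mdistxx.
have decr : {homo F : n m / (n <= m)%N >-> (m <= n)%O}.
  move=> n m nm; apply/subsetPset => t [tL nf]; split => // fn; apply: nf.
  exact: far_sub nm _ fn.
have F0 : (mu (F 0%N) < +oo)%E.
  apply: (@le_lt_trans _ _ (mu `[0, L])).
    apply: le_measure; [by rewrite inE; exact: mF|by rewrite inE|].
    exact: subIsetl.
  by apply: compact_finite_measure; exact: segment_compact.
have mI : measurable (\bigcap_n F n) by exact: bigcap_measurable.
have := nonincreasing_cvg_mu F0 mF mI decr.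
rewrite [X in _ --> X](_ : _ = 0%E); last by rewrite -(null_rays x) -FI.
by move=> /fine_cvg.
Qed.

Lemma total_var_free_point n (x : M) :
  total_var S (~` far n) (free_point o x) <=
  fine (mu (`[0, mdist oT (set_val x)] `&` ray (set_val x) @^-1` (~` far n))).
Proof.
have rC := regionC (region_far n).
apply: total_var_le => // g ag; have [ah h1] := aballI ag rC.
rewrite [X in X <= _](_ : _ = ray_int hT o (g \* (\1_(~` far n) : T -> R)) (set_val x)); last first.
  exact: (congr1 (fun f : M -> R => f x) (ray_funE ah h1)).
set L := mdist oT (set_val x).
have mC : measurable (ray (set_val x) @^-1` (~` far n)).
  by rewrite -preimage_setC; apply: measurableC; exact: measurable_far.
have mB : measurable_fun [set: R] (\1_(ray (set_val x) @^-1` (~` far n)) : R -> R).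
  exact: measurable_indic.
rewrite (@le_trans _ _ (\int[mu]_(t in `[0, L]) (\1_(ray (set_val x) @^-1` (~` far n)) t : R))%R)//.
  apply: le_Rintegral => //.
  - by apply: (@integrable_bounded _ _ _ _ 1) => // t; exact: (ah (set_val x)).
  - by apply: (@integrable_bounded _ _ _ _ 1) => // t; exact: indic_le1.
  - move=> t _; rewrite (_ : \1_(ray (set_val x) @^-1` (~` far n)) t = \1_(~` far n) (ray (set_val x) t) :> R).
      by rewrite /= ler_piMl//; case: ag => _ g1; exact: le_trans (ler_norm _) (g1 _).
    by rewrite !indicE; congr (nat_of_bool _)%:R; apply/idP/idP => /set_mem h; apply/mem_set.
by rewrite /Rintegral integral_indic// setIC.
Qed.

(** On combinations of point evaluations, the variation outside [far n] is bounded by the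
    lengths of the parts of finitely many rays outside [far n]. *)
Lemma far_exhausting : exhausting S [set E | exists n, E = far n].
Proof.
split.
- by move=> _ [n ->]; exact: region_far.
- move=> _ _ [n ->] [m ->]; exists (maxn n m); apply/seteqP; split => z.
    by move=> [] /far_sub; apply; rewrite ?leq_maxl ?leq_maxr.
  by case: (leqP n m) => nm; [right|left].
- move=> v e e0.
  have [k [a [x ax]]] := free_dense v (divr_gt0 e0 (ltr0Sn R 1)).
  set p := \sum_(i < k) _ in ax.
  have : (\sum_(i < k) `|a i| * fine (mu (`[0, mdist oT (set_val (x i))] `&`
     ray (set_val (x i)) @^-1` (~` far n)))) @[n --> \oo] --> \sum_(i < k) `|a i| * (0 : R).
    by apply: cvg_finite_sum => i; apply: cvgM; [exact: cvg_cst|exact: not_far_cvg].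
  rewrite [X in _ --> X]big1 => [|i _]; last by rewrite mulr0.
  move=> /cvgrPdist_le/(_ _ (divr_gt0 e0 (ltr0Sn R 1)))[n _ /(_ n (leqnn n))].
  rewrite sub0r normrN => /(le_trans (ler_norm _)) h.
  exists (far n); first by exists n.
  have rC := regionC (region_far n).
  have sC := bounded_seminorm_total_var rC.
  rewrite -[v](subrK p) (le_trans (total_varD _ _ rC))// [e]splitr lerD//.
    by rewrite (le_trans (total_var_bound _ rC))//= mul1r.
  rewrite (le_trans (seminorm_sum _ _ sC))//; apply: le_trans h.
  apply: ler_sum => i _; rewrite (total_varZ _ _ rC) ler_wpM2l//.
  exact: total_var_free_point.
Qed.

(** The integral along rays of a function supported in [far n] does not vary between points of
    M at distance at most 1/(n+1): beyond their branching point the two rays stay within that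
    distance of M. The integral is also bounded by n+1. So the variation over [far n] is at most
    n+1 times that of [flat_rep] at scale 1/(n+1). *)
Lemma tame_far n : tame (total_var S (far n)).
Proof.
have rf := region_far n.
pose r : R := n.+1%:R^-1; have r0 : 0 < r by rewrite invr_gt0.
have rT := @regionT _ _ _ (flat_rep o r0).
apply: (@tame_le _ _ _ (total_var (flat_rep o r0) setT) n.+1%:R) => //.
- exact: bounded_seminorm_total_var.
- move=> v; apply: total_var_le => // g ag.
  have [ah h1] := aballI ag rf.
  set h := g \* _ in ah h1 *.
  have h0 z : ~ far n z -> h z = 0 by move=> nz; rewrite /h/= indicE memNset ?mulr0.
  pose k (x : M) : R := r * ray_int hT o h (set_val x).
  have fk : flat r k.
    move=> x y xy; congr (_ * _); apply/eqP; rewrite -subr_eq0; apply/eqP.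
    have [c [/andP[c0 cx] cy D ->]] := ray_intB (set_val x) (set_val y) ah h1.
    have xyr : mdist (set_val x) (set_val y) <= r by [].
    rewrite !integral_ocitv0 ?subrr// => t /andP[ct tx]; apply: h0 => -[+ _];
      rewrite ltNge => /negP; apply.
    + rewrite (le_trans (dist_to_le y _))// metric_sym ray_dist_end; last by rewrite tx ltW// (le_lt_trans c0).
      by move: xyr; rewrite D -/r -/oT; clear -ct cx cy; move: (mdist oT (set_val x)) (mdist oT (set_val y)) cx cy ct => a1 a2 cx cy ct xyr; lra.
    + rewrite (le_trans (dist_to_le x _))// metric_sym ray_dist_end; last by rewrite tx ltW// (le_lt_trans c0).
      by move: xyr; rewrite D -/r -/oT; clear -ct cx cy; move: (mdist oT (set_val x)) (mdist oT (set_val y)) cx cy ct => a1 a2 cx cy ct xyr; lra.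
  have k1 x : `|k x| <= 1.
    rewrite /k normrM (gtr0_norm r0) mulrC -ler_pdivlMr// mul1r invrK.
    set L := mdist oT (set_val x).
    have [Ln|nL] := leP L n.+1%:R.
      have := ray_int_lip (set_val x) oT ah h1.
      rewrite [ray_int hT o h oT](_ : _ = 0) ?subr0; last first.
        by rewrite /ray_int mdistxx set_itv1 /Rintegral integral_set1.
      by move/le_trans; apply; rewrite metric_sym.
    rewrite /ray_int (integral_split (c := n.+1%:R) _ (ah _) (fun t => h1 _)); last by rewrite ler0n ltW.
    rewrite [X in _ + X]integral_ocitv0 ?addr0; last first.
      move=> t /andP[nt tL]; apply: h0 => -[_].
      rewrite ray_dist; first by rewrite leNgt nt.
      by rewrite tL andbT ltW// (le_lt_trans _ nt).
    have i1 := integrable_bounded 0 n.+1%:R (ah (set_val x)) (fun t => h1 _).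
    rewrite -Rintegral_itv_obnd_cbnd; last first.
      apply: (@integrableS _ _ _ mu `[0, n.+1%:R] _ _ _ _ _ i1) => //.
      by move=> t; rewrite /= !in_itv/= => /andP[/ltW -> ->].
    rewrite (le_trans (integral_ocitv_le _ (ah (set_val x)) (fun t => h1 _)))// ?subr0//.
  have ka : aball (flat_rep o r0) k by [].
  have -> : chg S h v = n.+1%:R * chg (flat_rep o r0) k v.
    have -> : chg S h = n.+1%:R *: chg (flat_rep o r0) k; last by [].
    rewrite /= -free_evalZ; congr free_eval; apply: val_inj; rewrite [LHS]ray_funE//.
    apply/funext => x /=; rewrite [RHS](_ : _ = n.+1%:R * flat_fun o k x)// (flat_funE o r0)// /k -mulrBr mulrA mulfV ?mul1r//.
    by rewrite [ray_int _ _ _ (set_val o)](_ : _ = 0) ?subr0// /ray_int mdistxx set_itv1 /Rintegral integral_set1.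
  rewrite ler_wpM2l//.
  have := total_var_ub v rT ka; rewrite indicT (_ : k \* cst 1 = k)//.
  by apply/funext => z /=; rewrite mulr1.
- exact: tame_flat.
Qed.

Theorem tame_free_norm : tame (fun m : free_space o => `|m|).
Proof.
have -> : (fun m : free_space o => `|m|) = total_var S setT.
  by apply/funext => m; exact: norm_ray_rep.
apply: (tame_glue far_exhausting) => _ [n ->]; exact: tame_far.
Qed.

End tame_free_space.

(** * Steps along an isometric copy of a set of reals *)

Section line_integrals.
Context {R : realType}.
Notation mu := (@lebesgue_measure R).

Lemma integrable_indicM (k : R -> R) (A : set R) : measurable A ->
  mu.-integrable A (EFin \o k) -> mu.-integrable setT (EFin \o (fun t => \1_A t * k t)).
Proof.
move=> mA ik; rewrite (_ : EFin \o _ = ((EFin \o k) \_ A)%E).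
  exact: (@integrable_mkcond _ _ _ mu A (EFin \o k) mA).1 ik.
apply/funext => t; rewrite /patch /= indicE; case: ifPn => tA.
  by rewrite mul1r.
by rewrite mul0r.
Qed.

Lemma Rintegral_indicM (k : R -> R) (A : set R) : measurable A ->
  (\int[mu]_t (\1_A t * k t) = \int[mu]_(t in A) k t)%R.
Proof.
move=> mA; rewrite /Rintegral [in RHS]integral_mkcond; congr fine.
apply: eq_integral => t _; rewrite /patch indicE; case: ifPn => tA.
  by rewrite mul1r.
by rewrite mul0r.
Qed.

Lemma measurable_sgr : measurable_fun [set: R] (@Num.sg R).
Proof.
have -> : @Num.sg R = fun x => \1_(`]0, +oo[) x - \1_(`]-oo, 0[) x.
  apply/funext => x; rewrite !indicE !mem_setE !in_itv/= andbT.
  by case: sgrP => h; rewrite ?subrr ?subr0 ?sub0r.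
by apply: measurable_funB; exact: measurable_indic.
Qed.

Lemma integrable_ocitv (k : R -> R) (p q : R) : measurable_fun [set: R] k ->
  (forall t, `|k t| <= 1) -> mu.-integrable `]p, q] (EFin \o k).
Proof.
move=> mk k1; apply: (@integrableS _ _ _ mu `[p, q]) => //.
  by move=> t; rewrite /= !in_itv/= => /andP[/ltW -> ->].
exact: (integrable_bounded _ _ mk k1).
Qed.

End line_integrals.

Section steps.
Context {R : realType} {N : metricType R} (o : N).
Variables (K : set R) (kap : R -> N) (pi : N -> R) (l : R).
Hypotheses (l0 : 0 <= l) (Kl : forall t, K t -> 0 <= t <= l).
Hypothesis kap_iso : forall s t, K s -> K t -> mdist (kap s) (kap t) = `|s - t|.
Hypothesis pi_lip : forall x y, `|pi x - pi y| <= mdist x y.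
Hypothesis pi_kap : forall t, K t -> pi (kap t) = t.
Notation mu := (@lebesgue_measure R).

Definition valid_steps (s : seq (R * R * R)) : Prop :=
  forall x, x \in s -> [/\ K x.1.2, K x.2 & x.1.2 <= x.2].

(** A sequence of triples (c, p, q) encodes the step function with the terms c 1_]p, q]. *)
Definition step_fun (s : seq (R * R * R)) (t : R) : R :=
  \sum_(x <- s) x.1.1 * \1_(`]x.1.2, x.2]) t.

(** The function 1_]p, q] corresponds to the difference of the points at q and p. *)
Definition step_elt (s : seq (R * R * R)) : free_space o :=
  \sum_(x <- s) x.1.1 *: (free_point o (kap x.2) - free_point o (kap x.1.2)).

Definition L1norm (g : R -> R) : R := (\int[mu]_t `|g t|)%R.

Lemma step_fun_cons x s t : step_fun (x :: s) t = x.1.1 * \1_(`]x.1.2, x.2]) t + step_fun s t.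
Proof. by rewrite /step_fun big_cons. Qed.

Lemma measurable_step_fun s : measurable_fun [set: R] (step_fun s).
Proof.
apply: measurable_sum => x; apply: measurable_funM => //.
Qed.

Lemma integrable_step_funM s (k : R -> R) : measurable_fun [set: R] k -> (forall t, `|k t| <= 1) ->
  mu.-integrable setT (EFin \o (fun t => step_fun s t * k t)).
Proof.
move=> mk k1; elim: s => [|x s ih].
  rewrite (_ : EFin \o _ = cst 0%E); first exact: integrable0.
  by apply/funext => t; rewrite /= /step_fun big_nil mul0r.
rewrite (_ : EFin \o _ = (fun t => ((x.1.1 * (\1_(`]x.1.2, x.2]) t * k t))%R%:E +
    (step_fun s t * k t)%R%:E)%E)); last first.
  by apply/funext => t; rewrite /= step_fun_cons mulrDl EFinD mulrA.
apply: integrableD => //.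
rewrite (_ : (fun t => _) = fun t => (x.1.1%:E * (\1_(`]x.1.2, x.2]) t * k t)%R%:E)%E)//.
apply: integrableZl => //; apply: integrable_indicM => //.
exact: integrable_ocitv.
Qed.

Lemma integral_step_funM s (k : R -> R) : measurable_fun [set: R] k -> (forall t, `|k t| <= 1) ->
  (\int[mu]_t (step_fun s t * k t) =
   \sum_(x <- s) x.1.1 * \int[mu]_(t in `]x.1.2, x.2]) k t)%R.
Proof.
move=> mk k1; elim: s => [|x s ih].
  rewrite big_nil; under eq_Rintegral do rewrite /step_fun big_nil mul0r.
  by rewrite Rintegral_cst// mul0r.
rewrite big_cons -ih.
rewrite (_ : (\int[mu]_t (step_fun (x :: s) t * k t))%R =
   (\int[mu]_t (x.1.1 * (\1_(`]x.1.2, x.2]) t * k t) + step_fun s t * k t))%R); last first.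
  by apply: eq_Rintegral => t _; rewrite step_fun_cons mulrDl mulrA.
have i1 : mu.-integrable setT (EFin \o (fun t => \1_(`]x.1.2, x.2]) t * k t)).
  by apply: integrable_indicM => //; exact: integrable_ocitv.
rewrite RintegralD//; last 2 first.
- rewrite (_ : EFin \o _ = fun t => (x.1.1%:E * (\1_(`]x.1.2, x.2]) t * k t)%R%:E)%E)//.
  exact: integrableZl.
- exact: integrable_step_funM.
by rewrite RintegralZl// Rintegral_indicM.
Qed.

Lemma integrable_step_fun s : mu.-integrable setT (EFin \o step_fun s).
Proof.
have := @integrable_step_funM s (fun=> 1) (@measurable_cst _ _ _ _ _ _) ltac:(by move=> t; rewrite normr1).
by rewrite (_ : EFin \o (fun t => step_fun s t * 1) = EFin \o step_fun s)//; apply/funext => t /=; rewrite mulr1.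
Qed.

Lemma integrable_abs g : mu.-integrable setT (EFin \o g) ->
  mu.-integrable setT (EFin \o (fun t => `|g t|)).
Proof. by move=> ig; exact: (integrable_norm ig). Qed.

(** A 1-Lipschitz function on K extends to a function phi on the line. Pairing with it is, up
    to e, integration of the step function against the difference quotients of phi, which are
    bounded by 1. *)
Lemma step_elt_norm_le s : valid_steps s -> `|step_elt s| <= L1norm (step_fun s).
Proof.
move=> vs; apply: free_norm_le => [|f fl].
  by apply: Rintegral_ge0 => t _.
have [phi [pl pf]] : exists phi : R -> R, (forall z z', `|phi z - phi z'| <= `|z - z'|) /\
    forall t : {t | K t}, phi (sval t) = f (kap (sval t)).
  have [[t0 Kt0]|nK] := pselect (exists t, K t); last first.
    exists (fun=> 0); split; first by move=> z z'; rewrite subrr normr0.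
    by move=> [t Kt]; exfalso; apply: nK; exists t.
  apply: (@mcshane _ {t | K t} R (fun z z' => `|z - z'|) sval (fun t => f (kap (sval t))) (exist _ t0 Kt0)).
  - by move=> x; rewrite subrr normr0.
  - by move=> x y; rewrite distrC.
  - by move=> x y z; exact: ler_distD.
  - by move=> [s1 K1] [s2 K2] /=; have := fl (kap s1) (kap s2); rewrite mul1r kap_iso.
have {}pf t : K t -> phi t = f (kap t) by move=> Kt; exact: (pf (exist _ t Kt)).
have mE : free_val (step_elt s) f = \sum_(x <- s) x.1.1 * (phi x.2 - phi x.1.2).
  rewrite free_sumE big_seq [RHS]big_seq; apply: eq_bigr => x xs.
  have [h1 h2 _] := vs x xs.
  by rewrite [LHS]/(x.1.1 * (f (kap x.2) - f (kap x.1.2))) !pf.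
apply/ler_addgt0Pr => e e0.
pose C := \sum_(x <- s) `|x.1.1|.
have C0 : 0 <= C by apply: sumr_ge0.
pose h := e / (2 * (C + 1)).
have h0 : 0 < h by rewrite divr_gt0// mulr_gt0// ltr_wpDl.
pose k t := (phi t - phi (t - h)) / h.
have ck : continuous k.
  have cp := Lip1_continuous pl.
  move=> t; apply: cvgM; last exact: cvg_cst.
  apply: cvgB; first exact: cp.
  apply: (@continuous_comp _ _ _ (fun t => t - h) phi); last exact: cp.
  by apply: cvgB; [exact: cvg_id|exact: cvg_cst].
have mk : measurable_fun [set: R] k by exact: continuous_measurable_fun.
have k1 t : `|k t| <= 1.
  rewrite /k normrM normfV (gtr0_norm h0) ler_pdivrMr// mul1r (le_trans (pl _ _))//.
  by rewrite opprB addrC subrK gtr0_norm.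
have A1 : `|(\int[mu]_t (step_fun s t * k t))%R - free_val (step_elt s) f| <= e.
  rewrite mE integral_step_funM// -sumrB (le_trans (ler_norm_sum _ _ _))//.
  rewrite (@le_trans _ _ (\sum_(x <- s) `|x.1.1| * (2 * h)))//.
    rewrite big_seq [leRHS]big_seq; apply: ler_sum => x xs.
    have [h1 h2 h3] := vs x xs.
    rewrite -mulrBr normrM ler_wpM2l// Rintegral_itv_obnd_cbnd.
      exact: integral_increment.
    exact: integrable_ocitv.
  have hE : 2 * h * (C + 1) = e.
    by rewrite /h; field; rewrite gt_eqF// ltr_wpDl.
  by rewrite -mulr_suml -/C -hE; lra.
have A2 : `|(\int[mu]_t (step_fun s t * k t))%R| <= L1norm (step_fun s).
  have im := integrable_step_funM s mk k1.
  rewrite (le_trans (le_normr_Rintegral _ im))//.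
  apply: le_Rintegral => //; [exact: integrable_abs|exact/integrable_abs/integrable_step_fun|].
  by move=> t _; rewrite normrM ler_piMr.
move: A1 A2; rewrite !ler_norml => /andP[A1 _] /andP[_ A2].
rewrite lerNl opprB lerBlDr addrC in A1.
by rewrite (le_trans A1)// lerD2r.
Qed.

(** The sign of the step function has a 1-Lipschitz primitive, and pi extends it from the copy
    of K to the whole space. *)
Lemma step_elt_norm_ge s : valid_steps s -> L1norm (step_fun s) <= `|step_elt s|.
Proof.
move=> vs.
pose k t : R := Num.sg (step_fun s t).
have mk : measurable_fun [set: R] k.
  apply: (measurableT_comp (f := @Num.sg R)); last exact: measurable_step_fun.
  exact: measurable_sgr.
have k1 t : `|k t| <= 1 by rewrite /k normr_sg; case: (_ != _).
have kE : L1norm (step_fun s) = (\int[mu]_t (step_fun s t * k t))%R.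
  by apply: eq_Rintegral => t _; rewrite normrEsg mulrC.
pose u t : R := (\int[mu]_(t in `[0, clamp l t]) k t)%R.
have uB p q : K p -> K q -> p <= q -> u q - u p = (\int[mu]_(t in `]p, q]) k t)%R.
  move=> /Kl/andP[p0 pl] /Kl/andP[q0 ql] pq.
  rewrite /u !clamp_id ?p0 ?q0// (integral_split (c := p) _ mk k1) ?p0//.
  by rewrite addrC addKr.
have ul t t' : `|u t - u t'| <= `|t - t'|.
  wlog tt : t t' / t' <= t.
    move=> W; have [/W//|/ltW/W] := leP t' t.
    by rewrite distrC [leRHS]distrC.
  have h1 := clamp_lip t t' l0.
  have /andP[a0 al] := clamp_itv t l0; have /andP[b0 bl] := clamp_itv t' l0.
  have ba : clamp l t' <= clamp l t.
    rewrite /clamp ge_max; apply/andP; split; first by rewrite le_max lexx.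
    by rewrite le_max le_min; apply/orP; right; rewrite !ge_min tt lexx orbT.
  rewrite /u (integral_split (c := clamp l t') _ mk k1) ?b0// addrC addKr.
  rewrite (le_trans (integral_ocitv_le ba mk k1))//.
  by apply: le_trans h1; rewrite ler_norm.
pose f := lip0_of o (fun z => u (pi z) - u (pi o)).
have fl : lipschitz_const 1 (fun z => u (pi z) - u (pi o)).
  move=> x y; rewrite opprB addrA subrK mul1r (le_trans (ul _ _))//.
have fE : f = (fun z => u (pi z) - u (pi o)) :> (N -> R).
  by apply: (lip0_ofE (k := 1)) => //; rewrite subrr.
have fn : `|f| <= 1 by apply: lip0_norm_const => //; rewrite fE.
have <- : free_val (step_elt s) f = L1norm (step_fun s).
  rewrite kE integral_step_funM// free_sumE big_seq [RHS]big_seq; apply: eq_bigr => x xs.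
  have [h1 h2 h3] := vs x xs.
  rewrite [LHS]/(x.1.1 * (f (kap x.2) - f (kap x.1.2))) fE -uB// !pi_kap//.
  by congr (_ * _); ring.
rewrite (le_trans (ler_norm _))// (le_trans (free_pair_le _ _))//.
by rewrite ler_piMr.
Qed.

Lemma step_elt_norm s : valid_steps s -> `|step_elt s| = L1norm (step_fun s).
Proof. by move=> vs; apply/eqP; rewrite eq_le step_elt_norm_le// step_elt_norm_ge. Qed.

End steps.

(** * Integrable functions represented in the free space *)

Section L1_norm.
Context {R : realType}.
Notation mu := (@lebesgue_measure R).
Notation intg g := (mu.-integrable setT (EFin \o g)).

Lemma intgD (g h : R -> R) : intg g -> intg h -> intg (fun t => g t + h t).
Proof.
move=> ig ih; rewrite (_ : EFin \o _ = (fun t => ((g t)%:E + (h t)%:E)%E)).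
  exact: integrableD.
by apply/funext => t.
Qed.

Lemma intgZ (a : R) (g : R -> R) : intg g -> intg (fun t => a * g t).
Proof.
move=> ig; rewrite (_ : EFin \o _ = (fun t => (a%:E * (g t)%:E)%E)).
  exact: integrableZl.
by apply/funext => t.
Qed.

Lemma intgB (g h : R -> R) : intg g -> intg h -> intg (fun t => g t - h t).
Proof.
move=> ig ih; have := intgD ig (intgZ (-1) ih).
by rewrite (_ : (fun t => g t + -1 * h t) = fun t => g t - h t)//; apply/funext => t; rewrite mulN1r.
Qed.

Lemma L1normD (g h : R -> R) : intg g -> intg h ->
  L1norm (fun t => g t + h t) <= L1norm g + L1norm h.
Proof.
move=> ig ih; rewrite /L1norm -RintegralD//; [|exact: integrable_abs|exact: integrable_abs].
apply: le_Rintegral => //; first by apply: integrable_abs; exact: intgD.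
  by apply: intgD; exact: integrable_abs.
by move=> t _; exact: ler_normD.
Qed.

Lemma L1normZ (a : R) (g : R -> R) : intg g -> L1norm (fun t => a * g t) = `|a| * L1norm g.
Proof.
move=> ig; rewrite /L1norm -RintegralZl//; last exact: integrable_abs.
by apply: eq_Rintegral => t _; rewrite normrM.
Qed.

Lemma L1norm0 : L1norm (fun=> 0 : R) = 0.
Proof.
rewrite /L1norm; under eq_Rintegral do rewrite normr0.
by rewrite Rintegral_cst// mul0r.
Qed.

Lemma L1normE (g : R -> R) : intg g -> ((L1norm g)%:E = \int[mu]_t (`|g t|)%:E)%E.
Proof.
move=> ig; rewrite /L1norm /Rintegral fineK//.
have := integrable_abs ig; exact: integrable_fin_num.
Qed.

End L1_norm.

Section embedding.
Context {R : realType} {N : metricType R} (o : N).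
Variables (K : set R) (kap : R -> N) (pi : N -> R) (l : R).
Hypotheses (l0 : 0 <= l) (Kl : forall t, K t -> 0 <= t <= l).
Hypothesis kap_iso : forall s t, K s -> K t -> mdist (kap s) (kap t) = `|s - t|.
Hypothesis pi_lip : forall x y, `|pi x - pi y| <= mdist x y.
Hypothesis pi_kap : forall t, K t -> pi (kap t) = t.
Notation mu := (@lebesgue_measure R).
Notation intg g := (mu.-integrable setT (EFin \o g)).
Notation elt := (step_elt o kap).
Notation valid_steps := (valid_steps K).
Let elt_norm s : valid_steps s -> `|elt s| = L1norm (step_fun s) := step_elt_norm o l0 Kl kap_iso pi_lip pi_kap (s := s).

Definition scale_steps (a : R) (s : seq (R * R * R)) := [seq (a * x.1.1, x.1.2, x.2) | x <- s].

Lemma valid_steps_cat s s' : valid_steps s -> valid_steps s' -> valid_steps (s ++ s').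
Proof. by move=> v v' x; rewrite mem_cat => /orP[/v|/v']. Qed.

Lemma valid_steps_scale a s : valid_steps s -> valid_steps (scale_steps a s).
Proof. by move=> v _ /mapP[x /v h ->]. Qed.

Lemma step_fun_cat (s s' : seq (R * R * R)) (t : R) : step_fun (s ++ s') t = step_fun s t + step_fun s' t.
Proof. by rewrite /step_fun big_cat. Qed.

Lemma step_fun_scale (a : R) s t : step_fun (scale_steps a s) t = a * step_fun s t.
Proof. by rewrite /step_fun big_map mulr_sumr; apply: eq_bigr => x _; rewrite mulrA. Qed.

Lemma step_elt_cat s s' : elt (s ++ s') = elt s + elt s'.
Proof. by rewrite /step_elt big_cat. Qed.

Lemma step_elt_scale a s : elt (scale_steps a s) = a *: elt s.
Proof. by rewrite /step_elt big_map scaler_sumr; apply: eq_bigr => x _; rewrite scalerA. Qed.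

(** The function g and m are limits of the same steps, in L1 and in the free space. *)
Definition represents (g : R -> R) (m : free_space o) : Prop := forall e : R, 0 < e ->
  exists s, [/\ valid_steps s, L1norm (fun t => g t - step_fun s t) <= e & `|m - elt s| <= e].

Lemma represents_norm g m : intg g -> represents g m -> `|m| = L1norm g.
Proof.
move=> ig r; apply/eqP; rewrite eq_le; apply/andP; split; apply/ler_addgt0Pr => e e0;
  have [s [vs gs ms]] := r (e / 2) (divr_gt0 e0 (ltr0Sn R 1)); have is_ := integrable_step_fun s.
- rewrite -(subrK (elt s) m) (le_trans (ler_normD _ _))// elt_norm//.
  have := L1normD (intgB is_ ig) ig.
  rewrite (_ : (fun t => step_fun s t - g t + g t) = step_fun s); last by apply/funext => t; rewrite subrK.
  have := L1normZ (-1) (intgB ig is_).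
  rewrite (_ : (fun t => -1 * (g t - step_fun s t)) = (fun t => step_fun s t - g t)); last by apply/funext => t; ring.
  rewrite normrN1 mul1r => ->; clear -gs ms; move: (L1norm _) (L1norm _) (L1norm _) gs => a b c; lra.
- have := L1normD (intgB ig is_) is_.
  rewrite (_ : (fun t => g t - step_fun s t + step_fun s t) = g); last by apply/funext => t; rewrite subrK.
  rewrite -elt_norm// => h; apply: (le_trans h).
  have h2 : `|elt s| <= `|m| + `|m - elt s|.
    by rewrite -{1}(subKr m (elt s)) ler_normB.
  clear -gs ms h2; move: (L1norm _) `|elt s| `|m| `|m - elt s| gs ms h2 => a b c d; lra.
Qed.

Lemma represents_lin a g g' m m' : intg g -> intg g' -> represents g m -> represents g' m' ->
  represents (fun t => a * g t + g' t) (a *: m + m').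
Proof.
move=> ig ig' r r' e e0; have a1 : 0 < `|a| + 1 by rewrite ltr_wpDl.
have e1 : 0 < e / (`|a| + 1) by rewrite divr_gt0.
have [s [vs gs ms]] := r _ (divr_gt0 e1 (ltr0Sn R 1)).
have [s' [vs' gs' ms']] := r' _ (divr_gt0 e0 (ltr0Sn R 1)).
have is_ := integrable_step_fun s; have is_' := integrable_step_fun s'.
have key x : x <= e / (`|a| + 1) / 2 -> `|a| * x <= e / 2.
  move=> xe; apply: (@le_trans _ _ (`|a| * (e / (`|a| + 1) / 2))); first exact: ler_wpM2l.
  have -> : `|a| * (e / (`|a| + 1) / 2) = `|a| / (`|a| + 1) * (e / 2) by ring.
  rewrite ler_piMl//; first by rewrite divr_ge0// ltW.
  by rewrite ler_pdivrMr// mul1r lerDl.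
exists (scale_steps a s ++ s'); split.
- by apply: valid_steps_cat => //; exact: valid_steps_scale.
- rewrite (_ : (fun t => _) = (fun t => a * (g t - step_fun s t) + (g' t - step_fun s' t))); last first.
    by apply/funext => t; rewrite step_fun_cat step_fun_scale; ring.
  rewrite (le_trans (L1normD _ _))//; [by apply: intgZ; exact: intgB|exact: intgB|].
  by rewrite L1normZ; [rewrite [e]splitr lerD// key|exact: intgB].
- rewrite step_elt_cat step_elt_scale opprD addrACA -scalerBr (le_trans (ler_normD _ _))//.
  by rewrite normrZ [e]splitr lerD// key.
Qed.

Lemma represents_uniq g m m' : intg g -> represents g m -> represents g m' -> m = m'.
Proof.
move=> ig r r'; have := represents_lin (-1) ig ig r r'.
rewrite (_ : (fun t => -1 * g t + g t) = (fun=> 0)); last by apply/funext => t; ring.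
move=> /represents_norm; rewrite L1norm0 scaleN1r addrC => h.
have /eqP : `|m' - m| = 0 by apply: h; exact: integrable0.
by rewrite normr_eq0 subr_eq0 => /eqP.
Qed.

Definition approximable (g : R -> R) : Prop := forall e : R, 0 < e ->
  exists s, valid_steps s /\ L1norm (fun t => g t - step_fun s t) <= e.

(** Approximating steps form a Cauchy sequence in the free space, by isometry. *)
Lemma represents_exists g : intg g -> approximable g -> exists m, represents g m.
Proof.
move=> ig ag.
have [s Hs] := choice (fun n : nat => ag n.+1%:R^-1 (ltac:(by rewrite invr_gt0) : 0 < n.+1%:R^-1 :> R)).
have cvgn : n.+1%:R^-1 @[n --> \oo] --> (0 : R) by exact: cvg_harmonic.
have mono n k : (n <= k)%N -> (k.+1%:R^-1 : R) <= n.+1%:R^-1.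
  by move=> nk; rewrite lef_pV2 ?posrE// ler_nat ltnS.
have dist n k : (n <= k)%N -> `|elt (s n) - elt (s k)| <= 2 * n.+1%:R^-1.
  move=> nk; have [vn gn] := Hs n; have [vk gk] := Hs k.
  have vd : valid_steps (s n ++ scale_steps (-1) (s k)) by apply: valid_steps_cat => //; exact: valid_steps_scale.
  rewrite -scaleN1r -step_elt_scale -step_elt_cat elt_norm//.
  have i1 := intgB ig (integrable_step_fun (s n)); have i2 := intgB ig (integrable_step_fun (s k)).
  rewrite (_ : step_fun _ = (fun t => -1 * (g t - step_fun (s n) t) + (g t - step_fun (s k) t))); last first.
    by apply/funext => t; rewrite step_fun_cat step_fun_scale; ring.
  rewrite (le_trans (L1normD (intgZ _ i1) i2))// L1normZ// normrN1 mul1r mulr2n mulrDl !mul1r.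
  by rewrite lerD// (le_trans gk)// mono.
have [|m ms] := free_complete (u := fun n => elt (s n)).
  move=> e e0; have /cvgrPdist_le/(_ _ (divr_gt0 e0 (ltr0Sn R 1))) := cvgn.
  apply: filterS => n; rewrite sub0r normrN ger0_norm ?invr_ge0// => ne k nk.
  by rewrite (le_trans (dist _ _ nk))// mulrC -ler_pdivlMr.
exists m => e e0.
have /cvgrPdist_le/(_ e e0) h1 := ms; have /cvgrPdist_le/(_ e e0) h2 := cvgn.
near \oo => n; exists (s n); have [vn gn] := Hs n; split => //.
  apply: (le_trans gn); have : `|0 - n.+1%:R^-1| <= e by near: n; exact: h2.
  by rewrite sub0r normrN ger0_norm ?invr_ge0.
by near: n; exact: h1.
Unshelve. all: by end_near. Qed.

End embedding.

(** * Density of the steps *)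

Lemma closed_inf_mem (R : realType) (A : set R) : closed A -> has_inf A -> A (inf A).
Proof.
move=> cA hA; apply: cA => B /nbhs_ballP[e /= e0 eB].
have [x Ax xe] := inf_adherent e0 hA; exists x; split => //; apply: eB.
rewrite /ball/= ltr_norml.
have h : inf A <= x by apply: ge_inf => //; case: hA.
by apply/andP; split; lra.
Qed.

Lemma closed_sup_mem (R : realType) (A : set R) : closed A -> has_sup A -> A (sup A).
Proof.
move=> cA hA; apply: cA => B /nbhs_ballP[e /= e0 eB].
have [x Ax xe] := sup_adherent e0 hA; exists x; split => //; apply: eB.
rewrite /ball/= ltr_norml.
have h : x <= sup A by apply: ub_le_sup => //; case: hA.
by apply/andP; split; lra.
Qed.

Section density.
Context {R : realType}.
Variables (K : set R) (l : R).
Hypotheses (l0 : 0 <= l) (Kl : forall t, K t -> 0 <= t <= l) (cK : closed K).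
Notation mu := (@lebesgue_measure R).
Notation intg g := (mu.-integrable setT (EFin \o g)).

Section continuous_case.
Variables (w : R -> R) (cw : continuous w).

(** The intersection of K with an interval between consecutive multiples of 1/(n+1). The step
    functions below use the intervals between the extreme points of the cells, which lie in K. *)
Definition cell (n j : nat) : set R :=
  K `&` [set t | j%:R <= t * n.+1%:R <= j.+1%:R].

Definition cell_lo n j : R := inf (cell n j).
Definition cell_hi n j : R := sup (cell n j).

Lemma cell_bounds n j : cell n j !=set0 -> has_inf (cell n j) /\ has_sup (cell n j).
Proof.
move=> ne; split; split => //.
  by exists 0 => t [/Kl/andP[]].
by exists l => t [/Kl/andP[]].
Qed.

Lemma closed_cell n j : closed (cell n j).
Proof.
apply: closedI => //.
have -> : [set t | j%:R <= t * n.+1%:R <= j.+1%:R] = (fun t : R => t * n.+1%:R) @^-1` `[j%:R, j.+1%:R].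
  by apply/seteqP; split => t /=; rewrite in_itv.
apply: closed_comp; last exact: interval_closed.
by move=> t _; apply: mulrr_continuous.
Qed.

Lemma cell_loP n j : cell n j !=set0 -> cell n j (cell_lo n j).
Proof. by move=> /cell_bounds[h _]; apply: closed_inf_mem => //; exact: closed_cell. Qed.

Lemma cell_hiP n j : cell n j !=set0 -> cell n j (cell_hi n j).
Proof. by move=> /cell_bounds[_ h]; apply: closed_sup_mem => //; exact: closed_cell. Qed.

Lemma cell_itv n j t : cell n j t -> cell_lo n j <= t <= cell_hi n j.
Proof.
move=> ct; have [[_ h1] [_ h2]] := @cell_bounds n j (ex_intro _ t ct).
by apply/andP; split; [exact: ge_inf|exact: ub_le_sup].
Qed.

Definition cells n : seq nat :=
  [seq j <- iota 0 (Num.trunc (l * n.+1%:R)).+1 | `[< cell n j !=set0 >]].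

Definition cell_steps n : seq (R * R * R) :=
  [seq (w (cell_lo n j), cell_lo n j, cell_hi n j) | j <- cells n].

Lemma valid_cell_steps n : valid_steps K (cell_steps n).
Proof.
move=> _ /mapP[j + ->] /=; rewrite mem_filter => /andP[/asboolP ne _].
have lo := cell_loP ne; have hi := cell_hiP ne.
by split; [case: lo|case: hi|have /andP[] := cell_itv hi].
Qed.

Lemma cell_disj n i j t : cell n i !=set0 -> cell n j !=set0 ->
  cell_lo n i < t <= cell_hi n i -> cell_lo n j < t <= cell_hi n j -> i = j.
Proof.
have n0 : (0 : R) < n.+1%:R by [].
have key a b : cell n a !=set0 -> cell n b !=set0 ->
    cell_lo n a < t <= cell_hi n a -> cell_lo n b < t <= cell_hi n b -> (a <= b)%N.
  move=> nea neb /andP[ta _] /andP[_ tb].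
  have [_ /= /andP[lo _]] := cell_loP nea; have [_ /= /andP[_ hi]] := cell_hiP neb.
  have : (a%:R : R) < b.+1%:R.
    apply: (le_lt_trans lo); apply: lt_le_trans hi.
    by rewrite ltr_pM2r//; exact: lt_le_trans ta tb.
  by rewrite ltr_nat ltnS.
move=> nei nej ti tj; apply/eqP; rewrite eqn_leq.
by rewrite (key i j)// (key j i).
Qed.

Lemma step_fun_cell_steps n t :
  (step_fun (cell_steps n) t = 0 /\ forall j, j \in cells n -> ~ (cell_lo n j < t <= cell_hi n j)) \/
  exists j, [/\ cell n j !=set0, cell_lo n j < t <= cell_hi n j &
                step_fun (cell_steps n) t = w (cell_lo n j)].
Proof.
have E : step_fun (cell_steps n) t =
    \sum_(j <- cells n) w (cell_lo n j) * \1_(`]cell_lo n j, cell_hi n j]) t.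
  by rewrite /step_fun big_map.
have ne j : j \in cells n -> cell n j !=set0.
  by rewrite mem_filter => /andP[/asboolP].
have [[j [jc tj]]|nj] := pselect (exists j, j \in cells n /\ cell_lo n j < t <= cell_hi n j).
  right; exists j; split => //; first exact: ne.
  rewrite E (bigD1_seq j)//=; last by rewrite filter_uniq// iota_uniq.
  rewrite indicE mem_set/= ?in_itv//= mulr1 big_seq_cond big1 ?addr0// => i /andP[ic ij].
  rewrite indicE memNset ?mulr0//= in_itv/= => ti; move/negP : ij; apply.
  by apply/eqP; apply: (cell_disj (ne _ ic) (ne _ jc) ti tj).
left; split; last by move=> j jc tj; apply: nj; exists j.
rewrite E big_seq big1// => j jc; rewrite indicE memNset ?mulr0//= in_itv/= => tj.
by apply: nj; exists j.
Qed.

(** A countable set outside of which the step functions converge: the lower ends of the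
    intervals, which are open there, and 0, which lies in no interval as these start at
    non-negative points. *)
Definition endpoints : set R :=
  range (fun x : option (nat * nat) => if x is Some nj then cell_lo nj.1 nj.2 else 0).

Lemma countable_endpoints : countable endpoints.
Proof. by apply: sub_countable (card_image_le _ _) _; exact: countableP. Qed.

(** A point of K other than these ends lies in the interval of one of its cells, and the value
    of w is taken within 1/(n+1) of it; a point outside K is in no interval for large n. *)
Lemma cell_steps_cvg t : ~ endpoints t ->
  step_fun (cell_steps n) t @[n --> \oo] --> \1_K t * w t.
Proof.
move=> nt; have t0 : t <> 0 by move=> t0; apply: nt; exists None.
have ntlo n j : t <> cell_lo n j by move=> tl; apply: nt; exists (Some (n, j)).
have near_t n j : cell n j !=set0 -> cell_lo n j < t <= cell_hi n j ->
    K (cell_lo n j) /\ `|t - cell_lo n j| <= n.+1%:R^-1.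
  move=> ne /andP[lt th].
  have [Klo /= /andP[lo _]] := cell_loP ne; have [_ /= /andP[_ hi]] := cell_hiP ne.
  split => //; have n0 : (0 : R) < n.+1%:R by [].
  rewrite gtr0_norm ?subr_gt0// -div1r ler_pdivlMr// mulrBl.
  have h1 : t * n.+1%:R <= j.+1%:R by apply: le_trans hi; rewrite ler_pM2r.
  by rewrite lerBlDr (le_trans h1)// -[j.+1%:R]natr1 addrC lerD2l.
have harm : n.+1%:R^-1 @[n --> \oo] --> (0 : R) by exact: cvg_harmonic.
have [Kt|nKt] := pselect (K t).
  rewrite indicE mem_set// mul1r; apply/cvgrPdist_le => e e0.
  have /cvgrPdist_le/(_ e e0)/nbhs_ballP[d /= d0 dB] := @cw t.
  have /cvgrPdist_lt/(_ d d0) := harm; apply: filterS => n; rewrite sub0r normrN ger0_norm ?invr_ge0// => nd.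
  have [[_ H]|[j [ne tj ->]]] := step_fun_cell_steps n t; last first.
    by apply: dB; have [_ h] := near_t _ _ ne tj; exact: le_lt_trans h nd.
  exfalso; have n0 : (0 : R) < n.+1%:R by [].
  have /andP[t_ge0 tl] := Kl Kt.
  have ex : exists j : nat, t * n.+1%:R <= j.+1%:R.
    by exists (Num.trunc (t * n.+1%:R)); apply/ltW/Num.Theory.truncnS_gt.
  case: (ex_minnP ex) => j tj jmin.
  have jt : j%:R < t * n.+1%:R.
    case: j tj jmin => [_ _|i _ imin]; first by rewrite mulr_gt0// lt_def t_ge0 andbT; exact/eqP.
    by rewrite ltNge; apply/negP => /imin; rewrite ltnn.
  have ct : cell n j t by split => //=; rewrite (ltW jt).
  apply: (H j).
    rewrite mem_filter mem_iota /= add0n; apply/andP; split; first by apply/asboolP; exists t.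
    rewrite ltnS -(ler_nat R).
    have jl : (j%:R : R) < l * n.+1%:R by apply: (lt_le_trans jt); rewrite ler_pM2r.
    have := Num.Theory.truncnS_gt (l * n.+1%:R); move/(lt_trans jl).
    by rewrite ltr_nat ltnS ler_nat.
  have /andP[lt1 lt2] := cell_itv ct; rewrite lt2 andbT lt_def lt1 andbT.
  exact/eqP.
rewrite indicE memNset// mul0r; apply/cvgrPdist_le => e e0.
have [d /= d0 dB] : exists2 d : R, 0 < d & forall s, `|t - s| < d -> ~ K s.
  have : nbhs t (~` K) by apply: open_nbhs_nbhs; split => //; exact: closed_openC.
  by move=> /nbhs_ballP[d /= d0 dB]; exists d => // s; exact: dB.
have /cvgrPdist_lt/(_ d d0) := harm; apply: filterS => n; rewrite sub0r normrN ger0_norm ?invr_ge0// => nd.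
have [[-> _]|[j [ne tj ->]]] := step_fun_cell_steps n t; first by rewrite subrr normr0 ltW.
by have [h1 h2] := near_t _ _ ne tj; exfalso; apply: (dB _ _ h1); exact: le_lt_trans h2 nd.
Qed.

Lemma approximable_continuous : approximable K (fun t => \1_K t * w t).
Proof.
move=> e e0.
have [c _ cB] : exists2 c : R, c \in `[0, l] & forall t, t \in `[0, l] -> `|w t| <= `|w c|.
  apply: EVT_max => //; apply: continuous_subspaceT => t.
  by apply: continuous_comp; [exact: cw|exact: norm_continuous].
pose B := `|w c|.
have wB t : K t -> `|w t| <= B by move=> /Kl tl; apply: cB; rewrite in_itv.
have mK : measurable (K : set R) by exact: closed_measurable.
have mw : measurable_fun [set: R] w by exact: continuous_measurable_fun.
have sub : \1_(`[0, l]) = (fun t => \1_(`[0, l]) t * 1) :> (R -> R).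
  by apply/funext => t; rewrite mulr1.
have iB : mu.-integrable setT (EFin \o (fun t => B * \1_(`[0, l]) t)).
  apply: intgZ; rewrite sub; apply: integrable_indicM => //.
  by apply: (@integrable_bounded _ _ _ _ 1) => // t; rewrite normr1.
have null : mu endpoints = 0%E.
  by apply: countable_lebesgue_measure0; exact: countable_endpoints.
have aecvg : {ae mu, forall t, [set: R] t ->
    (fun n => (step_fun (cell_steps n) t)%:E) @ \oo --> (\1_K t * w t)%:E}.
  exists endpoints; split => //.
    apply: countable_measurable; last exact: countable_endpoints.
    by move=> t; exact: measurable_set1.
  move=> t /= h; apply: contrapT => nt; apply: h => _.
  by apply: cvg_EFin; [exact: nearW|exact: cell_steps_cvg].
have bound n t : `|step_fun (cell_steps n) t| <= B * \1_(`[0, l]) t.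
  have [[-> _]|[j [ne /andP[lt th] ->]]] := step_fun_cell_steps n t.
    by rewrite normr0 mulr_ge0// ?indicE//; exact: normr_ge0.
  have [Klo _] := cell_loP ne; have [Khi _] := cell_hiP ne.
  rewrite indicE mem_set ?mulr1; first exact: wB.
  move: (Kl Klo) (Kl Khi) => /andP[h1 h2] /andP[h3 h4].
  by rewrite /= in_itv/= (le_trans h1 (ltW lt)) (le_trans th h4).
have mf n : measurable_fun [set: R] (EFin \o step_fun (cell_steps n)).
  by apply/measurable_EFinP; exact: measurable_step_fun.
have mKw : measurable_fun [set: R] (fun t => \1_K t * w t).
  by apply: measurable_funM => //; exact: measurable_indic.
have mg : measurable_fun [set: R] (EFin \o (fun t => \1_K t * w t)).
  exact/measurable_EFinP.
have aebound : {ae mu, forall t n, [set: R] t ->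
    (`|(step_fun (cell_steps n) t)%:E| <= (B * \1_(`[0, l]) t)%R%:E)%E}.
  by apply: nearW => t n _; rewrite abse_EFin lee_fin; exact: bound.
have [iw dc _] := @dominated_convergence _ _ _ mu setT measurableT
  (fun n => EFin \o step_fun (cell_steps n)) (EFin \o (fun t => \1_K t * w t))
  (EFin \o (fun t => B * \1_(`[0, l]) t)) mf mg aecvg iB aebound.
have [n _ /(_ n (leqnn n)) hn] := cvge0_near dc e0.
exists (cell_steps n); split; first exact: valid_cell_steps.
rewrite -lee_fin L1normE; last by apply: intgB => //; exact: integrable_step_fun.
apply: le_trans hn; rewrite le_eqVlt; apply/orP; left; apply/eqP.
by apply: eq_integral => t _; rewrite /= distrC.
Qed.

End continuous_case.

(** Continuous functions are dense in L1(K), and for them dominated convergence applies. *)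
Lemma approximable_supported (g : R -> R) : intg g -> (forall t, ~ K t -> g t = 0) ->
  approximable K g.
Proof.
move=> ig g0 e e0; have e2 : 0 < e / 2 by rewrite divr_gt0.
have mK : measurable (K : set R) by exact: closed_measurable.
have Kfin : (mu K < +oo)%E.
  apply: (@le_lt_trans _ _ (mu `[0, l])).
    apply: le_measure; [by rewrite inE|by rewrite inE|].
    by move=> t /Kl tl; rewrite /= in_itv.
  by apply: compact_finite_measure; exact: segment_compact.
have iK : mu.-integrable K (EFin \o g) by exact: (@integrableS _ _ _ mu setT).
have [w [cw iw wg]] := approximation_continuous_integrable mK Kfin iK.
have [n _ /(_ n (leqnn n)) hn] := cvge0_near wg e2.
have [s [vs hs]] := approximable_continuous (cw n) e2.
have iKw : intg (fun t => \1_K t * w n t) by exact: integrable_indicM.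
exists s; split => //.
rewrite (_ : (fun t => _) = (fun t => (g t - \1_K t * w n t) + (\1_K t * w n t - step_fun s t))); last first.
  by apply/funext => t; ring.
rewrite (le_trans (L1normD _ _))//; [exact: intgB|by apply: intgB => //; exact: integrable_step_fun|].
rewrite [e]splitr lerD// -lee_fin L1normE; last exact: intgB.
apply: le_trans hn; rewrite le_eqVlt; apply/orP; left; apply/eqP.
rewrite [RHS]integral_mkcond; apply: eq_integral => t _; rewrite /patch indicE.
case: ifPn => tK; first by rewrite mul1r.
by rewrite mul0r subr0 g0 ?normr0// => Kt; move/negP : tK; apply; exact: mem_set.
Qed.

End density.

(** * Transfer of a closed set of positive measure to the unit interval *)

Lemma ge0_integral_mrestr d (S : measurableType d) (R : realType)
    (m : {measure set S -> \bar R}) (D : set S) (mD : measurable D) (f : S -> \bar R) :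
  measurable_fun [set: S] f -> (forall x, (0 <= f x)%E) ->
  (\int[mrestr m mD]_x f x = \int[m]_(x in D) f x)%E.
Proof.
move=> mf f0.
rewrite (@ge0_negligible_integral _ _ _ (mrestr m mD) setT (~` D))//; last 2 first.
- exact: measurableC.
- by rewrite /= /mrestr setICl measure0.
rewrite setTD setCK; apply: eq_measure_integral => A mA AD.
by rewrite /= /mrestr (setIidl AD).
Qed.

Section cumulative.
Context {R : realType}.
Variables (K : set R) (l : R).
Hypotheses (l0 : 0 <= l) (Kl : forall t, K t -> 0 <= t <= l) (mK : measurable K).
Notation mu := (@lebesgue_measure R).
Hypothesis K_gt0 : (0 < mu K)%E.

Definition total_mass : R := fine (mu K).

Lemma mass_finite A : measurable A -> mu (K `&` A) \is a fin_num.
Proof.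
move=> mA; rewrite ge0_fin_numE//; apply: (@le_lt_trans _ _ (mu `[0, l])).
  apply: le_measure; [by rewrite inE; exact: measurableI|by rewrite inE|].
  by move=> t [/Kl tl _]; rewrite /= in_itv.
by apply: compact_finite_measure; exact: segment_compact.
Qed.

Lemma total_massE : (total_mass%:E = mu K)%E.
Proof. by rewrite /total_mass fineK// -[K]setIT mass_finite. Qed.

Lemma total_mass_gt0 : 0 < total_mass.
Proof. by rewrite -lte_fin total_massE. Qed.

Definition part_mass (t : R) : R := fine (mu (K `&` `]-oo, t])).

Lemma part_massE t : ((part_mass t)%:E = mu (K `&` `]-oo, t]))%E.
Proof. by rewrite /part_mass fineK// mass_finite. Qed.

Lemma part_mass_incr s t : s <= t -> part_mass s <= part_mass t <= part_mass s + (t - s).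
Proof.
move=> st; have mI x : measurable (K `&` `]-oo, x]) by exact: measurableI.
apply/andP; split; rewrite -lee_fin ?[(_ + (t - s))%:E]EFinD !part_massE.
  apply: le_measure; [by rewrite inE; exact: mI|by rewrite inE; exact: mI|].
  by move=> u [Ku us]; split => //; move: us; rewrite /= !in_itv/= => /le_trans; exact.
have -> : (t - s)%:E = mu `]s, t].
  rewrite [RHS](lebesgue_measure_itv `]s, t])/= lte_fin.
  by case: ltP => [//|ts]; have -> : t = s; [lra|rewrite subrr].
apply: le_trans (measureU2 mu (mI s) _) => //.
apply: le_measure; [by rewrite inE; exact: mI|by rewrite inE; apply: measurableU => //; exact: mI|].
move=> u [Ku]; rewrite /= in_itv/= => ut; have [us|su] := leP u s.
  by left; split => //=; rewrite in_itv.
by right; rewrite /= in_itv/= su.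
Qed.

(** The normalized distribution function of the restriction to K of Lebesgue measure. *)
Definition cumul (t : R) : R := part_mass t / total_mass.

Lemma cumul_homo s t : s <= t -> cumul s <= cumul t.
Proof.
move=> st; rewrite /cumul ler_pM2r ?invr_gt0 ?total_mass_gt0//.
by have /andP[] := part_mass_incr st.
Qed.

Lemma continuous_cumul : continuous cumul.
Proof.
move=> t; apply: cvgM; last exact: cvg_cst.
apply: Lip1_continuous => {t} s t.
wlog st : s t / s <= t.
  move=> W; have [/W//|/ltW/W] := leP s t.
  by rewrite distrC [leRHS]distrC.
have /andP[h1 h2] := part_mass_incr st.
by rewrite distrC [leRHS]distrC !ger0_norm ?subr_ge0//; lra.
Qed.

Lemma cumul_lt0 t : t < 0 -> cumul t = 0.
Proof.
move=> t0; rewrite /cumul /part_mass (_ : K `&` _ = set0) ?measure0 ?mul0r//.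
apply/seteqP; split => // u [/Kl/andP[u0 _]]; rewrite /= in_itv/= => ut.
by have := le_lt_trans (le_trans u0 ut) t0; rewrite ltxx.
Qed.

Lemma cumul_ge1 t : l <= t -> cumul t = 1.
Proof.
move=> lt; rewrite /cumul /part_mass (_ : K `&` _ = K).
  by rewrite divff// gt_eqF// total_mass_gt0.
apply/setIidl => u /Kl/andP[_ ul]; rewrite /= in_itv/=; exact: le_trans lt.
Qed.

Lemma cumul_itv t : 0 <= cumul t <= 1.
Proof.
apply/andP; split.
  by rewrite -(cumul_lt0 (_ : Num.min t (-1) < 0)) ?cumul_homo ?ge_min ?lexx// gt_min; apply/orP; right; lra.
by rewrite -(cumul_ge1 (_ : l <= Num.max t l)) ?cumul_homo ?le_max ?lexx// orbT.
Qed.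

(** The set where cumul <= x is a half-line, and cumul takes the value x at its end by
    continuity. *)
Lemma cumul_level x : 0 <= x < 1 -> (mu (K `&` [set t | (x < cumul t)%R]) = (total_mass * (1 - x))%:E)%E.
Proof.
move=> /andP[x0 x1].
pose A := [set t | cumul t <= x].
have hA : has_sup A.
  split; first by exists (-1); rewrite /A/= cumul_lt0//; lra.
  exists l => t; rewrite /A/= => ct; rewrite leNgt; apply/negP => lt.
  by move: ct; rewrite (cumul_ge1 (ltW lt)) leNgt x1.
set b := sup A.
have cA : closed A.
  have -> : A = cumul @^-1` `]-oo, x] by apply/seteqP; split => t; rewrite /A/= in_itv.
  apply: closed_comp; last exact: interval_closed.
  by move=> t _; exact: continuous_cumul.
have Ab : cumul b <= x := closed_sup_mem cA hA.
have AE : A = `]-oo, b]%classic.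
  apply/seteqP; split => t; rewrite /A/= in_itv/=.
    by move=> ct; apply: ub_le_sup => //; case: hA.
  by move=> /cumul_homo/le_trans; apply.
have bx : cumul b = x.
  apply/eqP; rewrite eq_le Ab/=; apply/ler_addgt0Pr => e e0.
  pose t := b + e * total_mass.
  have M0 := total_mass_gt0.
  have bt : b <= t by rewrite lerDl mulr_ge0// ltW.
  have /andP[_ h] := part_mass_incr bt.
  have tx : x < cumul t.
    rewrite ltNge; apply/negP => h'; have : t <= b by apply: ub_le_sup => //; case: hA.
    by rewrite leNgt ltrDl mulr_gt0.
  have h2 : cumul t <= cumul b + e.
    rewrite /cumul ler_pdivrMr// mulrDl divfK ?gt_eqF//.
    by apply: (le_trans h); rewrite /t; lra.
  by apply: ltW; exact: lt_le_trans tx h2.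
have -> : K `&` [set t | x < cumul t] = K `\` (K `&` `]-oo, b]).
  rewrite -AE; apply/seteqP; split => t [Kt].
    by rewrite /= ltNge => /negP h; split => // -[_]; rewrite /A.
  by move=> h; split => //=; rewrite ltNge; apply/negP => h'; apply: h.
rewrite measureD//; last 2 first.
- exact: measurableI.
- by rewrite [ltLHS](_ : _ = mu K)// -total_massE ltry.
rewrite [LHS](_ : _ = (mu K - mu (K `&` (K `&` `]-oo, b]%classic)))%E)//.
rewrite setIA setIid -part_massE -total_massE -EFinB mulrBr mulr1 -bx /cumul.
by rewrite [total_mass * _]mulrC divfK// gt_eqF// total_mass_gt0.
Qed.

Let M0 : {nonneg R} := NngNum (ltW total_mass_gt0).

Let mcumul : measurable_fun [set: measurableTypeR R] (cumul : measurableTypeR R -> measurableTypeR R).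
Proof. exact: continuous_measurable_fun continuous_cumul. Qed.

Let K_restr : {measure set (measurableTypeR R) -> \bar R} := mrestr mu mK.

Let cumul_law : {measure set (measurableTypeR R) -> \bar R} :=
  measure_function_pushforward__canonical__measure_function_Measure K_restr mcumul.

Let uniform_law : {measure set (measurableTypeR R) -> \bar R} := mscale M0 (@lebesgue01 R).

(** The distribution function carries the measure of K to a multiple of Lebesgue measure on
    [0, 1]; half-lines suffice to see it. *)
Lemma cumul_image (A : set (measurableTypeR R)) : measurable A ->
  cumul_law A = uniform_law A.
Proof.
move=> mA.
pose g (n : nat) : set R := `](- n%:R), +oo[%classic.
apply: (@measure_unique _ _ (measurableTypeR R) (@RGenOInfty.G R) g _ _ _ _ cumul_law uniform_law) => //.
- exact: RGenOInfty.measurableE.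
- move=> _ _ [x ->] [y ->]; exists (Num.max x y).
  by apply/seteqP; split => t /=; rewrite !in_itv/= !andbT gt_max; [move=> [-> ->]|move=> /andP[-> ->]].
- by move=> i; exists (- i%:R).
- apply/seteqP; split => // t _; have [n _ /(_ n (leqnn n)) h] := nbhs_infty_gtr (- t).
  by exists n => //; rewrite /g/= in_itv/= andbT ltrNl.
- move=> _ [x ->].
  have -> : cumul_law `]x, +oo[%classic = mu (cumul @^-1` `]x, +oo[%classic `&` K) by [].
  have -> : uniform_law `]x, +oo[%classic =
    (total_mass%:E * mu (`]x, +oo[%classic `&` `[0%R, 1%R]%classic))%E by [].
  rewrite setIC; have [x0|x0] := ltP x 0.
    rewrite [X in K `&` X](_ : _ = setT); last first.
      apply/seteqP; split => // t _ /=; rewrite in_itv/= andbT.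
      by apply: lt_le_trans x0 _; have /andP[] := cumul_itv t.
    rewrite setIT -total_massE [X in mu X](_ : _ = `[0, 1]%classic).
      by rewrite lebesgue_measure_itv/= lte_fin ltr01 -EFinB subr0 mule1.
    apply/seteqP; split => t /=; rewrite !in_itv/= andbT; first by case.
    by move=> /andP[t0 t1]; rewrite t0 t1; split => //; exact: lt_le_trans x0 t0.
  have [x1|x1] := ltP x 1.
    rewrite [X in K `&` X](_ : _ = [set t | x < cumul t]); last first.
      by apply/seteqP; split => t /=; rewrite in_itv/= andbT.
    rewrite cumul_level ?x0// EFinM; congr (_ * _)%E.
    rewrite [X in mu X](_ : _ = `]x, 1]%classic).
      by rewrite lebesgue_measure_itv/= lte_fin x1 -EFinB.
    apply/seteqP; split => t /=; rewrite !in_itv/= andbT.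
      by move=> [-> /andP[_ ->]].
    by move=> /andP[xt ->]; rewrite xt andbT; split => //; exact: ltW (le_lt_trans x0 xt).
  rewrite [X in K `&` X](_ : _ = set0); last first.
    apply/seteqP; split => // t /=; rewrite in_itv/= andbT => h.
    have /andP[_ h1] := cumul_itv t.
    by have := lt_le_trans h (le_trans h1 x1); rewrite ltxx.
  rewrite setI0 measure0 [X in mu X](_ : _ = set0).
    by rewrite measure0 mule0.
  apply/seteqP; split => // t /=; rewrite !in_itv/= andbT => -[xt /andP[_ t1]].
  by have := lt_le_trans xt (le_trans t1 x1); rewrite ltxx.
- move=> k; apply: (@le_lt_trans _ _ (mu K)); last by rewrite -total_massE ltry.
  have -> : cumul_law (g k) = mu (cumul @^-1` g k `&` K) by [].
  apply: le_measure; [|by rewrite inE|exact: subIsetr].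
  rewrite inE; apply: measurableI => //.
  rewrite -[X in measurable X]setTI; by apply: mcumul => //; exact: measurable_itv.
Qed.

Lemma integral_cumul (g : R -> R) : measurable_fun [set: R] g ->
  (\int[mu]_t `|\1_K t * g (cumul t)|%:E = total_mass%:E * \int[@lebesgue01 R]_x `|g x|%:E)%E.
Proof.
move=> mg; have mag : measurable_fun [set: measurableTypeR R] (fun x => `|g x|%:E).
  by apply/measurable_EFinP; exact: measurableT_comp.
transitivity (\int[mu]_(t in K) `|g (cumul t)|%:E)%E.
  rewrite [RHS]integral_mkcond; apply: eq_integral => t _; rewrite /patch indicE.
  by case: ifPn => tK; rewrite ?mul1r// mul0r normr0.
transitivity (\int[K_restr]_t `|g (cumul t)|%:E)%E.
  rewrite (ge0_integral_mrestr mu mK)//.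
  by apply: (measurableT_comp mag); exact: mcumul.
transitivity (\int[cumul_law]_x `|g x|%:E)%E.
  by rewrite (ge0_integral_pushforward mcumul K_restr measurableT mag).
rewrite (@eq_measure_integral _ _ _ setT uniform_law cumul_law); last first.
  by move=> A mA _; exact: cumul_image.
by rewrite (@ge0_integral_mscale _ _ _ (@lebesgue01 R) setT measurableT M0).
Qed.

End cumulative.

Section contains_L1_line.
Context {R : realType} {N : metricType R} (o : N).
Variables (K : set R) (kap : R -> N) (pi : N -> R) (l : R).
Hypotheses (l0 : 0 <= l) (Kl : forall t, K t -> 0 <= t <= l) (cK : closed K).
Hypothesis kap_iso : forall s t, K s -> K t -> mdist (kap s) (kap t) = `|s - t|.
Hypothesis pi_lip : forall x y, `|pi x - pi y| <= mdist x y.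
Hypothesis pi_kap : forall t, K t -> pi (kap t) = t.
Notation mu := (@lebesgue_measure R).
Notation intg g := (mu.-integrable setT (EFin \o g)).
Hypothesis K_gt0 : (0 < mu K)%E.

Notation L1 := (LfunType (@lebesgue01 R) (lexx 1%E)).

Let mK : measurable (K : set R) := closed_measurable cK.

Definition transfer (g : R -> R) (t : R) : R := \1_K t * g (cumul K t).

Let intg_transfer (g : L1) : intg (transfer g).
Proof.
have mg : measurable_fun [set: measurableTypeR R] g by exact: measurable_funPT.
apply/integrableP; split.
  apply/measurable_EFinP; apply: measurable_funM; first exact: measurable_indic.
  apply: (measurableT_comp mg); apply: continuous_measurable_fun.
  exact: (continuous_cumul Kl mK).
rewrite [ltLHS](_ : _ = \int[mu]_t `|transfer g t|%:E)%E//.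
rewrite (integral_cumul Kl mK K_gt0 mg).
have := Lfunction_finite _ g; rewrite /finite_norm Lnorm1 => h.
by rewrite lte_mul_pinfty// lee_fin ltW// (total_mass_gt0 Kl mK K_gt0).
Qed.

Let L1norm_transfer (g : L1) : L1norm (transfer g) = total_mass K * fine ('N[@lebesgue01 R]_1[EFin \o g]).
Proof.
have mg : measurable_fun [set: measurableTypeR R] g by exact: measurable_funPT.
rewrite Lnorm1; apply: EFin_inj; rewrite (L1normE (intg_transfer g)).
rewrite (integral_cumul Kl mK K_gt0 mg) EFinM; congr (_ * _)%E; rewrite fineK//.
have := Lfunction_finite _ g; rewrite /finite_norm Lnorm1 => h.
by rewrite ge0_fin_numE// integral_ge0.
Qed.

Let ex_represents (g : L1) : exists m : free_space o, represents K kap (transfer g) m.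
Proof.
apply: (represents_exists o l0 Kl kap_iso pi_lip pi_kap (intg_transfer g)).
apply: (approximable_supported l0 Kl cK (intg_transfer g)) => t nK.
by rewrite /transfer indicE memNset// mul0r.
Qed.

Let L (g : L1) : free_space o := projT1 (cid (ex_represents g)).

Let LP (g : L1) : represents K kap (transfer g) (L g).
Proof. by rewrite /L; case: cid. Qed.

Let L_linear : linear L.
Proof.
move=> a f g; apply: (represents_uniq l0 Kl kap_iso pi_lip pi_kap (intg_transfer (a *: f + g))) => //.
rewrite (_ : transfer (a *: f + g) = (fun t => a * transfer f t + transfer g t)).
  exact: (represents_lin _ (intg_transfer f) (intg_transfer g)).
apply/funext => t; rewrite /transfer.
have -> : (a *: f + g) (cumul K t) = a * f (cumul K t) + g (cumul K t) by [].
by rewrite mulrDr mulrCA.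
Qed.

HB.instance Definition _ := GRing.isLinear.Build R L1 (free_space o) *:%R L L_linear.

(** Composition with cumul multiplies norms by the measure of K, and functions on K are
    represented isometrically. *)
Theorem contains_L1_of_line : contains_L1 (free_space o).
Proof.
exists L, (total_mass K), (total_mass K); split; first exact: (total_mass_gt0 Kl mK K_gt0).
move=> f; rewrite (represents_norm l0 Kl kap_iso pi_lip pi_kap (intg_transfer f) (LP f)).
by rewrite L1norm_transfer lexx.
Qed.

End contains_L1_line.

(** * Step functions in L1 *)

Section unit_interval.
Context {R : realType}.

Notation lambda := (@lebesgue_measure R).

Let itv01_finite : (lambda `[0%R, 1%R]%classic < +oo)%E.
Proof. by rewrite lebesgue_measure_itv/= lte_fin ltr01 ltry. Qed.

Let m01 : measurable (`[0%R, 1%R]%classic : set (measurableTypeR R)) := measurable_itv `[0%R, 1%R].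

Definition finite01 : {finite_measure set (measurableTypeR R) -> \bar R} :=
  [the {finite_measure set _ -> \bar R} of @mfrestr _ (measurableTypeR R) R _ lambda m01 itv01_finite].

Lemma mass01T : mass finite01 setT = 1.
Proof.
apply: EFin_inj; rewrite massE// [LHS](_ : _ = lambda (setT `&` `[0%R, 1%R]))//.
by rewrite setTI lebesgue_measure_itv/= lte_fin ltr01 -EFinB subr0.
Qed.

(** Cut A at its median. *)
Lemma halving (A : set (measurableTypeR R)) : measurable A ->
  exists B, [/\ measurable B, B `<=` A & mass finite01 B = mass finite01 A / 2].
Proof.
move=> mA; pose K : set R := A `&` `[0, 1]%classic.
have mK : measurable (K : set (measurableTypeR R)) by exact: measurableI.
have AE : mass finite01 A = total_mass K by [].
have Kl t : K t -> 0 <= t <= 1 by move=> [_]; rewrite /= in_itv.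
have [K0|] := ltP 0%E (lambda K); last first.
  rewrite measure_le0 => /eqP K0; exists set0; split => //.
  by rewrite mass0 AE /total_mass K0/= mul0r.
have h : (0 <= 1 / 2 :> R) && (1 / 2 < 1 :> R) by lra.
have hc := cumul_level Kl mK K0 h.
pose B : set (measurableTypeR R) := K `&` [set t | 1 / 2 < cumul K t].
have mB : measurable B.
  apply: measurableI => //; rewrite [X in measurable X](_ : _ = cumul K @^-1` `]1 / 2, +oo[%classic).
    rewrite -[X in measurable X]setTI.
    by apply: (continuous_measurable_fun (continuous_cumul Kl mK)) => //; exact: measurable_itv.
  by apply/seteqP; split => t; rewrite /= in_itv/= andbT.
exists B; split => //; first by move=> t [[]].
rewrite AE; apply: EFin_inj; rewrite massE//.
rewrite [LHS](_ : _ = lambda (B `&` `[0, 1]%classic))//.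
rewrite (_ : B `&` _ = B); last by apply/setIidl => t [[]].
by rewrite [LHS]hc; congr EFin; lra.
Qed.

(** The set B is the union of the halves of the blocks. *)
Lemma simultaneous_halving (K : finType) (p : measurableTypeR R -> K) : mpart p ->
  exists2 B, measurable B & forall k,
    mass finite01 (block p k `&` B) = mass finite01 (block p k) / 2 /\
    mass finite01 (block p k `&` ~` B) = mass finite01 (block p k) / 2.
Proof.
move=> mp; have /choice[H HP] k := halving (mp k).
pose B : set (measurableTypeR R) := \big[setU/set0]_(k : K) H k.
have mB : measurable B by apply: bigsetU_measurable => k _; have [] := HP k.
have Bk k : block p k `&` B = H k.
  have [_ Hk _] := HP k; rewrite /B -bigcup_seq; apply/seteqP; split => x.
    move=> [px [j _ Hx]]; have [_ Hj _] := HP j.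
    by rewrite -(px : p x = k) (Hj _ Hx : p x = j).
  by move=> Hx; split; [exact: Hk|exists k => //=; rewrite mem_index_enum].
exists B => // k; have [_ _ hk] := HP k; rewrite Bk hk; split => //.
have := mass_part finite01 (mpart_set mB) (mp k).
by rewrite big_bool/= -/(block p k) block_in block_notin Bk hk; lra.
Qed.

End unit_interval.

Section L1_embedding.
Context {R : realType} {V : normedModType R}.
Notation L1 := (LfunType (@lebesgue01 R) (lexx 1%E)).
Notation mass := (mass (@finite01 R)).
Variables (L : {linear L1 -> V}) (c C : R).
Hypotheses (c0 : 0 < c) (LP : forall f : L1,
  c * fine 'N[@lebesgue01 R]_1[EFin \o f] <= `|L f| <= C * fine 'N[@lebesgue01 R]_1[EFin \o f]).

Notation intg01 f := ((@lebesgue01 R).-integrable setT (EFin \o f)).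

Let mkL1 (f : measurableTypeR R -> R) : L1 := insubd (0 : L1) f.

Let mkL1E f : intg01 f -> mkL1 f = f :> (R -> R).
Proof.
move=> fi; have fL : f \in Lfun (@lebesgue01 R) 1 by exact/Lfun1_integrable.
exact: (insubdK (0 : L1) fL).
Qed.

(** The value of L at f; integrable functions are the meaningful arguments. *)
Definition embed (f : measurableTypeR R -> R) : V := L (mkL1 f).

Lemma embed_lin (a : R) f g : intg01 f -> intg01 g ->
  embed (fun t => a * f t + g t) = a *: embed f + embed g.
Proof.
move=> fi gi; rewrite /embed -linearP; congr (L _); apply: val_inj.
have h : intg01 (fun t => a * f t + g t).
  rewrite (_ : EFin \o _ = (fun t => (a%:E * (f t)%:E + (g t)%:E)%E)) //.
  by apply: integrableD => //; apply: integrableZl.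
apply/funext => t; rewrite [LHS](congr1 (fun h => h t) (mkL1E h)).
by rewrite [RHS](_ : _ = a * mkL1 f t + mkL1 g t)// (mkL1E fi) (mkL1E gi).
Qed.

Lemma intg01_step (K : finType) (p : measurableTypeR R -> K) (w : K -> R) :
  mpart p -> intg01 (fun t => w (p t)).
Proof. by move=> mp; exact: (integrable_finite_valued (@finite01 R)). Qed.

Lemma embed_step_norm (K : finType) (p : measurableTypeR R -> K) (w : K -> R) : mpart p ->
  c * \sum_k `|w k| * mass (block p k) <= `|embed (fun t => w (p t))| <=
  C * \sum_k `|w k| * mass (block p k).
Proof.
move=> mp; have := LP (mkL1 (fun t => w (p t))).
rewrite (mkL1E (intg01_step w mp)) Lnorm1.
have := integral_finite_valued (@finite01 R) (fun k => `|w k|) mp measurableT.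
under eq_bigr do rewrite setTI.
move=> h; rewrite [X in fine X](_ : _ = (\sum_k `|w k| * mass (block p k))%:E)//.
Qed.

End L1_embedding.

(** * Densities are close to step functions; L1 fails the Radon-Nikodym property *)

Section bochner_step.
Context {R : realType} {V : normedModType R} d (S : measurableType d).
Variable mu : {finite_measure set S -> \bar R}.

Lemma simple_factor (s : S -> V) : simple_fun s ->
  exists (K : finType) (p : S -> K) (w : K -> V), mpart p /\ s = w \o p.
Proof.
move=> [fs ms]; have [K [p [w [mp sE]]]] := finite_factor 0 fs ms.
by exists K, p, w; split => //; apply/funext.
Qed.

Lemma simple_factor2 (s t : S -> V) : simple_fun s -> simple_fun t ->
  exists (K : finType) (p : S -> K) (w w' : K -> V),
    [/\ mpart p, s = w \o p & t = w' \o p].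
Proof.
move=> /simple_factor[K [p [w [mp ->]]]] /simple_factor[K' [p' [w' [mp' ->]]]].
exists (K * K')%type, (fun x => (p x, p' x)), (w \o fst), (w' \o snd).
by split => //; exact: mpart_pair.
Qed.

Lemma measurable_dist_simple (s t : S -> V) : simple_fun s -> simple_fun t ->
  measurable_fun setT (fun x => `|s x - t x|).
Proof.
move=> ss st; have [K [p [w [w' [mp -> ->]]]]] := simple_factor2 ss st.
exact: (measurable_finite_valued (fun k => `|w k - w' k|) mp).
Qed.

Lemma simple_integral_dist (A : set S) (s t : S -> V) : measurable A ->
  simple_fun s -> simple_fun t ->
  (`|simple_integral mu A s - simple_integral mu A t|%:E <= \int[mu]_x `|s x - t x|%:E)%E.
Proof.
move=> mA ss st; have [K [p [w [w' [mp -> ->]]]]] := simple_factor2 ss st.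
rewrite !simple_integral_finite_valued// -sumrB.
rewrite [leRHS](integral_finite_valued mu (fun k => `|w k - w' k|) mp measurableT) lee_fin.
rewrite (le_trans (ler_norm_sum _ _ _))//; apply: ler_sum => k _.
rewrite -scalerBr normrZ ger0_norm ?mass_ge0// mulrC ler_wpM2l// setTI.
have mk : measurable (block p k) := mp k.
rewrite -lee_fin !massE//; last exact: measurableI.
by apply: le_measure; rewrite ?inE//; exact: measurableI.
Qed.

(** Strong measurability makes the norm of s - g measurable off a null set, which gives
    the triangle inequality for the possibly non-measurable integrands. *)
Lemma integral_dist_triangle (g s t : S -> V) : strongly_measurable mu g ->
  simple_fun s -> simple_fun t ->
  (\int[mu]_x `|s x - t x|%:E <= \int[mu]_x `|s x - g x|%:E + \int[mu]_x `|t x - g x|%:E)%E.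
Proof.
move=> [r sr [N [mN N0 gN]]] ss st.
have cg x : ~ N x -> r n x @[n --> \oo] --> g x.
  by move=> nN; apply: contrapT => h; apply: nN; exact: gN.
pose h (u : S -> V) x : R := \1_(~` N) x * `|u x - g x|.
have mh u : simple_fun u -> measurable_fun setT (h u).
  move=> su; apply: (measurable_fun_cvg (h := fun n x => \1_(~` N) x * `|u x - r n x|)).
    move=> n; apply: measurable_funM; last exact: measurable_dist_simple.
    by apply: measurable_indic; exact: measurableC.
  move=> x _; rewrite /h indicE; have [/set_mem nN|_] := boolP (x \in ~` N); last first.
    by under eq_fun do rewrite mul0r; rewrite mul0r; exact: cvg_cst.
  under eq_fun do rewrite mul1r.
  rewrite mul1r; apply: cvg_norm; apply: cvgB; [exact: cvg_cst|exact: cg].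
have hle u : (\int[mu]_x (h u x)%:E <= \int[mu]_x `|u x - g x|%:E)%E.
  apply: ge0_le_integral_any => x; rewrite lee_fin /h indicE; first exact: mulr_ge0.
  by case: (_ \in _); rewrite ?mul1r ?mul0r.
apply: le_trans (leeD (hle s) (hle t)).
have h0 u x : setT x -> (0 <= (h u x)%:E)%E by rewrite lee_fin /h indicE => _; exact: mulr_ge0.
rewrite -ge0_integralD//; [|exact: h0|by apply/measurable_EFinP; exact: mh|exact: h0|by apply/measurable_EFinP; exact: mh].
rewrite (ge0_negligible_integral mN measurableT)//; last first.
  by apply/measurable_EFinP; exact: measurable_dist_simple.
rewrite setTD [leLHS]integral_mkcond; apply: ge0_le_integral => //.
- by move=> x _; rewrite /patch; case: ifP => // _; rewrite lee_fin.
- apply/(measurable_restrictT _ _).1; first exact: measurableC.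
  apply/measurable_EFinP; apply: (measurable_funS measurableT) => //; exact: measurable_dist_simple.
- by apply: emeasurable_funD; apply/measurable_EFinP; exact: mh.
move=> x _; rewrite /patch -EFinD /h indicE; case: ifP => _; last by rewrite !mul0r addr0.
by rewrite lee_fin !mul1r -[X in _ <= _ + X]normrN opprB (le_trans _ (ler_normD _ _))// subrKA.
Qed.

(** A density is close in mean to one simple function, and then the two have close integrals
    over all sets, even though the sequence used to integrate over a set may depend on it. *)
Lemma bochner_step (G : set S -> V) (g : S -> V) : bochner_integrable mu g ->
  (forall A, measurable A -> is_bochner_integral mu A g (G A)) ->
  forall e : R, 0 < e -> exists (K : finType) (p : S -> K) (w : K -> V), mpart p /\
    forall A, measurable A ->
      `|G A - \sum_(k : K) mass mu (A `&` block p k) *: w k| <= e.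
Proof.
move=> [mg [t [st ct]]] Gg e e0; have e4 : 0 < e / 4 by lra.
have [n _ /(_ n (leqnn n)) tn] := cvge0_near ct e4.
have [K [p [w [mp tE]]]] := simple_factor (st n).
exists K, p, w; split => // A mA; rewrite -simple_integral_finite_valued// -tE.
have [s [ss cs] cG] := Gg A mA.
move/cvgrPdist_le : cG => /(_ _ e4) cG.
have [m _ /(_ m (leqnn m))[h1 h2]] := filterI cG (cvge0_near cs e4).
rewrite -(subrKA (simple_integral mu A (s m))) (le_trans (ler_normD _ _))//.
have h3 := simple_integral_dist mA (ss m) (st n).
have h4 := le_trans h3 (integral_dist_triangle mg (ss m) (st n)).
have := le_trans h4 (leeD h2 tn); rewrite -EFinD lee_fin; move: h1 => /=; lra.
Qed.

End bochner_step.

(** For a finitely additive set function, convergence of the series over a disjoint sequence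
    amounts to decay along the tails of its union. *)
Lemma additive_tail d (S : measurableType d) (V : zmodType) (H : set S -> V) (F : nat -> set S) n :
  (forall A B, measurable A -> measurable B -> A `&` B = set0 -> H (A `|` B) = H A + H B) ->
  (forall k, measurable (F k)) -> trivIset setT F ->
  H (\bigcup_k F k) = \sum_(0 <= k < n) H (F k) + H (\bigcup_(k in [set k | (n <= k)%N]) F k).
Proof.
move=> HU mF tF; elim: n => [|n ih]; first by rewrite big_nil add0r; congr (H (bigcup _ _)); apply/seteqP.
rewrite ih big_nat_recr//= -addrA; congr (_ + _); rewrite -HU//.
- congr (H _); apply/seteqP; split => x /=.
    move=> [k /= nk Fx]; move: nk; rewrite leq_eqVlt => /predU1P[->|nk]; [by left|].
    by right; exists k.
  by case=> [Fx|[k /= nk Fx]]; [exists n => //=|exists k => //=; exact: ltnW].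
- exact: bigcup_measurable.
- apply/seteqP; split => // x [Fx [k /= nk Fk]].
  have e : n = k by apply: (tF n k I I); exists x.
  by move: nk; rewrite e ltnn.
Qed.

Section L1_no_RNP.
Context {R : realType} {V : normedModType R}.
Notation L1 := (LfunType (@lebesgue01 R) (lexx 1%E)).
Notation mu := (@finite01 R).
Notation S := (measurableTypeR R).
Variables (L : {linear L1 -> V}) (c C : R).
Hypotheses (c0 : 0 < c) (LP : forall f : L1,
  c * fine 'N[@lebesgue01 R]_1[EFin \o f] <= `|L f| <= C * fine 'N[@lebesgue01 R]_1[EFin \o f]).

Let C_ge0 : 0 <= C.
Proof.
have /andP[h1 h2] := embed_step_norm LP (fun=> 1) (mpart_set (@measurableT _ S)).
have := le_trans h1 h2; rewrite big_bool/= !normr1 !mul1r block_in block_notin setCT mass0 mass01T.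
by rewrite addr0 !mulr1 => h; apply: le_trans h; exact: ltW.
Qed.

(** The vector measure A |-> 1_A with values in L1, seen in V. *)
Definition embed_set (A : set S) : V := embed L (fun t => (t \in A)%:R).

Lemma embed_set_le A : measurable A -> `|embed_set A| <= C * mass mu A.
Proof.
move=> mA; have /andP[_] := embed_step_norm LP (fun b : bool => b%:R) (mpart_set mA).
by rewrite big_bool/= normr1 normr0 mul1r mul0r addr0 block_in.
Qed.

Lemma embed_setU A B : measurable A -> measurable B -> A `&` B = set0 ->
  embed_set (A `|` B) = embed_set A + embed_set B.
Proof.
move=> mA mB AB; rewrite -[embed_set A]scale1r -embed_lin; last 2 first.
- exact: (intg01_step (fun b : bool => b%:R) (mpart_set mA)).
- exact: (intg01_step (fun b : bool => b%:R) (mpart_set mB)).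
congr (embed L _); apply/funext => t; rewrite in_setU mul1r.
have [tA|tA] := boolP (t \in A); last by rewrite add0r.
suff -> : t \in B = false by rewrite addr0.
by apply/negbTE/negP => tB; have : set0 t by rewrite -AB; split; exact: set_mem.
Qed.

Let massU A B : measurable A -> measurable B -> A `&` B = set0 ->
  mass mu (A `|` B) = mass mu A + mass mu B.
Proof.
move=> mA mB AB; apply: EFin_inj; rewrite EFinD !massE//; last exact: measurableU.
exact: measureU.
Qed.

Let vector_measure_embed : vector_measure embed_set.
Proof.
move=> F mF tF; apply/cvgrPdist_le => e e0.
have C1 : 0 < C + 1 by rewrite ltr_wpDl.
have mU : measurable (\bigcup_k F k) by exact: bigcup_measurable.
have : (\sum_(0 <= k < n) mass mu (F k))%:E @[n --> \oo] --> (mass mu (\bigcup_k F k))%:E.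
  rewrite massE// (_ : (fun n => _) = (fun n => \sum_(0 <= k < n) mu (F k))%E).
    exact: measure_semi_sigma_additive.
  by apply/funext => n; rewrite -sumEFin; apply: eq_bigr => k _; rewrite massE.
move=> /fine_cvgP[_ /cvgrPdist_le/(_ _ (divr_gt0 e0 C1))].
apply: filterS => n /=; rewrite (additive_tail n massU mF tF) (additive_tail n embed_setU mF tF).
have K (W : zmodType) (a b : W) : a + b - a = b by rewrite addrAC subrr add0r.
rewrite /series/= !K.
rewrite ger0_norm ?mass_ge0// ler_pdivlMr// => he.
apply: (le_trans (embed_set_le (bigcup_measurable (fun k _ => mF k)))).
by apply: le_trans he; rewrite mulrC ler_wpM2l ?mass_ge0// lerDl.
Qed.

Let bounded_variation_embed : vector_bounded_variation embed_set.
Proof.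
exists (C * mass mu setT) => n E mE tE.
apply: (@le_trans _ _ (\sum_(i < n) C * mass mu (E i))).
  by apply: ler_sum => i _; exact: embed_set_le.
rewrite -mulr_sumr ler_wpM2l// -lee_fin massE//.
rewrite -sumEFin (eq_bigr (fun i => mu (E i))); last by move=> i _; rewrite massE.
rewrite -measure_semi_additive_ord//; last by apply: bigsetU_measurable.
by apply: le_measure; rewrite ?inE//; apply: bigsetU_measurable.
Qed.

Let abs_continuous_embed : vector_abs_continuous mu embed_set.
Proof.
move=> A mA A0; apply/eqP; rewrite -normr_eq0 eq_le normr_ge0 andbT.
by apply: le_trans (embed_set_le mA) _; rewrite /mass A0/= mulr0.
Qed.

(** A density would be close to a step function, which has equal integrals over a set that
    halves its steps and over the complement of that set; but the two indicator functions
    are at distance 1 in L1. *)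
Lemma L1_no_RNP : ~ Radon_Nikodym_property V.
Proof.
move=> /(_ _ _ mu embed_set vector_measure_embed bounded_variation_embed abs_continuous_embed)[g bg Gg].
have c4 : 0 < c / 4 by rewrite divr_gt0.
have [K [p [w [mp h]]]] := bochner_step bg Gg c4.
have [B mB HB] := simultaneous_halving mp.
have mCB : measurable (~` B) by exact: measurableC.
have hB := h _ mB; have := h _ mCB.
rewrite (eq_bigr (fun k => mass mu (B `&` block p k) *: w k)); last first.
  by move=> k _; have [h1 h2] := HB k; rewrite setIC h2 setIC h1.
move: hB; set I := \sum_k _ => hB hCB.
have hd : `|embed_set B - embed_set (~` B)| <= c / 2.
  rewrite -(subrKA I) (le_trans (ler_normD _ _))//.
  by rewrite [`|I - _|]distrC; lra.
have : c <= `|embed_set B - embed_set (~` B)|.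
  rewrite addrC -scaleN1r -embed_lin; last 2 first.
  - exact: (intg01_step (fun b : bool => b%:R) (mpart_set mCB)).
  - exact: (intg01_step (fun b : bool => b%:R) (mpart_set mB)).
  have /andP[h1 _] := embed_step_norm LP (fun b : bool => -1 * (~~ b)%:R + b%:R) (mpart_set mB).
  rewrite (_ : (fun t => -1 * (t \in ~` B)%:R + _) =
      (fun t : S => -1 * (~~ (t \in B))%:R + (t \in B)%:R)); last first.
    by apply/funext => t; rewrite in_setC.
  apply: le_trans h1; rewrite big_bool/= !mulr0 !mulr1 add0r addr0 normr1 normrN1 !mul1r.
  by rewrite block_in block_notin -massU ?setICr// setUv mass01T mulr1.
by move: c0; lra.
Qed.

End L1_no_RNP.

(** * L1 fails the Schur property *)

Section rademacher.
Context {R : realType}.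
Notation mu := (@finite01 R).
Notation S := (measurableTypeR R).

Record partition := Partition {
  part_type : finType;
  part_fun :> S -> part_type;
  part_mpart : mpart part_fun }.

Arguments part_mpart : clear implicits.

Let balanced_set (p : partition) : exists B, measurable B /\
  forall k, mass mu (block p k `&` B) = mass mu (block p k) / 2 /\
            mass mu (block p k `&` ~` B) = mass mu (block p k) / 2.
Proof. by have [B mB HB] := simultaneous_halving (part_mpart p); exists B. Qed.

Let bal (p : partition) : set S := projT1 (cid (balanced_set p)).

Let mbal p : measurable (bal p).
Proof. by rewrite /bal; case: cid => B []. Qed.

Let balP (p : partition) k : mass mu (block p k `&` bal p) = mass mu (block p k) / 2 /\
               mass mu (block p k `&` ~` bal p) = mass mu (block p k) / 2.
Proof. by rewrite /bal; case: cid => B [_ /=]; exact. Qed.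

Let mpart_unit : mpart (fun _ : S => tt).
Proof.
move=> []; rewrite (_ : _ @^-1` _ = setT); first exact: measurableT.
by apply/seteqP.
Qed.

Let refine (p : partition) : partition :=
  Partition (mpart_pair (part_mpart p) (mpart_set (mbal p))).

Let level (n : nat) : partition := iter n refine (Partition mpart_unit).

(** Each function takes opposite values on the two halves of every block on which the earlier
    ones are all constant. *)
Definition rademacher (n : nat) (t : S) : R := if t \in bal (level n) then 1 else -1.

Lemma rademacher_step n : exists2 p : S -> bool, mpart p &
  rademacher n = fun t => if p t then 1 else -1.
Proof. by exists (fun t => t \in bal (level n)) => //; exact: mpart_set. Qed.

Lemma sum_mass (K : finType) (p : S -> K) : mpart p -> \sum_k mass mu (block p k) = 1.
Proof.
move=> mp; rewrite -(@mass01T R) (mass_part mu mp measurableT).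
by apply: eq_bigr => k _; rewrite setTI.
Qed.

(** Orthonormality, in the form of the Pythagorean identity: a combination of the first n
    functions is constant on the blocks which the next function halves. *)
Lemma rademacher_sum (a : nat -> R) n : exists (K : finType) (p : S -> K) (F : K -> R),
  [/\ mpart p, (fun t => \sum_(i < n) a i * rademacher i t) = (fun t => F (p t)) &
      \sum_k F k ^+ 2 * mass mu (block p k) = \sum_(i < n) a i ^+ 2].
Proof.
suff [F [FE F2]] : exists F : part_type (level n) -> R,
    (forall t, \sum_(i < n) a i * rademacher i t = F (level n t)) /\
    \sum_k F k ^+ 2 * mass mu (block (level n) k) = \sum_(i < n) a i ^+ 2.
  by exists _, (level n), F; split => //; [exact: part_mpart|exact/funext].
elim: n => [|n [F [FE F2]]].
  exists (fun=> 0); split; first by move=> t; rewrite big_ord0.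
  by rewrite big_ord0 big1// => k _; rewrite expr0n mul0r.
exists (fun kb => F kb.1 + a n * if kb.2 then 1 else -1); split.
  by move=> t; rewrite big_ord_recr/= FE.
rewrite big_ord_recr/= -F2.
have -> : a n ^+ 2 = \sum_k a n ^+ 2 * mass mu (block (level n) k).
  by rewrite -mulr_sumr (sum_mass (part_mpart (level n))) mulr1.
rewrite -big_split/=.
pose G (kb : part_type (level n) * bool) : R := (F kb.1 + a n * if kb.2 then 1 else -1) ^+ 2 *
  mass mu (block (fun x => (level n x, x \in bal (level n))) kb).
transitivity (\sum_k \sum_(b : bool) G (k, b)).
  by rewrite pair_bigA; apply: eq_bigr => -[].
apply: eq_bigr => k _; rewrite big_bool /G/= !block_pair.
rewrite block_in block_notin; have [-> ->] := balP k; lra.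
Qed.

End rademacher.

Section L1_no_Schur.
Context {R : realType} {V : normedModType R}.
Notation L1 := (LfunType (@lebesgue01 R) (lexx 1%E)).
Notation mu := (@finite01 R).
Notation S := (measurableTypeR R).
Variables (L : {linear L1 -> V}) (c C : R).
Hypotheses (c0 : 0 < c) (LP : forall f : L1,
  c * fine 'N[@lebesgue01 R]_1[EFin \o f] <= `|L f| <= C * fine 'N[@lebesgue01 R]_1[EFin \o f]).

Let intg_rademacher n : (@lebesgue01 R).-integrable setT (EFin \o rademacher n).
Proof.
have [p mp ->] := @rademacher_step R n.
exact: (intg01_step (fun b : bool => (if b then 1 else -1) : R) mp).
Qed.

Lemma embed_rademacher_sum (a : nat -> R) n :
  embed L (fun t => \sum_(i < n) a i * rademacher i t) =
  \sum_(i < n) a i *: embed L (rademacher i).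
Proof.
elim: n => [|n ih].
  rewrite big_ord0; have /andP[_] := embed_step_norm LP (fun=> 0) (mpart_set (@measurableT _ S)).
  rewrite big1 ?mulr0 ?normr_le0; last by move=> k _; rewrite normr0 mul0r.
  by move/eqP => h; rewrite -[RHS]h; congr (embed L _); apply/funext => t; rewrite big_ord0.
rewrite big_ord_recr/= -ih addrC -embed_lin//.
  by congr (embed L _); apply/funext => t; rewrite big_ord_recr/= addrC.
have [K [p [F [mp -> _]]]] := rademacher_sum a n; exact: intg01_step.
Qed.

(** Bessel: if the coefficients a i of a functional f have square sum s over i < n, then
    s is the value of f at the combination with coefficients a i, whose norm in L1 is at
    most its norm in L2; the latter bound is used in the linear form
    |y| <= y^2 / (4 t) + t, with t = D + 1 and D = |f| |C|. *)
Lemma rademacher_coef_bound (f : dual_space V) n :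
  \sum_(i < n) f (embed L (rademacher i)) ^+ 2 <=
  4 * (`|f| * `|C|) * (`|f| * `|C| + 1).
Proof.
set a := fun i => f (embed L (rademacher i)); set s := \sum_(i < n) _.
set D := `|f| * `|C|; have D0 : 0 <= D by rewrite mulr_ge0.
have [K [p [F [mp FE F2]]]] := rademacher_sum a n.
have s0 : 0 <= s by apply: sumr_ge0 => i _; exact: sqr_ge0.
have fs : f (embed L (fun t => F (p t))) = s.
  rewrite -FE embed_rademacher_sum dual_sum; apply: eq_bigr => i _.
  by rewrite dualZ -expr2.
have hs : s <= D * (s / (4 * (D + 1)) + (D + 1)).
  rewrite -{1}fs (le_trans (ler_norm _))// (le_trans (dual_le _ _))// -mulrA ler_wpM2l//.
  have /andP[_ h] := embed_step_norm LP F mp; apply: (le_trans h).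
  have m0 : 0 <= \sum_k `|F k| * mass mu (block p k).
    by apply: sumr_ge0 => k _; rewrite mulr_ge0// mass_ge0.
  rewrite (le_trans (ler_wpM2r m0 (ler_norm C)))// ler_wpM2l//.
  rewrite -[s]F2 mulr_suml.
  have e1 : D + 1 = \sum_k (D + 1) * mass mu (block p k) by rewrite -mulr_sumr (sum_mass mp) mulr1.
  rewrite [X in _ <= _ + X]e1 -big_split/=.
  apply: ler_sum => k _; rewrite mulrAC -mulrDl ler_wpM2r ?mass_ge0//.
  have D4 : 0 < 4 * (D + 1) by lra.
  rewrite -lerBlDr ler_pdivlMr// -[F k ^+ 2]real_normK ?num_real//.
  have := sqr_ge0 (`|F k| - 2 * (D + 1)); nra.
have : D * (s / (4 * (D + 1))) <= s / 4.
  rewrite mulrA ler_pdivrMr; last by lra.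
  nra.
nra.
Qed.

Lemma L1_no_Schur : ~ Schur_property V.
Proof.
move=> /(_ (fun n => embed L (rademacher n)) 0) H.
have /H : weakly_cvg (fun n => embed L (rademacher n)) 0.
  move=> f; rewrite dual0.
  have /cvg_series_cvg_0 : cvgn (series (fun n => f (embed L (rademacher n)) ^+ 2)).
    apply: nondecreasing_is_cvgn.
      by apply: nondecreasing_series => n _ _; exact: sqr_ge0.
    exists (4 * (`|f| * `|C|) * (`|f| * `|C| + 1)) => _ [n _ <-].
    by rewrite /series/= big_mkord rademacher_coef_bound.
  move=> /cvgrPdist_le h; apply/cvgrPdist_le => e e0.
  apply: filterS (h _ (exprn_gt0 2 e0)) => n.
  rewrite !sub0r !normrN normrX; rewrite ler_pXn2r ?nnegrE//; exact: ltW.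
move=> /cvgrPdist_le/(_ (c / 2)); rewrite divr_gt0// => /(_ isT)[n _ /(_ n (leqnn n))/=].
rewrite sub0r normrN; have [p mp ->] := @rademacher_step R n.
have /andP[+ _] := embed_step_norm LP (fun b : bool => (if b then 1 else -1) : R) mp.
rewrite (eq_bigr (fun b => mass mu (block p b))); last first.
  by move=> [] _; rewrite ?normrN ?normr1 mul1r.
rewrite sum_mass// mulr1 => h1 h2; move: (le_trans h1 h2) c0; lra.
Qed.

End L1_no_Schur.

(** * Length measure and the equivalence *)

Section length_measure.
Context {R : realType} {T : metricType R} (hT : is_rtree T).
Notation mu := (@lebesgue_measure R).

Lemma segment_measure_geodesic (E : set T) (x y : T) g : x <> y -> geodesic x y g ->
  segment_measure E x y = mu (`[0, mdist x y] `&` [set t | E (g t)]).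
Proof.
move=> xy gg; rewrite /segment_measure (segment_geodesic hT xy gg); congr (mu _).
apply/seteqP; split => t /=.
  move=> [z [Ez [s + gs]] <-]; rewrite /= in_itv/= => sd; rewrite -gs in Ez *.
  by rewrite (geodesic_dist0 gg sd).
rewrite in_itv/= => -[td Eg]; exists (g t); last exact: geodesic_dist0 gg td.
by split => //; exists t => //=; rewrite in_itv.
Qed.

Lemma length_measure_eq0 (E : set T) :
  length_measure E = 0%E <-> forall x y, x <> y -> segment_measure E x y = 0%E.
Proof.
split=> [E0 x y xy|E0].
  apply/eqP; rewrite eq_le measure_ge0 andbT -E0; apply: ereal_sup_ubound.
  exists 1%N, (fun=> (x, y)); split => //; last by rewrite big_ord1.
  by move=> i j _ _ _; rewrite !ord1.
apply/eqP; rewrite eq_le; apply/andP; split.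
  apply: ge_ereal_sup => _ [n [p [pn _ ->]]].
  by rewrite big1// => i _; exact: E0.
apply: ereal_sup_ubound; exists 0%N, (fun i : 'I_0 => False_rect _ (notF (ltn_ord i))).
by split; [case|case|rewrite big_ord0].
Qed.

Lemma null_length_rays (M : set T) (o x : M) : length_measure M = 0%E ->
  mu (`[0, mdist (set_val o) (set_val x)] `&` [set t | M (ray hT o (set_val x) t)]) = 0%E.
Proof.
move=> /length_measure_eq0 M0; have [xo|xo] := pselect (set_val o = set_val x).
  rewrite xo mdistxx set_itv1; set E := _ `&` _.
  by have [->|->] : E = set0 \/ E = [set 0] := subset_set1 (@subIsetl _ _ _); rewrite ?measure0 ?lebesgue_measure_set1.
rewrite -segment_measure_geodesic//; first exact: M0.
exact: ray_geodesic.
Qed.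

(** A segment meeting M in positive length carries an isometric copy of a closed set of
    positive measure of the line, and M retracts onto the line by a Gromov product. *)
Lemma positive_length_contains_L1 (M : set T) (o : M) : closed M ->
  length_measure M <> 0%E -> contains_L1 (free_space o).
Proof.
move=> cM M0.
have [x [y [xy s0]]] : exists x y, x <> y /\ segment_measure M x y <> 0%E.
  apply: contrapT => h; apply: M0; apply/length_measure_eq0 => x y xy.
  by apply: contrapT => s0; apply: h; exists x, y.
have [g [gg _]] := geodesic_exists hT x y; have [_ _ gi] := gg.
pose d := mdist x y; have d0 : 0 <= d := mdist_ge0 _ _.
pose K : set R := `[0, d] `&` [set t | M (g t)].
have Kd t : K t -> 0 <= t <= d by move=> [+ _]; rewrite /= in_itv.
have cK : closed K.
  have -> : K = `[0, d] `&` ((g \o clamp d) @^-1` M).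
    by apply/seteqP; split => t [/= td]; move: (td); rewrite in_itv/= => /clamp_id ->.
  apply: closedI; first exact: interval_closed.
  apply: closed_comp => // t _; apply: lipschitz_continuous => {}s {}t /=.
  by rewrite gi ?clamp_itv// clamp_lip.
pose kap (t : R) : M := if pselect (M (g t)) is left h then exist (fun z => z \in M) _ (mem_set h) else o.
have kapE t : K t -> set_val (kap t) = g t.
  by move=> [_ Mt]; rewrite /kap; case: pselect => // h.
pose gromov (z : M) : R := (mdist x (set_val z) + d - mdist y (set_val z)) / 2.
apply: (@contains_L1_of_line R M o K kap gromov d) => //.
- move=> s t Ks Kt; rewrite -gi ?Kd// -!kapE//.
- move=> u v; have tr := @metric_triangle R T.
  have h1 := tr x (set_val u) (set_val v); have h2 := tr x (set_val v) (set_val u).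
  have h3 := tr y (set_val u) (set_val v); have h4 := tr y (set_val v) (set_val u).
  rewrite (metric_sym (set_val v)) in h2 h4.
  have -> : mdist u v = mdist (set_val u) (set_val v) by [].
  by rewrite /gromov ler_norml; apply/andP; split; lra.
- move=> t Kt; have td := Kd _ Kt; rewrite /gromov kapE// (geodesic_dist0 gg td).
  by rewrite metric_sym (geodesic_dist1 gg td) -/d; lra.
- by rewrite lt0e measure_ge0 andbT -(segment_measure_geodesic M xy gg); exact/eqP.
Qed.

End length_measure.

Theorem corollary2p5 (R : realType) (T : metricType R) (hT : is_rtree T)
    (M : set T) (hM : closed M) (o : M) :
  [<-> length_measure M = 0%E;
       Schur_property (free_space o);
       Radon_Nikodym_property (free_space o);
       ~ contains_L1 (free_space o)].
Proof.
have tame0 : length_measure M = 0%E -> tame (fun m : free_space o => `|m|).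
  by move=> M0; apply: (tame_free_norm (hT := hT)) => // x; exact: null_length_rays.
tfae.
- by move=> /tame0; exact: tame_Schur.
- move=> sch; apply: tame_RNP; first exact: free_complete.
  apply: tame0; apply: contrapT => /(positive_length_contains_L1 hT o hM)[L [c [C [c0 LP]]]].
  exact: L1_no_Schur c0 LP sch.
- by move=> rnp [L [c [C [c0 LP]]]]; exact: L1_no_RNP c0 LP rnp.
- by move=> nL; apply: contrapT => /(positive_length_contains_L1 hT o hM).
Qed.
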